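(* For each $n\in\mathbb{N}$, let $U^n=(U^n_1,\ldots,U^n_n)$ be uniformly distributed on the sphere $\sqrt{dn}\,\mathbb{S}^{dn-1}\subset\mathbb{R}^{dn}$ of radius $\sqrt{dn}$, where $U^n_i\in\mathbb{R}^d$ denotes the $i$th block of $d$ coordinates. Let $\gamma$ be the standard Gaussian measure on $\mathbb{R}^d$, and define $\alpha:\mathbb{R}\to[0,\infty]$ by $\alpha(x)=2d\arcsin^2\!\big(\sqrt x/(2\sqrt d)\big)$ if $0\le x\le4d$ and $\alpha(x)=\infty$ otherwise. Let $r>0$. For any bounded continuous functions $f$ and $g$ on $\mathbb{R}^d$ satisfying $f(x)-g(y)\le|x-y|^2$ for all $x,y\in\mathbb{R}^d$, we have $$\limsup_{n\to\infty}\frac1n\log\mathbb{P}\bigg(\frac1n\sum_{i=1}^nf\Big(U^n_i-\frac1n\sum_{j=1}^nU^n_j\Big)\ge\int g\,d\gamma+r\bigg)\le-\alpha(r).$$ Moreover, $$\limsup_{n\to\infty}\frac1n\log\mathbb{P}\big(\mathcal W_1(\mathsf CL_n(U^n),\gamma)\ge r\big)\le-\alpha(r^2).$$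
   Context: $L_n(U^n)=\frac1n\sum_{i=1}^n\delta_{U^n_i}$ is the empirical measure, and $\mathsf C$ is the centering map translating a measure to have mean zero, so that $\mathsf CL_n(U^n)=\frac1n\sum_{i=1}^n\delta_{U^n_i-\frac1n\sum_{j=1}^nU^n_j}$. $\mathcal W_1$ is the 1-Wasserstein distance on probability measures on $\mathbb{R}^d$ with finite first moment. Convention $\log0=-\infty$. *)

(* Defs.v *)
From HB Require Import structures.
From mathcomp Require Import all_boot all_order all_algebra.
From mathcomp Require Import all_classical all_reals all_analysis.

Set Implicit Arguments.
Unset Strict Implicit.
Unset Printing Implicit Defensive.

Import Order.TTheory GRing.Theory Num.Theory.
Import numFieldNormedType.Exports.

Local Open Scope classical_set_scope.
Local Open Scope ring_scope.

(* Borel sigma-algebra on real matrices, in particular on R^n = 'rV[R]_n. *)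
HB.instance Definition _ (R : realType) (m n : nat) :=
  @isMeasurable.Build (sigma_display (@open 'M[R]_(m, n))) 'M[R]_(m, n)
    <<s @open 'M[R]_(m, n) >>
    (@sigma_algebra0 _ setT _) (@sigma_algebraC _ _)
    (@sigma_algebra_bigcup _ setT _).

Section Defs.
Variable R : realType.

(* Euclidean norm; the norm that the library puts on matrices is the sup norm. *)
Definition enorm n (x : 'rV[R]_n) : R := Num.sqrt (\sum_(i < n) x 0 i ^+ 2).

(* The uniform distribution on the sphere of radius rho centered at 0 in R^n is
   the unique rotation-invariant Borel probability measure carried by it.
   Invariance is under the whole orthogonal group O(n), so that for n = 1 the
   two points of the sphere get equal mass. *)
Definition uniform_on_sphere n (rho : R) (mu : probability 'rV[R]_n R) : Prop :=
  mu [set x | enorm x = rho] = 1%E /\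
  forall Q : 'M[R]_n, Q *m Q^T = 1%:M ->
  forall A : set 'rV[R]_n, measurable A ->
  pushforward mu (fun x => x *m Q) A = mu A.

(* The n-fold product of the standard normal law N(0, 1). *)
Definition standard_gaussian n (mu : probability 'rV[R]_n R) : Prop :=
  forall A : 'I_n -> set R, (forall i, measurable (A i)) ->
  mu [set x | forall i, A i (x 0 i)] = (\prod_(i < n) normal_prob 0 1 (A i))%E.

(* vec_mx is row-major: the i-th block consists of the coordinates
   i * d, ..., i * d + d - 1 of u. *)
Definition block n d (u : 'rV[R]_(n * d)) (i : 'I_n) : 'rV[R]_d :=
  row i (vec_mx u).

Definition average n d (x : 'I_n -> 'rV[R]_d) : 'rV[R]_d :=
  n%:R^-1 *: \sum_(j < n) x j.

Definition empirical n d (x : 'I_n -> 'rV[R]_d) : set 'rV[R]_d -> \bar R :=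
  fun A => ((n%:R^-1)%:E * \sum_(i < n) \d_(x i) A)%E.

Definition mean d (mu : set 'rV[R]_d -> \bar R) : 'rV[R]_d :=
  \row_j fine (\int[mu]_x (x 0 j)%:E).

Definition centering d (mu : set 'rV[R]_d -> \bar R) : set 'rV[R]_d -> \bar R :=
  pushforward mu (fun x => x - mean mu).

Definition coupling d (mu nu : set 'rV[R]_d -> \bar R)
    (pi : probability ('rV[R]_d * 'rV[R]_d)%type R) : Prop :=
  forall A : set 'rV[R]_d, measurable A ->
  pushforward pi fst A = mu A /\ pushforward pi snd A = nu A.

(* 1-Wasserstein distance; meant for probability measures with finite first
   moment (it is +oo when there is no coupling). *)
Definition W1 d (mu nu : set 'rV[R]_d -> \bar R) : \bar R :=
  ereal_inf [set (\int[pi]_z (enorm (z.1 - z.2))%:E)%E | pi in coupling mu nu].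

Definition alpha (d : nat) (x : R) : \bar R :=
  if 0 <= x <= 4 * d%:R
  then (2 * d%:R * asin (Num.sqrt x / (2 * Num.sqrt d%:R)) ^+ 2)%:E
  else +oo%E.

End Defs.

(* Main.v *)
Require Import Defs.
From HB Require Import structures.
From mathcomp Require Import all_boot all_order all_algebra.
From mathcomp Require Import all_classical all_reals all_analysis.
From mathcomp Require Import measurable_realfun ring lra.
Import Order.TTheory GRing.Theory Num.Theory.
Import numFieldNormedType.Exports.
Local Open Scope classical_set_scope.
Local Open Scope ring_scope.
Set Implicit Arguments.
Unset Strict Implicit.
Unset Printing Implicit Defensive.

(* Write N = n * d, let gamma_N be the standard Gaussian measure on R^N, and let u range over the
   bad event A on the sphere of radius sqrt N. By the law of large numbers a gamma_N-typical y has
   |y|^2 close to N, mean close to 0 and block empirical measure close to gamma, and for such y the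
   bad event forces |u - y|^2 >= n (r - o(1)) (with r ^ 2 in place of r for the W_1 statement).

   Fix a >= 1. If |g| is close to a sqrt N, the point x = (|g| / sqrt N) u satisfies
   |x - y|^2 >= N ((a - 1)^2 + a r / d - o(1)), so Gaussian concentration with the sharp exponent 1/2
   (Maurey's property tau, tensorized from the one-dimensional Prekopa-Leindler inequality) bounds the
   Gaussian measure of a neighbourhood of these x. By polar decomposition that measure is at least
   P(A) gamma_N(|g| close to a sqrt N), and tilting to variance a^2 bounds the last factor from below
   by exp(N (ln a - (a^2 - 1) / 2 - o(1))). Altogether
     limsup (1/n) log P(A) <= d (a q - 1 - ln a)   with q = 1 - r / (2 d).
   If q > 0, take a = 1 / q: the bound is d ln q <= - alpha r, because q = cos (2 phi) with
   phi = asin (sqrt (r / (4 d))) and ln cos t <= - t^2 / 2. If q <= 0, let a tend to infinity. *)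

(** * Prekopa-Leindler inequality on the line *)

(** The change of radius is what produces the rate. With [a = 1] concentration alone gives only
    [- r / 2], which is weaker than [- alpha r] since arcsin t >= t. Moving [u] out by a factor [a]
    multiplies the gain due to the bad event by [a], at the price of the Gaussian improbability of
    that radius; [a q - 1 - ln a] is the balance of the two and [a = 1 / q] minimises it.

    The exponent 1/2 of the concentration bound must not be lost on the way: property tau with equal
    weights would give 1/4. Weights [1 - l] and [l] give [l / 2]; the constant that explodes as [l]
    tends to 1 depends on [l] only, so it disappears in (1/n) log.

    Polar decomposition is obtained without spherical coordinates or a surface measure. Smoothing by
    a kernel that depends only on norms and a scalar product makes invariance under the orthogonal
    group sufficient, and the smoothing parameter tends to 0 while the dimension stays fixed. *)

Section Lebesgue1.
Variable R : realType.
Local Notation mu := (@lebesgue_measure R).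
Implicit Types (A B C : set R) (k b : R).

(** The right-hand side is a measure in [A], so it is enough to compare the two sides on half-open
    intervals. *)
Lemma lebesgue_measure_affine k b A : 0 < k -> measurable A ->
  mu A = (k%:E * mu ((fun x => (k * x + b)%R) @^-1` A))%E.
Proof.
move=> k0 mA.
pose f (x : measurableTypeR R) : measurableTypeR R := k * x + b.
have mf : measurable_fun setT f by apply: measurable_funD => //; exact: measurable_funM.
pose m := mscale (NngNum (ltW k0)) (measure_function_pushforward__canonical__measure_function_Measure mu mf).
apply: (lebesgue_measure_unique (mu := m)) => // _ [[a c]] _ <-.
transitivity (k%:E * mu (f @^-1` `](a, c).1, (a, c).2]%classic))%E; last by [].
have -> : f @^-1` `](a, c).1, (a, c).2]%classic = `](a - b) / k, (c - b) / k]%classic.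
  by apply/seteqP; split=> x /=; rewrite /f !in_itv/= ltr_pdivrMr// ler_pdivlMr// ltrBlDr lerBrDr (mulrC x).
rewrite !lebesgue_measure_itv/= !lte_fin ltr_pM2r ?invr_gt0// ltrD2r.
case: ifP => // _; last by rewrite mule0.
rewrite -!EFinD -EFinM; congr EFin; field; exact: lt0r_neq0.
Qed.

(** The supremum need not be attained. A point of [A] within [e] of it loses at most an interval of
    length [e], and it has to lie in [A] because it is later combined with points of [B]. *)
Lemma near_sup_split A e : measurable A -> A !=set0 -> has_ubound A -> 0 < e ->
  exists2 a, A a & (mu A <= mu (A `&` `]-oo, a[) + e%:E)%E.
Proof.
move=> mA A0 ubA e0.
have [a Aa ltea] : exists2 a, A a & sup A - e < a.
  by apply: sup_adherent.
exists a => //.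
have sub : A `<=` (A `&` `]-oo, a[) `|` `[a, a + e].
  move=> x Ax /=; rewrite !in_itv/=.
  have [xa|ax] := ltP x a; [by left|right].
  by rewrite (le_trans (sup_upper_bound _ Ax))//; rewrite -lerBlDr ltW.
have mAi : measurable (A `&` `]-oo, a[) by apply: measurableI.
apply: (@le_trans _ _ (mu (A `&` `]-oo, a[) + mu `[a, (a + e)%R])%E).
  apply: (@le_trans _ _ (mu ((A `&` `]-oo, a[) `|` `[a, a + e]))).
    by apply: le_measure; rewrite ?inE//; exact: measurableU.
  exact: measureU2.
rewrite leeD2l//= lebesgue_measure_itv/= lte_fin ltrDl e0.
by rewrite -EFinD addrAC subrr add0r.
Qed.

Lemma near_inf_split A e : measurable A -> A !=set0 -> has_lbound A -> 0 < e ->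
  exists2 a, A a & (mu A <= mu (A `&` `[a, +oo[) + e%:E)%E.
Proof.
move=> mA A0 lbA e0.
have [a Aa ltea] : exists2 a, A a & a < inf A + e.
  by apply: inf_adherent.
exists a => //.
have sub : A `<=` (A `&` `[a, +oo[) `|` `[a - e, a[.
  move=> x Ax /=; rewrite !in_itv/= andbT.
  have [xa|ax] := leP a x; [by left|right].
  by rewrite andbT lerBlDr (le_trans (ltW ltea))// lerD2r inf_lbound.
have mAi : measurable (A `&` `[a, +oo[) by apply: measurableI.
apply: (@le_trans _ _ (mu (A `&` `[a, +oo[) + mu `[(a - e)%R, a[)%E).
  apply: (@le_trans _ _ (mu ((A `&` `[a, +oo[) `|` `[a - e, a[))).
    by apply: le_measure; rewrite ?inE//; exact: measurableU.
  exact: measureU2.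
rewrite leeD2l//= lebesgue_measure_itv/= lte_fin gtrBl e0.
by rewrite -EFinD opprB addrC subrK.
Qed.

(** Take [a] near the top of [A] and [b] near the bottom of [B]. The part of [A] below [a], combined
    with the single point [b], and the part of [B] above [b], combined with the single point [a],
    give affine copies inside [C] on the two sides of [m], so that their measures add up. Hence each
    set has to be bounded on one side only. *)
Lemma Brunn_Minkowski1 l A B C : 0 < l < 1 ->
  measurable A -> measurable B -> measurable C ->
  A !=set0 -> B !=set0 -> has_ubound A -> has_lbound B ->
  (forall a b, A a -> B b -> C ((1 - l) * a + l * b)) ->
  ((1 - l)%:E * mu A + l%:E * mu B <= mu C)%E.
Proof.
move=> /andP[l0 l1] mA mB mC A0 B0 ubA lbB ABC.
have k0 : 0 < 1 - l by rewrite subr_gt0.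
apply/lee_addgt0Pr => e e0.
have [a Aa leA] := near_sup_split mA A0 ubA e0.
have [b Bb leB] := near_inf_split mB B0 lbB e0.
set m := (1 - l) * a + l * b.
have mC1 : measurable (C `&` `]-oo, m[) by apply: measurableI.
have mC2 : measurable (C `&` `[m, +oo[) by apply: measurableI.
have maff k c D : measurable D -> measurable ((fun x : R => (k * x + c)%R) @^-1` D).
  move=> mD; rewrite -[X in measurable X]setTI.
  have mf : measurable_fun setT (fun x : R => (k * x + c)%R).
    by apply: measurable_funD => //; exact: measurable_funM.
  exact: mf.
have hA : ((1 - l)%:E * mu (A `&` `]-oo, a[) <= mu (C `&` `]-oo, m[))%E.
  rewrite (@lebesgue_measure_affine (1 - l) (l * b) (C `&` `]-oo, m[))//.
  apply: lee_pmul => //; first by rewrite lee_fin ltW.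
  apply: le_measure; rewrite ?inE; [exact: measurableI|exact: maff|].
  move=> x [Ax]; rewrite /= !in_itv/= => xa; split; first exact: ABC.
  by rewrite ltrD2r ltr_pM2l.
have hB : (l%:E * mu (B `&` `[b, +oo[) <= mu (C `&` `[m, +oo[))%E.
  rewrite (@lebesgue_measure_affine l ((1 - l) * a) (C `&` `[m, +oo[))//.
  apply: lee_pmul => //; first by rewrite lee_fin ltW.
  apply: le_measure; rewrite ?inE; [exact: measurableI|exact: maff|].
  move=> x [Bx]; rewrite /= !in_itv/= !andbT => xb; split.
    by rewrite addrC; exact: ABC.
  by rewrite /m addrC lerD2r ler_pM2l.
apply: (@le_trans _ _ (mu (C `&` `]-oo, m[) + mu (C `&` `[m, +oo[) + e%:E)%E); last first.
  rewrite leeD2r// -measureU//; last first.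
    apply/seteqP; split => x //= [[_ xm] [_]]; move: xm.
    by rewrite !in_itv/= andbT => xm; rewrite leNgt xm.
  by apply: le_measure; rewrite ?inE; [exact: measurableU| |move=> x [] []].
apply: (@le_trans _ _ ((1 - l)%:E * (mu (A `&` `]-oo, a[) + e%:E) + l%:E * (mu (B `&` `[b, +oo[) + e%:E))%E).
  by apply: leeD; apply: lee_pmul => //; rewrite lee_fin ltW.
rewrite !ge0_muleDr// ?lee_fin ?(ltW e0)// addeACA -!EFinM -EFinD -mulrDl subrK mul1r.
by rewrite leeD2r// leeD.
Qed.

Let level_set (F : R -> R) := [set z : measurableTypeR R * measurableTypeR R | z.2 < F z.1].

Let measurable_level_set (F : R -> R) : measurable_fun setT F -> measurable (level_set F).
Proof.
move=> mF; rewrite -[X in measurable X]setTI; apply: measurable_fun_ltr => //.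
exact: measurableT_comp.
Qed.

Lemma measurable_layer (F : R -> R) : measurable_fun setT F ->
  measurable_fun setT (fun t : R => mu [set x | (t < F x)%R]).
Proof.
move=> mF.
rewrite (_ : (fun t => _) = mu \o ysection (level_set F)).
  exact: measurable_fun_ysection (measurable_level_set mF).
by apply/funext => t /=; congr (mu _); apply/seteqP; split=> x; rewrite /ysection/= inE.
Qed.

(** Tonelli on the region [0 < t < F x]; the levels stop at 1 because [F] does. *)
Lemma layer_cake (F : R -> R) : measurable_fun setT F -> (forall x, 0 <= F x <= 1) ->
  (\int[mu]_x (F x)%:E = \int[mu]_(t in `]0%R, 1%R[) mu [set x | (t < F x)%R])%E.
Proof.
move=> mF F01.
pose S := [set z : measurableTypeR R * measurableTypeR R | 0 < z.2] `&` level_set F.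
have mS : measurable S.
  apply: measurableI; last exact: measurable_level_set.
  by rewrite -[X in measurable X]setTI; exact: measurable_fun_ltr.
have mi : measurable_fun setT (fun z : measurableTypeR R * measurableTypeR R => (\1_S z)%:E : \bar R).
  by apply/measurable_EFinP; exact: measurable_indic.
have i0 z : (0 <= (\1_S z)%:E :> \bar R)%E by rewrite lee_fin.
have := @fubini_tonelli _ _ _ _ R mu mu _ mi i0.
have -> : (\int[mu]_x \int[mu]_y (\1_S (x, y))%:E = \int[mu]_x (F x)%:E)%E.
  apply: eq_integral => x _ /=.
  rewrite (_ : (fun y => _) = (fun y => (\1_(`]0%R, F x[%classic : set R) y)%:E)); last first.
    apply/funext => y; congr (_%:E); rewrite !indicE; congr (nat_of_bool _)%:R.
    by apply/idP/idP; rewrite !inE/= in_itv/=; [move=> [-> ->]|move=> /andP[]].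
  rewrite integral_indic//= setIT lebesgue_measure_itv/= lte_fin.
  have /andP[F0 _] := F01 x; case: ltP => [_|]; first by rewrite oppr0 adde0.
  by move=> F0'; congr (_%:E); apply/eqP; rewrite eq_le F0.
move=> ->; rewrite [RHS]integral_mkcond; apply: eq_integral => t _ /=.
rewrite patchE.
have mlt : measurable [set x | (t < F x)%R].
  by rewrite -[X in measurable X]setTI; exact: measurable_fun_ltr.
case: ifPn => [/set_mem|/negP t01] /=.
  rewrite in_itv/= => /andP[t0 t1].
  rewrite (_ : (fun x => _) = (fun x => (\1_[set x | (t < F x)%R] x)%:E)); last first.
    apply/funext => x; congr (_%:E); rewrite !indicE; congr (nat_of_bool _)%:R.
    by apply/idP/idP; rewrite !inE/=; [move=> []|move=> ?; split].
  by rewrite integral_indic// setIT.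
apply: integral0_eq => x _; rewrite indicE memNset//= => -[/= t0 tF].
apply: t01; rewrite inE/= in_itv/= t0 (lt_le_trans tF)//.
by have /andP[] := F01 x.
Qed.

(** Suprema equal to 1 make the level sets of [F] and [G] non-empty for every [t < 1], so
    Brunn-Minkowski can be integrated over [t]. The outcome has the arithmetic mean of the integrals
    on the left, which is stronger than the usual geometric mean. *)
Lemma Prekopa_Leindler1 l (F G H : R -> R) : 0 < l < 1 ->
  measurable_fun setT F -> measurable_fun setT G -> measurable_fun setT H ->
  (forall x, 0 <= F x <= 1) -> (forall x, 0 <= G x <= 1) -> (forall x, 0 <= H x) ->
  (forall t, t < 1 -> exists x, t < F x) -> (forall t, t < 1 -> exists x, t < G x) ->
  (forall t, 0 < t -> has_ubound [set x | t < F x]) ->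
  (forall t, 0 < t -> has_lbound [set x | t < G x]) ->
  (forall t x y, 0 < t -> t < F x -> t < G y -> t < H ((1 - l) * x + l * y)) ->
  ((1 - l)%:E * \int[mu]_x (F x)%:E + l%:E * \int[mu]_x (G x)%:E
    <= \int[mu]_x (H x)%:E)%E.
Proof.
move=> l01 mF mG mH F01 G01 H0 exF exG ubF lbG FGH.
have /andP[l0 l1] := l01.
have k0 : 0 <= 1 - l by rewrite subr_ge0 ltW.
(* Capping [H] at 1 leaves the levels [t < 1] unchanged and makes [layer_cake] applicable. *)
pose H1 x := Num.min (H x) 1.
have mH1 : measurable_fun setT H1 by exact: measurable_minr.
have H101 x : 0 <= H1 x <= 1 by rewrite /H1 le_min H0 ler01 ge_min lexx orbT.
have mlt (K : R -> R) t : measurable_fun setT K -> measurable [set x | t < K x].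
  by move=> mK; rewrite -[X in measurable X]setTI; exact: measurable_fun_ltr.
apply: (@le_trans _ _ (\int[mu]_x (H1 x)%:E)%E); last first.
  apply: ge0_le_integral => //=.
  - by move=> x _; rewrite lee_fin; have /andP[] := H101 x.
  - exact/measurable_EFinP.
  - exact/measurable_EFinP.
  - by move=> x _; rewrite lee_fin /H1 ge_min lexx.
rewrite !layer_cake//.
have mL (K : R -> R) : measurable_fun setT K ->
    measurable_fun (`]0, 1[%classic : set R) (fun t : R => mu [set x | (t < K x)%R]).
  by move=> mK; apply: measurable_funTS; exact: measurable_layer.
rewrite -!ge0_integralZl_EFin//; [|exact: mL|exact: ltW|exact: mL].
rewrite -ge0_integralD//; first last.
- by apply: measurable_funeM; exact: mL.
- by move=> x _; rewrite mule_ge0// lee_fin ltW.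
- by apply: measurable_funeM; exact: mL.
- by move=> x _; rewrite mule_ge0// lee_fin ltW.
apply: ge0_le_integral => //=.
- by move=> x _; rewrite adde_ge0// mule_ge0// lee_fin ltW.
- by apply: emeasurable_funD; apply: measurable_funeM; exact: mL.
- exact: mL.
move=> t; rewrite in_itv/= => /andP[t0 t1].
apply: Brunn_Minkowski1 => //; [exact: mlt|exact: mlt|exact: mlt|exact: exF|exact: exG|exact: ubF|exact: lbG|].
by move=> x y /= tF tG; rewrite /H1 lt_min t1 andbT; exact: FGH.
Qed.
End Lebesgue1.

Lemma weighted_amgm (R : realType) (l a b : R) : 0 < l < 1 -> 0 <= a -> 0 <= b ->
  a `^ (1 - l) * b `^ l <= (1 - l) * a + l * b.
Proof.
move=> /andP[l0 l1] a0 b0.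
have k0 : 0 < 1 - l by rewrite subr_gt0.
have := @conjugate_powR _ (a `^ (1 - l)) (b `^ l) (1 - l)^-1 l^-1.
rewrite !powR_ge0 !invr_gt0 !invrK subrK => /(_ isT isT k0 l0 erefl).
by rewrite -!powRrM !mulfV ?lt0r_neq0// !powRr1// (mulrC a) (mulrC b).
Qed.

(** * Integration against a measure with a density *)

Section density.
Context d (T : measurableType d) (R : realType).
Variables (nu mu : {measure set T -> \bar R}) (f : T -> R).
Hypotheses (mf : measurable_fun setT f) (f0 : forall x, 0 <= f x).
Hypothesis nuE : forall A, measurable A -> (nu A = \int[mu]_(x in A) (f x)%:E)%E.
Import HBNNSimple.
Local Open Scope ereal_scope.

Lemma ge0_integral_density (g : T -> \bar R) : measurable_fun setT g ->
  (forall x, 0 <= g x) -> \int[nu]_x g x = \int[mu]_x (g x * (f x)%:E).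
Proof.
move=> mg g0.
have mfE : measurable_fun setT (EFin \o f) by exact/measurable_EFinP.
pose h := nnsfun_approx measurableT mg.
have cvgh x : (EFin \o h ^~ x) n @[n --> \oo] --> g x.
  by apply: cvg_nnsfun_approx.
have -> : \int[nu]_x g x = lim (\int[nu]_x (h n x)%:E @[n --> \oo]).
  rewrite -monotone_convergence//=.
  - by apply: eq_integral => x _; apply/esym/cvg_lim => //; exact: cvgh.
  - by move=> n; apply/measurable_EFinP.
  - by move=> n x _; rewrite lee_fin.
  - by move=> x _ a b ab; rewrite lee_fin; exact/lefP/nd_nnsfun_approx.
have -> : \int[mu]_x (g x * (f x)%:E) =
    lim (\int[mu]_x ((h n x)%:E * (f x)%:E) @[n --> \oo]).
  rewrite -monotone_convergence//=.
  - apply: eq_integral => x _; apply/esym/cvg_lim => //; apply: cvgeZr => //.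
    exact: cvgh.
  - by move=> n; apply: emeasurable_funM => //; exact/measurable_EFinP.
  - by move=> n x _; rewrite mule_ge0// lee_fin.
  - by move=> x _ a b ab; rewrite lee_wpmul2r ?lee_fin//; exact/lefP/nd_nnsfun_approx.
suff suf n : \int[nu]_x (h n x)%:E = \int[mu]_x ((h n x)%:E * (f x)%:E).
  by under eq_fun do rewrite suf.
rewrite integralT_nnsfun sintegralE.
under [RHS]eq_integral => x _.
  rewrite fimfunE -fsumEFin// ge0_mule_fsuml; last first.
    by move=> y; exact: nnfun_muleindic_ge0.
  over.
rewrite ge0_integral_fsum//; first last.
- move=> y x _; apply: mule_ge0; last by rewrite lee_fin.
  by rewrite EFinM; exact: nnfun_muleindic_ge0.
- move=> y; apply: emeasurable_funM => //; apply/measurable_EFinP.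
  by apply: measurable_funM => //; exact: measurable_indic.
apply: eq_fsbigr => r /set_mem [t _ <-].
under eq_integral do rewrite EFinM -muleA.
rewrite ge0_integralZl//; first last.
- by rewrite lee_fin.
- by move=> x _; rewrite mule_ge0// lee_fin.
- by apply: emeasurable_funM => //; apply/measurable_EFinP; exact: measurable_indic.
rewrite nuE//; congr (_ * _).
rewrite integral_mkcond; apply: eq_integral => x _; rewrite muleC epatch_indic//.
Qed.

End density.
(** * Property tau of the one-dimensional Gaussian *)

(** Maurey's property in multiplicative form, with general weights in place of 1/2. The common bound
    [M] makes both integrals finite, so that the real-valued integrals are not default values. *)
Definition property_tau (R : realType) d (T : measurableType d) (l : R)
    (P : probability T R) (c : T -> T -> R) : Prop :=
  forall (M : R) (u v : T -> R), measurable_fun setT u -> measurable_fun setT v ->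
    (forall x, 0 <= u x <= M) -> (forall x, 0 <= v x <= M) ->
    (forall x y, u x `^ (1 - l) * v y `^ l <= expR (c x y)) ->
  (\int[P]_x u x)%R `^ (1 - l) * (\int[P]_x v x)%R `^ l <= 1.

Section tau_normal.
Variable R : realType.
Local Notation mu := (@lebesgue_measure R).
Local Notation g1 := (@normal_prob R 0 1).
Local Notation phi := (@normal_pdf R 0 1).
Local Notation K := (@normal_peak R 1).

Lemma normal_pdf01E x : phi x = K * expR (- (x ^+ 2 / 2)).
Proof. by rewrite normal_pdfE ?oner_neq0// /normal_fun subr0 expr1n mulNr. Qed.

Lemma normal_peak1_gt0 : 0 < K.
Proof. by rewrite normal_peak_gt0// oner_neq0. Qed.

Lemma ge0_integral_normal (u : R -> \bar R) : measurable_fun setT u ->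
  (forall x, 0 <= u x)%E ->
  (\int[g1]_x u x = \int[mu]_x (u x * (phi x)%:E))%E.
Proof.
move=> m_u u0; apply: ge0_integral_density => //.
- exact: measurable_normal_pdf.
- by move=> x; exact: normal_pdf_ge0.
Qed.

(** Since [expR (x ^+ 2 / 2)] is at least [1 + x ^+ 2 / 2], the level condition bounds [x ^+ 2],
    which dominates [|x|] outside [[-1, 1]]. *)
Let level_bound (F : R -> R) (M t : R) : (forall x, F x <= M * expR (- (x ^+ 2 / 2))) ->
  0 <= M -> 0 < t -> forall x, t < F x -> `|x| <= 1 + 2 * M / t.
Proof.
move=> FM M0 t0 x tF.
have : t * (1 + x ^+ 2 / 2) <= M.
  have h : t <= M * expR (- (x ^+ 2 / 2)) by rewrite (le_trans (ltW tF)).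
  have := ler_wpM2r (expR_ge0 (x ^+ 2 / 2)) h.
  rewrite -[X in _ <= X -> _]mulrA -expRD addNr expR0 mulr1; apply: le_trans.
  by rewrite ler_pM2l// expR_ge1Dx.
have -> : x ^+ 2 = `|x| ^+ 2 by rewrite -normrX ger0_norm// sqr_ge0.
move=> h; have [|x1] := leP `|x| 1; first by move/le_trans; apply; rewrite lerDl !mulr_ge0// invr_ge0 ltW.
rewrite addrC -lerBlDr ler_pdivlMr//.
have x0 : 0 <= `|x| by [].
nra.
Qed.

(** [s] is the supremum of [u * phi]. Dividing by it meets the requirements of [Prekopa_Leindler1]:
    the level sets are bounded because [phi] decays while [u] stays below [M]. *)
Let sup_normalise (u : R -> R) (M : R) : measurable_fun setT u ->
  (forall x, 0 <= u x <= M) -> (exists x, 0 < u x) ->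
  exists2 s, 0 < s & [/\ measurable_fun setT (fun x => u x * phi x / s),
    forall x, 0 <= u x * phi x / s <= 1,
    forall t, t < 1 -> exists x, t < u x * phi x / s &
    forall t, 0 < t -> exists B : R, forall x, t < u x * phi x / s -> `|x| <= B].
Proof.
move=> mu_ uM [x0 ux0].
have phi0 x : 0 < phi x by rewrite normal_pdf01E mulr_gt0 ?normal_peak1_gt0 ?expR_gt0.
have M0 : 0 <= M by have /andP[/le_trans h /h] := uM 0.
pose A := range (fun x => u x * phi x).
have hA : has_sup A.
  split; first by exists (u 0 * phi 0), 0.
  exists (M * K) => _ [x _ <-]; have /andP[? ?] := uM x.
  by rewrite ler_pM// ?normal_pdf_ge0// normal_pdf_ub// oner_neq0.
have ubA x : u x * phi x <= sup A by apply: sup_upper_bound => //; exists x.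
have s0 : 0 < sup A by rewrite (lt_le_trans _ (ubA x0))// mulr_gt0.
exists (sup A) => //; split.
- apply: measurable_funM => //; apply: measurable_funM => //; exact: measurable_normal_pdf.
- move=> x; rewrite ler_pdivrMr// mul1r ubA andbT; have /andP[? _] := uM x.
  by rewrite !mulr_ge0// ?invr_ge0 ltW.
- move=> t t1; have e0 : 0 < (1 - t) * sup A by rewrite mulr_gt0// subr_gt0.
  have [_ [x _ <-] h] := sup_adherent e0 hA.
  by exists x; rewrite ltr_pdivlMr//; move: h; rewrite mulrBl mul1r opprB addrC subrK.
- move=> t t0; exists (1 + 2 * (M * K / sup A) / t) => x.
  apply: (@level_bound (fun x => u x * phi x / sup A) _ t) => //; last by rewrite !mulr_ge0 ?invr_ge0// ltW// normal_peak1_gt0.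
  move=> {}x; rewrite normal_pdf01E; have /andP[? uxM] := uM x.
  set E := expR _.
  have -> : u x * (K * E) / sup A = u x * (K / sup A * E) by ring.
  have -> : M * K / sup A * E = M * (K / sup A * E) by ring.
  by rewrite ler_wpM2r// !mulr_ge0 ?expR_ge0 ?normal_peak_ge0 ?invr_ge0// ltW.
Qed.

Lemma fin_num_bounded_integral d (T : measurableType d) (P : probability T R) (u : T -> R) M :
  measurable_fun setT u -> (forall x, 0 <= u x <= M) ->
  (\int[P]_x (u x)%:E = (\int[P]_x u x)%R%:E)%E.
Proof.
move=> mu_ uM; rewrite fineK//; apply/fin_numPlt/andP; split.
  rewrite (lt_le_trans (ltNyr 0))//; apply: integral_ge0 => x _.
  by rewrite lee_fin; have /andP[] := uM x.
apply: (@le_lt_trans _ _ (\int[P]_x (cst M%:E x))%E).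
  apply: ge0_le_integral => //=.
  - by move=> x _; rewrite lee_fin; have /andP[] := uM x.
  - exact/measurable_EFinP.
  - by move=> x _; rewrite lee_fin; have /andP[] := uM x.
by rewrite integral_cst// [X in (_ * X)%E]probability_setT mule1 ltry.
Qed.

Let Rint0 (u : R -> R) : (forall x, 0 <= u x) -> ~ (exists x, 0 < u x) ->
  (\int[g1]_x u x)%R = 0.
Proof.
move=> u0 nu; rewrite /Rintegral integral0_eq// => x _.
congr EFin; apply/eqP; rewrite eq_le u0 andbT leNgt; apply/negP => ux; apply: nu.
by exists x.
Qed.

(** Prekopa-Leindler is applied to [u * phi], [v * phi] and [phi], each divided by a constant. The
    arithmetic mean that results is bounded below by the geometric mean, in which the constants
    cancel. *)
Theorem tau_normal l : 0 < l < 1 ->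
  property_tau l g1 (fun x y => l * (1 - l) / 2 * (x - y) ^+ 2).
Proof.
move=> l01 M u v m_u m_v uM vM uv.
have /andP[l0 l1] := l01.
have k0 : 0 < 1 - l by rewrite subr_gt0.
have [upos|unpos] := pselect (exists x, 0 < u x); last first.
  rewrite Rint0//; last by move=> x; have /andP[] := uM x.
  by rewrite powR0 ?mul0r ?gt_eqF.
have [vpos|vnpos] := pselect (exists x, 0 < v x); last first.
  rewrite [X in _ * X `^ _]Rint0//; last by move=> x; have /andP[] := vM x.
  by rewrite [X in _ * X]powR0 ?mulr0// gt_eqF.
have [s s0 [mF F01 exF ubF]] := sup_normalise m_u uM upos.
have [r r0 [mG G01 exG ubG]] := sup_normalise m_v vM vpos.
(* [c] is the weighted geometric mean of the two suprema, so that the levels [t * s] and [t * r]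
   combine to exactly [t * c]. *)
set c := s `^ (1 - l) * r `^ l.
have c0 : 0 < c by rewrite mulr_gt0// powR_gt0.
have mphi : measurable_fun setT phi by exact: measurable_normal_pdf.
have PL := @Prekopa_Leindler1 R l _ _ (fun x => phi x / c) l01 mF mG.
have {PL} : ((1 - l)%:E * \int[mu]_x (u x * phi x / s)%:E +
    l%:E * \int[mu]_x (v x * phi x / r)%:E <= \int[mu]_x (phi x / c)%:E)%E.
  apply: PL => //.
  - by apply: measurable_funM.
  - by move=> x; rewrite mulr_ge0// ?normal_pdf_ge0 ?invr_ge0 ?ltW.
  - move=> t t0; have [B hB] := ubF t t0; exists B => x /= /hB.
    by apply: le_trans; exact: ler_norm.
  - move=> t t0; have [B hB] := ubG t t0; exists (- B) => x /= /hB.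
    by rewrite ler_norml => /andP[].
  move=> t x y t0 tF tG.
  rewrite ltr_pdivlMr//.
  have h1 : t * s < u x * phi x by rewrite -ltr_pdivlMr.
  have h2 : t * r < v y * phi y by rewrite -ltr_pdivlMr.
  have hh1 : (t * s) `^ (1 - l) < (u x * phi x) `^ (1 - l).
    by apply: gt0_ltr_powR => //; rewrite nnegrE; [|apply: le_trans (ltW h1)]; rewrite mulr_ge0// ltW.
  have hh2 : (t * r) `^ l < (v y * phi y) `^ l.
    by apply: gt0_ltr_powR => //; rewrite nnegrE; [|apply: le_trans (ltW h2)]; rewrite mulr_ge0// ltW.
  apply: (@lt_le_trans _ _ ((u x * phi x) `^ (1 - l) * (v y * phi y) `^ l)).
    rewrite (_ : t * c = (t * s) `^ (1 - l) * (t * r) `^ l); last first.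
      rewrite !powRM ?ltW// mulrACA -powRD ?subrK ?powRr1 ?ltW//.
      by rewrite oner_eq0.
    by apply: ltr_pM; [exact: powR_ge0|exact: powR_ge0|exact: hh1|exact: hh2].
  have /andP[u0 _] := uM x; have /andP[v0 _] := vM y.
  have K0 := normal_peak1_gt0.
  rewrite !powRM ?normal_pdf_ge0// mulrACA.
  apply: (@le_trans _ _ (expR (l * (1 - l) / 2 * (x - y) ^+ 2) * (phi x `^ (1 - l) * phi y `^ l))).
    by rewrite ler_wpM2r// mulr_ge0 ?powR_ge0.
  have -> : phi x `^ (1 - l) * phi y `^ l =
      K * expR (- (x ^+ 2 / 2) * (1 - l) + - (y ^+ 2 / 2) * l).
    rewrite !normal_pdf01E (powRM _ (ltW K0) (expR_ge0 _)) (powRM l (ltW K0) (expR_ge0 _)).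
    rewrite mulrACA -powRD ?subrK ?powRr1 ?(ltW K0)// ?(lt0r_neq0 K0) ?implybT//.
    by rewrite -!expRM -expRD.
  (* Completion of the square: (1 - l) x^2 + l y^2 - l (1 - l) (x - y)^2 = ((1 - l) x + l y)^2. *)
  rewrite normal_pdf01E mulrCA -expRD ler_pM2l// ler_expR le_eqVlt.
  by apply/orP; left; apply/eqP; field.
have scaleE (w : R -> R) (a : R) : 0 < a -> measurable_fun setT w -> (forall x, 0 <= w x <= M) ->
    (\int[mu]_x (w x * phi x / a)%:E = ((\int[g1]_x w x)%R / a)%:E)%E.
  move=> a0 mw wM.
  rewrite EFinM -(fin_num_bounded_integral g1 mw wM) ge0_integral_normal//; first last.
  - by move=> x; rewrite lee_fin; have /andP[] := wM x.
  - exact/measurable_EFinP.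
  rewrite -ge0_integralZr//.
  - by apply/measurable_EFinP; exact: measurable_funM.
  - by move=> x _; rewrite lee_fin mulr_ge0 ?normal_pdf_ge0//; have /andP[] := wM x.
  - by rewrite lee_fin invr_ge0 ltW.
rewrite (scaleE u s)// (scaleE v r)//.
have -> : (\int[mu]_x (phi x / c)%:E = (c^-1)%:E)%E.
  under eq_integral do rewrite mulrC EFinM.
  rewrite ge0_integralZl//; first by rewrite integral_normal_pdf mule1.
  - exact/measurable_EFinP.
  - by move=> x _; rewrite lee_fin normal_pdf_ge0.
  - by rewrite lee_fin invr_ge0 ltW.
rewrite -!EFinM -EFinD lee_fin => h.
set a := (\int[g1]_x u x)%R in h *; set b := (\int[g1]_x v x)%R in h *.
have a0 : 0 <= a by apply: Rintegral_ge0 => x _; have /andP[] := uM x.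
have b0 : 0 <= b by apply: Rintegral_ge0 => x _; have /andP[] := vM x.
have := le_trans (@weighted_amgm _ l (a / s) (b / r) l01 (divr_ge0 a0 (ltW s0)) (divr_ge0 b0 (ltW r0))) h.
have si0 : 0 <= s^-1 by rewrite invr_ge0 ltW.
have ri0 : 0 <= r^-1 by rewrite invr_ge0 ltW.
have -> : (a / s) `^ (1 - l) * (b / r) `^ l = a `^ (1 - l) * b `^ l / c.
  rewrite (powRM _ a0 si0) (powRM _ b0 ri0) mulrACA; congr (_ * _).
  apply: (mulIf (lt0r_neq0 c0)); rewrite mulVf ?lt0r_neq0// /c mulrACA.
  rewrite -(powRM _ si0 (ltW s0)) -(powRM _ ri0 (ltW r0)) !mulVf ?gt_eqF//.
  by rewrite !powR1 mulr1.
by rewrite -[X in _ <= X]mul1r ler_pM2r ?invr_gt0.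
Qed.
End tau_normal.
(** * Gaussian measure on row vectors *)

Lemma measurable_forall d (T : measurableType d) (I : countType) (A : I -> set T) :
  (forall i, measurable (A i)) -> measurable [set x | forall i, A i x].
Proof.
move=> mA; rewrite (_ : [set x | _] = ~` \bigcup_i ~` A i).
  apply: measurableC; apply: countable_bigcupT_measurable => // i.
  exact: measurableC.
by rewrite setC_bigcup; apply/seteqP; split=> x h i; [move=> _; rewrite setCK|have := h i Logic.I; rewrite setCK].
Qed.

Section rV_measurable.
Variable R : realType.

Lemma open_measurable_mx m n (A : set 'M[R]_(m, n)) : open A -> measurable A.
Proof. by move=> oA; exact: sub_sigma_algebra. Qed.

Lemma continuous_measurable_mx_real m n (f : 'M[R]_(m, n) -> R) :
  continuous f -> measurable_fun setT f.
Proof.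
move=> cf; apply: (measurability _ (RGenOInfty.measurableE R)) => //.
move=> _ [_ [a ->] <-]; rewrite setTI; apply: open_measurable_mx.
move/continuousP: cf; apply; exact: rray_open.
Qed.

Lemma measurable_coord m n i j : measurable_fun setT (fun x : 'M[R]_(m, n) => x i j).
Proof. by apply: continuous_measurable_mx_real; exact: coord_continuous. Qed.

(* An open set is the union of the rational boxes that it contains. *)
Lemma measurable_fun_mx d (T : measurableType d) m n (f : T -> 'M[R]_(m, n)) :
  (forall i j, measurable_fun setT (fun x => f x i j)) -> measurable_fun setT f.
Proof.
move=> mf; apply: (@measurability _ _ _ _ setT f (@open 'M[R]_(m, n))) => //.
move=> _ [A oA <-]; rewrite setTI.
pose box (c : 'M[rat]_(m, n)) (e : rat) := [set x : 'M[R]_(m, n) |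
  forall i j, `|x i j - ratr (c i j)| < ratr e].
pose D := [set ce : 'M[rat]_(m, n) * rat | box ce.1 ce.2 `<=` A].
have -> : f @^-1` A = \bigcup_(ce in D) (f @^-1` box ce.1 ce.2).
  apply/seteqP; split=> x /=; last by move=> [ce Dce]; exact: Dce.
  move=> Afx; have /nbhs_ballP[e /= e0 fxe] : nbhs (f x) A by exact: open_nbhs_nbhs.
  have e20 : 0 < e / 2 by rewrite divr_gt0.
  have [q /itvP q0e] := rat_in_itvoo e20.
  have q0 : 0 < ratr q :> R by rewrite q0e.
  have exc i j : exists c : rat, `|f x i j - ratr c| < ratr q.
    have lt : f x i j - ratr q < f x i j + ratr q by rewrite ltrBlDr -addrA ltrDl addr_gt0.
    have [c /itvP hc] := rat_in_itvoo lt; exists c.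
    by rewrite distrC ltr_distl; apply/andP; split; rewrite hc.
  pose c : 'M[rat]_(m, n) := \matrix_(i, j) sval (cid (exc i j)).
  have hc i j : `|f x i j - ratr (c i j)| < ratr q by rewrite mxE; case: cid.
  exists (c, q) => //= y yb; apply: fxe; split => // i j.
  rewrite /ball/= (le_lt_trans (ler_distD (ratr (c i j)) _ _))//.
  rewrite (splitr e) ltrD// ?(lt_trans (hc i j)) ?q0e//.
  by rewrite distrC (lt_trans (yb i j))// q0e.
rewrite bigcup_mkcond; apply: countable_bigcupT_measurable => // ce.
case: ifPn => // _.
rewrite (_ : _ @^-1` _ = [set x | forall ij : 'I_m * 'I_n,
    `|f x ij.1 ij.2 - ratr (ce.1 ij.1 ij.2)| < ratr ce.2]); last first.
  by apply/seteqP; split=> x /= h; [move=> [i j]; exact: h|move=> i j; exact: (h (i, j))].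
apply: measurable_forall => -[i j] /=.
rewrite -[X in measurable X]setTI; apply: measurable_fun_ltr => //.
by apply: measurableT_comp => //; apply: measurable_funB => //; exact: mf.
Qed.

Definition cons_rV_fun n (z : measurableTypeR R * 'rV[R]_n) : 'rV[R]_n.+1 :=
  row_mx (const_mx z.1 : 'M[R]_(1, 1)) z.2.

Lemma cons_rV0 n (z : measurableTypeR R * 'rV[R]_n) : cons_rV_fun z 0 ord0 = z.1.
Proof.
rewrite /cons_rV_fun (_ : ord0 = lshift n (0 : 'I_1)); last exact: val_inj.
by rewrite (@row_mxEl _ 1 1 n) mxE.
Qed.

Lemma cons_rVS n (z : measurableTypeR R * 'rV[R]_n) i : cons_rV_fun z 0 (lift ord0 i) = z.2 0 i.
Proof.
rewrite /cons_rV_fun (_ : lift ord0 i = rshift 1 i); last exact: val_inj.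
by rewrite (@row_mxEr _ 1 1 n).
Qed.

Lemma measurable_cons_rV n : measurable_fun setT (@cons_rV_fun n).
Proof.
apply: measurable_fun_mx => i j; rewrite ord1.
case: (unliftP ord0 j) => [k ->|->].
  rewrite (_ : (fun x => _) = (fun z : measurableTypeR R * 'rV[R]_n => z.2 0 k)); last by apply/funext => z; rewrite cons_rVS.
  exact: (measurableT_comp (@measurable_coord 1 n 0 k) measurable_snd).
by rewrite (_ : (fun x => _) = fst)//; apply/funext => z; rewrite cons_rV0.
Qed.

HB.instance Definition _ n := isMeasurableFun.Build _ _ _ _ (@cons_rV_fun n) (@measurable_cons_rV n).

Lemma sub_mxE m n (A B : 'M[R]_(m, n)) i j : (A - B) i j = A i j - B i j.
Proof. by rewrite !mxE. Qed.

Lemma enorm_sqr n (x : 'rV[R]_n) : enorm x ^+ 2 = \sum_(i < n) x 0 i ^+ 2.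
Proof. by rewrite sqr_sqrtr// sumr_ge0// => i _; rewrite sqr_ge0. Qed.

Lemma enorm_ge0 n (x : 'rV[R]_n) : 0 <= enorm x.
Proof. exact: sqrtr_ge0. Qed.

Lemma enorm_cons n x y (x' y' : 'rV[R]_n) :
  enorm (cons_rV_fun (x, x') - cons_rV_fun (y, y')) ^+ 2 =
  (x - y) ^+ 2 + enorm (x' - y') ^+ 2.
Proof.
rewrite !enorm_sqr big_ord_recl !sub_mxE !cons_rV0; congr (_ + _).
by apply: eq_bigr => i _; rewrite !sub_mxE !cons_rVS.
Qed.

(** Coordinates are added one at a time, which is the form that tensorization by induction needs.
    [std_gaussP] and [standard_gaussian_unique] identify the result with every measure satisfying
    [standard_gaussian]. *)
Fixpoint std_gauss n : probability 'rV[R]_n R :=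
  match n with
  | 0 => \d_(0 : 'rV[R]_0)
  | n.+1 => distribution (@normal_prob R 0 1 \x std_gauss n)%E (@cons_rV_fun n)
  end.
End rV_measurable.

(** * Euclidean geometry and orthogonal maps *)

Section euclidean.
Variable R : realType.
Implicit Types n : nat.

Definition dotr n (x y : 'rV[R]_n) : R := \sum_(i < n) x 0 i * y 0 i.

Lemma dotrC n (x y : 'rV[R]_n) : dotr x y = dotr y x.
Proof. by apply: eq_bigr => i _; rewrite mulrC. Qed.

Lemma dotrZl n k (x y : 'rV[R]_n) : dotr (k *: x) y = k * dotr x y.
Proof. by rewrite /dotr mulr_sumr; apply: eq_bigr => i _; rewrite mxE mulrA. Qed.

Lemma dotrZr n k (x y : 'rV[R]_n) : dotr x (k *: y) = k * dotr x y.
Proof. by rewrite dotrC dotrZl dotrC. Qed.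

Lemma dotrBr n (x y z : 'rV[R]_n) : dotr x (y - z) = dotr x y - dotr x z.
Proof. by rewrite /dotr -sumrB; apply: eq_bigr => i _; rewrite !mxE mulrBr. Qed.

Lemma mulmx_trr n (x y : 'rV[R]_n) : x *m y^T = (dotr x y)%:M.
Proof. by rewrite [LHS]mx11_scalar mxE; congr (_%:M); apply: eq_bigr => i _; rewrite mxE. Qed.

Lemma dotr_mulmx n (x y : 'rV[R]_n) (Q : 'M[R]_n) : Q *m Q^T = 1%:M ->
  dotr (x *m Q) (y *m Q) = dotr x y.
Proof.
move=> QQ; have := mulmx_trr (x *m Q) (y *m Q).
rewrite trmx_mul mulmxA -(mulmxA x) QQ mulmx1 mulmx_trr => /matrixP/(_ 0 0).
by rewrite !mxE !mulr1n.
Qed.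

Lemma enormZ n k (x : 'rV[R]_n) : enorm (k *: x) = `|k| * enorm x.
Proof.
rewrite /enorm -sqrtr_sqr -sqrtrM ?sqr_ge0// mulr_sumr; congr Num.sqrt.
by apply: eq_bigr => i _; rewrite mxE exprMn.
Qed.

Lemma enormN n (x : 'rV[R]_n) : enorm (- x) = enorm x.
Proof. by rewrite -scaleN1r enormZ normrN1 mul1r. Qed.

Lemma enorm_sqr_dotr n (x : 'rV[R]_n) : enorm x ^+ 2 = dotr x x.
Proof. by rewrite enorm_sqr; apply: eq_bigr => i _; rewrite expr2. Qed.

Lemma enormD_sqr n (x y : 'rV[R]_n) :
  enorm (x + y) ^+ 2 = enorm x ^+ 2 + 2 * dotr x y + enorm y ^+ 2.
Proof.
rewrite !enorm_sqr /dotr mulr_sumr -!big_split/=; apply: eq_bigr => i _.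
by rewrite mxE; ring.
Qed.

Lemma enormB_sqr n (x y : 'rV[R]_n) :
  enorm (x - y) ^+ 2 = enorm x ^+ 2 - 2 * dotr x y + enorm y ^+ 2.
Proof. by rewrite enormD_sqr enormN -scaleN1r dotrZr; ring. Qed.

Lemma coord_le_enorm n (x : 'rV[R]_n) i : `|x 0 i| <= enorm x.
Proof.
rewrite /enorm -sqrtr_sqr ler_sqrt; last by rewrite sumr_ge0// => j _; rewrite sqr_ge0.
by rewrite (bigD1 i)//= lerDl sumr_ge0// => j _; rewrite sqr_ge0.
Qed.

(** Expand the squared norm of the difference of the two normalised vectors. *)
Lemma dotr_le n (x y : 'rV[R]_n) : dotr x y <= enorm x * enorm y.
Proof.
have [x0|x0] := eqVneq (enorm x) 0.
  rewrite x0 mul0r /dotr big1// => i _.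
  by have := coord_le_enorm x i; rewrite x0 normr_le0 => /eqP ->; rewrite mul0r.
have [y0|y0] := eqVneq (enorm y) 0.
  rewrite y0 mulr0 /dotr big1// => i _.
  by have := coord_le_enorm y i; rewrite y0 normr_le0 => /eqP ->; rewrite mulr0.
have {}x0 : 0 < enorm x by rewrite lt_def x0 enorm_ge0.
have {}y0 : 0 < enorm y by rewrite lt_def y0 enorm_ge0.
have := sqr_ge0 (enorm ((enorm x)^-1 *: x - (enorm y)^-1 *: y)).
rewrite enormB_sqr !enormZ !gtr0_norm ?invr_gt0// !mulVf ?gt_eqF// dotrZl dotrZr expr1n.
rewrite (_ : 2 * _ = 2 * ((enorm y * enorm x)^-1 * dotr x y)); last by rewrite invfM; ring.
move=> h.
have xy0 : 0 < enorm y * enorm x by rewrite mulr_gt0.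
rewrite mulrC -[leRHS]mulr1 -ler_pdivrMl//.
move: h; move: (_ * dotr x y) => z; lra.
Qed.

Lemma enormD n (x y : 'rV[R]_n) : enorm (x + y) <= enorm x + enorm y.
Proof.
rewrite -(ler_pXn2r (n := 2)) ?nnegrE ?addr_ge0 ?enorm_ge0// enormD_sqr.
have := dotr_le x y; lra.
Qed.

Lemma enormB n (x y : 'rV[R]_n) : enorm (x - y) <= enorm x + enorm y.
Proof. by rewrite (le_trans (enormD _ _))// enormN. Qed.

Lemma enorm_distC n (x y : 'rV[R]_n) : enorm (x - y) = enorm (y - x).
Proof. by rewrite -opprB enormN. Qed.

Lemma enorm_distD n (z x y : 'rV[R]_n) : enorm (x - y) <= enorm (x - z) + enorm (z - y).
Proof. by rewrite (le_trans _ (enormD _ _))// addrA subrK. Qed.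

Lemma enorm_le_sum n (x : 'rV[R]_n) : enorm x <= \sum_(i < n) `|x 0 i|.
Proof.
have : enorm x ^+ 2 <= (\sum_(i < n) `|x 0 i|) ^+ 2.
  rewrite enorm_sqr; elim: n x => [|n IH] x; first by rewrite !big_ord0 expr0n.
  have := IH (\row_i x 0 (lift ord0 i)).
  rewrite !big_ord_recl/= sqrrD real_normK ?num_real//.
  under eq_bigr do rewrite mxE; under [in X in _ <= X -> _]eq_bigr do rewrite mxE.
  move=> h; rewrite -addrA lerD2l (le_trans h)// lerDr mulrn_wge0// mulr_ge0// sumr_ge0//.
by rewrite ler_pXn2r// nnegrE ?enorm_ge0// sumr_ge0.
Qed.

(* The Householder reflection along x - y exchanges x and y. *)
Lemma orthogonal_transitive n (x y : 'rV[R]_n) : enorm x = enorm y ->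
  exists2 Q : 'M[R]_n, Q *m Q^T = 1%:M & x *m Q = y.
Proof.
move=> xy; have [->|neq] := eqVneq x y.
  by exists 1%:M; rewrite ?trmx1 mulmx1.
pose v := x - y; pose c := enorm v ^+ 2.
have c0 : c != 0.
  rewrite expf_eq0/=; apply: contra neq => /eqP v0.
  rewrite -subr_eq0; apply/eqP/rowP => i; rewrite [RHS]mxE; apply/eqP.
  by have := coord_le_enorm v i; rewrite v0 normr_le0.
pose Q : 'M[R]_n := 1%:M - (2 / c) *: (v^T *m v).
have QT : Q^T = Q by rewrite /Q linearB/= trmx1 linearZ/= trmx_mul trmxK.
have vv : v *m v^T = c%:M by rewrite mulmx_trr /c enorm_sqr_dotr.
exists Q; rewrite ?QT.
  have PP : (v^T *m v) *m (v^T *m v) = c *: (v^T *m v).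
    by rewrite -mulmxA (mulmxA v) vv mul_scalar_mx scalemxAr.
  rewrite /Q; set P := v^T *m v in PP *.
  rewrite mulmxBl mul1mx -scalemxAl mulmxBr -scalemxAr mulmx1 PP.
  rewrite scalerA divfK// scalerBr scalerA.
  by apply/matrixP => i j; rewrite !mxE; ring.
rewrite /Q mulmxBr mulmx1 -scalemxAr mulmxA mulmx_trr mul_scalar_mx scalerA.
have -> : 2 / c * dotr x v = 1.
  rewrite mulrAC; apply/eqP; rewrite eq_sym -(can2_eq (mulfK c0) (divfK c0)) mul1r; apply/eqP.
  by rewrite /c /v enormB_sqr -xy dotrBr -enorm_sqr_dotr; ring.
by rewrite scale1r /v opprB addrC subrK.
Qed.
Lemma measurable_enorm_sqr n : measurable_fun setT (fun x : 'rV[R]_n => enorm x ^+ 2).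
Proof.
rewrite (_ : (fun x => _) = (fun x : 'rV[R]_n => \sum_(i < n) x 0 i ^+ 2)); last first.
  by apply/funext => x; rewrite enorm_sqr.
by apply: measurable_sum => i; apply: measurable_funX; exact: measurable_coord.
Qed.

Lemma measurable_enorm n : measurable_fun setT (@enorm R n).
Proof.
rewrite (_ : @enorm R n = Num.sqrt \o (fun x => enorm x ^+ 2)); last first.
  by apply/funext => x /=; rewrite sqrtr_sqr ger0_norm// enorm_ge0.
apply: measurableT_comp; last exact: measurable_enorm_sqr.
by apply: continuous_measurable_fun; exact: sqrt_continuous.
Qed.

Lemma measurable_sphere n rho : measurable [set x : 'rV[R]_n | enorm x = rho].
Proof.
rewrite (_ : [set x | _] = @enorm R n @^-1` [set rho])//.
by rewrite -[X in measurable X]setTI; apply: measurable_enorm.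
Qed.

End euclidean.

(** * Restriction to sets of full measure *)

Section full_measure.
Variable R : realType.

Lemma integral_full_measure d (T : measurableType d) (P : probability T R) (S : set T)
    (f : T -> \bar R) : measurable S -> P S = 1%E -> measurable_fun setT f ->
  (forall x, 0 <= f x)%E -> (\int[P]_x f x = \int[P]_(x in S) f x)%E.
Proof.
move=> mS PS mf f0.
have nS : P (~` S) = 0 by rewrite probability_setC// PS subee.
rewrite (ge0_negligible_integral (N := ~` S))//; first by rewrite setTD setCK.
exact: measurableC.
Qed.

Lemma eq_full_integral d (T : measurableType d) (P : probability T R) (S : set T)
    (f g : T -> \bar R) : measurable S -> P S = 1%E ->
  measurable_fun setT f -> measurable_fun setT g ->
  (forall x, 0 <= f x)%E -> (forall x, 0 <= g x)%E ->
  (forall x, S x -> f x = g x) -> (\int[P]_x f x = \int[P]_x g x)%E.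
Proof.
move=> mS PS mf mg f0 g0 fg.
rewrite (integral_full_measure mS PS mf f0) (integral_full_measure mS PS mg g0).
by apply: eq_integral => x /set_mem; exact: fg.
Qed.

Lemma measure_full_setI d (T : measurableType d) (P : probability T R) (A S : set T) :
  measurable A -> measurable S -> P S = 1%E -> P (A `&` S) = P A.
Proof.
move=> mA mS PS; transitivity (P (A `\` S) + P (A `&` S))%E; last exact/esym/measureDI.
suff -> : P (A `\` S) = 0%E by rewrite add0e.
apply: (@subset_measure0 _ _ _ P _ (~` S)); last by rewrite [LHS]probability_setC// PS subee.
- exact: measurableD.
- exact: measurableC.
- by move=> x [].
Qed.

End full_measure.

(** * Property tau and concentration in dimension n *)

Section gauss.
Variable R : realType.
Local Notation g1 := (@normal_prob R 0 1).
Local Notation gam := (@std_gauss R).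

Lemma ge0_integral_gaussS n (F : 'rV[R]_n.+1 -> \bar R) :
  measurable_fun setT F -> (forall x, 0 <= F x)%E ->
  (\int[gam n.+1]_z F z = \int[g1]_x \int[gam n]_y F (cons_rV_fun (x, y)))%E.
Proof.
move=> mF F0.
rewrite ge0_integral_distribution// fubini_tonelli1//; last by move=> z; exact: F0.
by apply: measurableT_comp => //; exact: measurable_cons_rV.
Qed.

Lemma integral_gauss0 (F : 'rV[R]_0 -> \bar R) :
  measurable_fun setT F -> (\int[gam 0]_z F z = F (0 : 'rV[R]_0)%R)%E.
Proof. by move=> mF; rewrite integral_dirac// diracT mul1e. Qed.

Lemma ge0_integral_gauss_prod n (h : 'I_n -> R -> R) :
  (forall i, measurable_fun setT (h i)) -> (forall i x, 0 <= h i x) ->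
  (\int[gam n]_x (\prod_(i < n) h i (x 0 i))%:E = \prod_(i < n) \int[g1]_x (h i x)%:E)%E.
Proof.
elim: n h => [|n IH] h mh h0.
  rewrite integral_gauss0; last by apply/measurable_EFinP; rewrite (_ : (fun _ => _) = cst 1)//; apply/funext => x; rewrite big_ord0.
  by rewrite !big_ord0.
have mprod k (k_ : 'I_k -> R -> R) : (forall i, measurable_fun setT (k_ i)) ->
    measurable_fun setT (fun x : 'rV[R]_k => (\prod_(i < k) k_ i (x 0 i))%:E).
  move=> mk; apply/measurable_EFinP; apply: measurable_prod => i _.
  by apply: measurableT_comp => //; exact: measurable_coord.
rewrite ge0_integral_gaussS//; [|exact: mprod|by move=> x; rewrite lee_fin prodr_ge0].
transitivity (\int[g1]_x ((h ord0 x)%:E * \prod_(i < n) \int[g1]_y (h (lift ord0 i) y)%:E))%E.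
  apply: eq_integral => x _; rewrite -(IH (fun i => h (lift ord0 i)))//.
  rewrite -ge0_integralZl//=; first last.
  - by rewrite lee_fin.
  - by move=> y _; rewrite lee_fin prodr_ge0.
  - by apply: (mprod _ (fun i => h (lift ord0 i))).
  apply: eq_integral => y _; rewrite big_ord_recl cons_rV0 -EFinM; congr (_ * _)%:E.
  by apply: eq_bigr => i _; rewrite cons_rVS.
rewrite /= ge0_integralZr//.
- by rewrite big_ord_recl.
- by apply/measurable_EFinP; exact: mh.
- by move=> x _; rewrite lee_fin.
- by apply: prode_ge0 => i _; apply: integral_ge0 => x _; rewrite lee_fin.
Qed.

Lemma std_gaussP n : standard_gaussian (gam n).
Proof.
move=> A mA; pose S := [set x : 'rV[R]_n | forall i, A i (x 0 i)]; transitivity (gam n S) => //.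
have mS : measurable S.
  apply: measurable_forall => i; rewrite -[X in measurable X]setTI.
  by apply: measurable_coord.
transitivity (\int[gam n]_x (\prod_(i < n) (\1_(A i) (x 0 i) : R))%:E)%E.
  transitivity (\int[gam n]_x (\1_S x)%:E)%E; first by rewrite integral_indic// setIT.
  apply: eq_integral => x _.
  congr EFin; rewrite indicE.
  have [Sx|nSx] := boolP (x \in S).
    rewrite big1// => i _; rewrite indicE mem_set//.
    by move: Sx; rewrite inE; exact.
  have /existsNP[i nA] : ~ S x by move/negP: nSx; rewrite inE.
  by rewrite (bigD1 i)//= indicE memNset// mul0r.
rewrite (ge0_integral_gauss_prod (h := fun i => \1_(A i)))//.
by apply: eq_bigr => i _; rewrite integral_indic ?setIT//; exact: mA.
Qed.

(** Fubini with real-valued integrals. The partial integral inherits the bound [M], so the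
    one-dimensional property tau applies to it. *)
Lemma RintegralS n (u : 'rV[R]_n.+1 -> R) M : measurable_fun setT u ->
  (forall x, 0 <= u x <= M) ->
  let U x := (\int[gam n]_y u (cons_rV_fun (x, y)))%R in
  [/\ measurable_fun setT U, forall x, 0 <= U x <= M & (\int[gam n.+1]_z u z)%R = (\int[g1]_x U x)%R].
Proof.
move=> mu_ uM U.
have mc x : measurable_fun setT (fun y : 'rV[R]_n => u (cons_rV_fun (x, y))).
  apply: measurableT_comp => //; apply: measurableT_comp; first exact: measurable_cons_rV.
  exact: measurable_pair1.
have UE x : ((U x)%:E = \int[gam n]_y (u (cons_rV_fun (x, y)))%:E)%E.
  by rewrite (fin_num_bounded_integral _ (mc x) (M := M)).
have mf : measurable_fun setT (fun z : measurableTypeR R * 'rV[R]_n => (u (cons_rV_fun z))%:E).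
  by apply/measurable_EFinP; apply: measurableT_comp => //; exact: measurable_cons_rV.
split.
- apply/measurable_EFinP; rewrite (_ : EFin \o U = (fun x => \int[gam n]_y (u (cons_rV_fun (x, y)))%:E)%E).
    apply: (measurable_fun_fubini_tonelli_F _ mf) => z.
    by rewrite lee_fin; have /andP[] := uM (cons_rV_fun z).
  by apply/funext => x /=; rewrite UE.
- move=> x; rewrite -!lee_fin UE; apply/andP; split.
    by apply: integral_ge0 => y _; rewrite lee_fin; have /andP[] := uM (cons_rV_fun (x, y)).
  apply: (@le_trans _ _ (\int[gam n]_y (cst M%:E y))%E).
    apply: ge0_le_integral => //=.
    - by move=> y _; rewrite lee_fin; have /andP[] := uM (cons_rV_fun (x, y)).
    - exact/measurable_EFinP.
    - by move=> y _; rewrite lee_fin; have /andP[] := uM (cons_rV_fun (x, y)).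
  by rewrite integral_cst// [X in (_ * X)%E]probability_setT mule1.
- rewrite /Rintegral ge0_integral_gaussS.
  + by congr fine; apply: eq_integral => x _; rewrite -UE.
  + exact/measurable_EFinP.
  + by move=> x; rewrite lee_fin; have /andP[] := uM x.
Qed.

(** The squared distance is a sum over coordinates. With the first coordinates [x] and [y] frozen,
    the induction hypothesis for the slices gives exactly the hypothesis of [tau_normal] for the
    partial integrals. *)
Theorem tau_gauss n l : 0 < l < 1 ->
  property_tau l (gam n) (fun x y => l * (1 - l) / 2 * enorm (x - y) ^+ 2).
Proof.
move=> l01; have /andP[l0 l1] := l01.
have k0 : 0 < 1 - l by rewrite subr_gt0.
elim: n => [|n IH] M u v m_u m_v uM vM uv.
  rewrite /Rintegral !integral_gauss0/=; [|exact/measurable_EFinP|exact/measurable_EFinP].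
  rewrite (le_trans (uv 0 0))// subrr /enorm big_ord0 sqrtr0 expr0n/= mulr0 expR0//.
have [mU UM ->] := RintegralS m_u uM.
have [mV VM ->] := RintegralS m_v vM.
apply: (@tau_normal _ l l01 M _ _ mU mV UM VM) => x y /=.
set c := l * (1 - l) / 2.
(* The power [l] of [q] is the inverse of the exponential cost of the first coordinates, so
   multiplying [v] by [q] removes this cost from the slices; [q <= 1] preserves the bound [M]. *)
set q := expR (- ((1 - l) / 2 * (x - y) ^+ 2)).
have q0 : 0 < q by exact: expR_gt0.
have q1 : q <= 1.
  rewrite expR_le1 oppr_le0 mulr_ge0 ?sqr_ge0//.
  by rewrite divr_ge0// ltW.
have mc (w : 'rV[R]_n.+1 -> R) z : measurable_fun setT w -> measurable_fun setT (fun y : 'rV[R]_n => w (cons_rV_fun (z, y))).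
  move=> mw; apply: measurableT_comp => //; apply: measurableT_comp; first exact: measurable_cons_rV.
  exact: measurable_pair1.
have qvM y' : 0 <= q * v (cons_rV_fun (y, y')) <= M.
  have /andP[v0 vM'] := vM (cons_rV_fun (y, y')).
  by rewrite mulr_ge0 ?(ltW q0)//= (le_trans _ vM')// ler_piMl.
have mqv : measurable_fun setT (fun y' : 'rV[R]_n => q * v (cons_rV_fun (y, y'))).
  by apply: measurable_funM => //; exact: mc.
have := IH M (fun x' => u (cons_rV_fun (x, x'))) (fun y' => q * v (cons_rV_fun (y, y'))).
move=> /(_ (mc _ _ m_u) mqv (fun x' => uM _) qvM).
have -> : (\int[gam n]_x0 (q * v (cons_rV_fun (y, x0))))%R = q * (\int[gam n]_x0 v (cons_rV_fun (y, x0)))%R.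
  apply: EFin_inj; rewrite EFinM -(fin_num_bounded_integral (gam n) mqv qvM).
  rewrite -(fin_num_bounded_integral (gam n) (mc _ _ m_v) (fun y' => vM _)).
  under eq_integral do rewrite EFinM.
  rewrite ge0_integralZl//.
  - by apply/measurable_EFinP; exact: mc.
  - by move=> y' _; rewrite lee_fin; have /andP[] := vM (cons_rV_fun (y, y')).
  - by rewrite lee_fin ltW.
have ql : q `^ l = expR (- (c * (x - y) ^+ 2)).
  by rewrite -expRM; congr expR; rewrite /c; ring.
have V0 : 0 <= (\int[gam n]_y0 v (cons_rV_fun (y, y0)))%R.
  by have /andP[] := VM y.
rewrite (powRM l (ltW q0) V0) ql => H.
have {H} : (\int[gam n]_y0 u (cons_rV_fun (x, y0)))%R `^ (1 - l) *
    (expR (- (c * (x - y) ^+ 2)) * (\int[gam n]_y0 v (cons_rV_fun (y, y0)))%R `^ l) <= 1.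
  apply: H => x' y'.
  have /andP[v0 _] := vM (cons_rV_fun (y, y')).
  rewrite (powRM l (ltW q0) v0) ql mulrCA expRN mulrC ler_pdivrMr ?expR_gt0//.
  by rewrite -expRD (le_trans (uv _ _))// enorm_cons mulrDr addrC.
by rewrite mulrCA expRN mulrC ler_pdivrMr ?expR_gt0// mul1r.
Qed.

(* Concentration with the sharp exponent 1/2, up to the factor l < 1. *)
Theorem gauss_concentration n l (t : R) (A B : set 'rV[R]_n) : 0 < l < 1 ->
  measurable A -> measurable B ->
  (forall x y, A x -> B y -> t <= enorm (x - y) ^+ 2) ->
  (expR (l * t / 2) * fine (gam n A)) `^ (1 - l) * (fine (gam n B)) `^ l <= 1.
Proof.
move=> l01 mA mB ABt; have /andP[l0 l1] := l01.
have k0 : 0 < 1 - l by rewrite subr_gt0.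
set E := expR (l * t / 2).
have E0 : 0 < E by exact: expR_gt0.
have mA1 : measurable_fun setT (\1_A : 'rV[R]_n -> R) by exact: measurable_indic.
have i01 (C : set 'rV[R]_n) x : 0 <= (\1_C x : R) <= 1 by rewrite indicE; case: (_ \in _); rewrite lexx ler01.
(* The power [1 - l] of [E] is the exponential of the cost at squared distance [t]. Off [A] or off
   [B] the product of powers is 0. *)
have := @tau_gauss n l l01 (E + 1) (fun x => E * \1_A x) (\1_B : _ -> R).
have -> : (\int[gam n]_x (E * \1_A x))%R = E * fine (gam n A).
  rewrite /Rintegral; under eq_integral do rewrite EFinM.
  rewrite ge0_integralZl//; last by rewrite lee_fin ltW.
    by rewrite integral_indic// setIT fineM// fin_num_measure.
  exact/measurable_EFinP.
have -> : (\int[gam n]_x (\1_B x : R))%R = fine (gam n B).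
  by rewrite /Rintegral integral_indic// setIT.
apply.
- exact: measurable_funM.
- exact: measurable_indic.
- move=> x; have /andP[a0 a1] := i01 A x.
  by rewrite mulr_ge0 ?(ltW E0)//= (le_trans (ler_wpM2l (ltW E0) a1))// mulr1 lerDl.
- by move=> x; have /andP[-> /le_trans->]// := i01 B x; rewrite lerDr ltW.
move=> x y; rewrite !indicE.
have [Ax|_] := boolP (x \in A); last by rewrite mulr0 powR0 ?gt_eqF// mul0r expR_ge0.
have [By|_] := boolP (y \in B); last by rewrite (powR0 (lt0r_neq0 l0)) mulr0 expR_ge0.
rewrite mulr1 powR1 mulr1 /E -expRM ler_expR.
have := ABt x y; move: Ax By; rewrite !inE => Ax By /(_ Ax By) h.
have l2 : 0 < l * (1 - l) / 2 by rewrite !mulr_gt0.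
by rewrite (_ : l * t / 2 * (1 - l) = l * (1 - l) / 2 * t) ?ler_pM2l//; ring.
Qed.

End gauss.
(** * Tilting and the Gaussian measure of shells *)

Section tilt.
Variable R : realType.
Local Notation g1 := (@normal_prob R 0 1).
Local Notation gam := (@std_gauss R).

(* The density of N(m, s^2)^n with respect to the standard Gaussian measure. *)
Definition tilt n (s : R) (m x : 'rV[R]_n) : R :=
  s^-1 ^+ n * expR (enorm x ^+ 2 / 2 - enorm (x - m) ^+ 2 / (2 * s ^+ 2)).

Lemma tilt_ge0 n s (m x : 'rV[R]_n) : 0 < s -> 0 <= tilt s m x.
Proof. by move=> s0; rewrite mulr_ge0 ?expR_ge0// exprn_ge0// invr_ge0 ltW. Qed.

Let tilt1 (s m x : R) : R := s^-1 * expR (x ^+ 2 / 2 - (x - m) ^+ 2 / (2 * s ^+ 2)).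

Let integral_tilt1 s m : 0 < s -> (\int[g1]_x (tilt1 s m x)%:E = 1)%E.
Proof.
move=> s0.
have mt : measurable_fun setT (tilt1 s m).
  apply: measurable_funM => //; apply: measurableT_comp => //.
  by apply: measurable_funB; apply: measurable_funM => //; apply: measurable_funX => //; exact: measurable_funB.
rewrite ge0_integral_normal//.
- rewrite -(integral_normal_pdf m s); apply: eq_integral => x _.
  rewrite -EFinM; congr EFin; rewrite normal_pdf01E normal_pdfE ?gt_eqF//.
  have K0 := @normal_peak1_gt0 R.
  have -> : normal_peak s = s^-1 * normal_peak 1.
    rewrite /normal_peak -mulrnAr sqrtrM ?sqr_ge0// sqrtr_sqr gtr0_norm// invfM; congr (_ * _).
    by rewrite expr1n mul1r.
  rewrite /tilt1 /normal_fun -!mulrA; congr (_ * _); rewrite mulrCA; congr (_ * _).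
  rewrite -expRD; congr expR; field; exact: lt0r_neq0.
- exact/measurable_EFinP.
- by move=> x; rewrite lee_fin mulr_ge0 ?expR_ge0// invr_ge0 ltW.
Qed.

Lemma tilt_prod n s (m x : 'rV[R]_n) :
  tilt s m x = \prod_(i < n) tilt1 s (m 0 i) (x 0 i).
Proof.
rewrite /tilt !enorm_sqr !mulr_suml -sumrB expR_sum big_split/= prodr_const card_ord.
congr (_ * _); apply: eq_bigr => i _; rewrite sub_mxE//.
Qed.

Lemma measurable_tilt n s (m : 'rV[R]_n) : measurable_fun setT (tilt s m).
Proof.
rewrite (_ : tilt s m = fun x => \prod_(i < n) tilt1 s (m 0 i) (x 0 i)); last first.
  by apply/funext => x; rewrite tilt_prod.
apply: measurable_prod => i _; rewrite /tilt1.
apply: measurable_funM => //; apply: measurableT_comp => //.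
by apply: measurable_funB; apply: measurable_funM => //; apply: measurable_funX => //;
  [exact: measurable_coord|apply: measurable_funB => //; exact: measurable_coord].
Qed.

Lemma integral_tilt n s (m : 'rV[R]_n) : 0 < s -> (\int[gam n]_x (tilt s m x)%:E = 1)%E.
Proof.
move=> s0; under eq_integral do rewrite tilt_prod.
rewrite (ge0_integral_gauss_prod (h := fun i => tilt1 s (m 0 i))).
- by apply: big1 => i _; exact: integral_tilt1.
- move=> i; apply: measurable_funM => //; apply: measurableT_comp => //.
  by apply: measurable_funB; apply: measurable_funM => //; apply: measurable_funX => //; exact: measurable_funB.
- by move=> i x; rewrite mulr_ge0 ?expR_ge0// invr_ge0 ltW.
Qed.

Lemma measure_le_integral d (T : measurableType d) (mu : {measure set T -> \bar R})
    (A : set T) (f : T -> R) (c : R) : measurable A -> measurable_fun setT f ->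
  (forall x, 0 <= f x) -> 0 <= c -> (forall x, A x -> c <= f x) ->
  (c%:E * mu A <= \int[mu]_x (f x)%:E)%E.
Proof.
move=> mA mf f0 c0 cf; have mfE : measurable_fun setT (EFin \o f) by exact/measurable_EFinP.
rewrite -integral_cst//.
apply: (@le_trans _ _ (\int[mu]_(x in A) (f x)%:E)%E).
  apply: ge0_le_integral => //=; first exact: measurable_funTS.
apply: ge0_subset_integral => //.
by move=> x _; rewrite lee_fin.
Qed.

Lemma integral_le_integral d (T : measurableType d) (mu : {measure set T -> \bar R})
    (A : set T) (f g : T -> R) (c : R) : measurable A ->
  measurable_fun setT f -> measurable_fun setT g ->
  (forall x, 0 <= f x) -> (forall x, 0 <= g x) -> 0 <= c -> (forall x, A x -> f x <= c * g x) ->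
  (\int[mu]_(x in A) (f x)%:E <= c%:E * \int[mu]_x (g x)%:E)%E.
Proof.
move=> mA mf mg f0 g0 c0 fg.
have mfE : measurable_fun setT (EFin \o f) by exact/measurable_EFinP.
have mgE : measurable_fun setT (EFin \o g) by exact/measurable_EFinP.
apply: (@le_trans _ _ (\int[mu]_(x in A) (c%:E * (g x)%:E))%E).
  apply: ge0_le_integral => //=.
  - by move=> x _; rewrite lee_fin.
  - exact: measurable_funTS.
  - by apply: measurable_funeM; exact: measurable_funTS.
rewrite ge0_integralZl_EFin//; first last.
- exact: measurable_funTS.
- by move=> x _; rewrite lee_fin.
apply: lee_pmul => //; first by apply: integral_ge0 => x _; rewrite lee_fin.
by apply: ge0_subset_integral => // x _; rewrite lee_fin.
Qed.

(** Chernoff's exponential weight turns a centered Gaussian density into a multiple of another one.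
    Passing from variance [s ^+ 2] to [(k * s) ^+ 2] thus replaces the computation of an exponential
    moment, since both densities have integral 1. *)
Lemma tilt_ratio n s k (x : 'rV[R]_n) : 0 < s -> 0 < k ->
  tilt s 0 x = k ^+ n * expR (enorm x ^+ 2 / (2 * s ^+ 2) * (k^-1 ^+ 2 - 1)) * tilt (k * s) 0 x.
Proof.
move=> s0 k0; rewrite /tilt !subr0.
have -> : s^-1 ^+ n = k ^+ n * (k * s)^-1 ^+ n.
  by rewrite -exprMn invfM mulrA mulfV ?gt_eqF// mul1r.
rewrite mulrACA -expRD; congr (_ * expR _).
by field; rewrite !gt_eqF.
Qed.

(* Base of the exponential decay in Chernoff's bound for [enorm x ^+ 2]. *)
Definition chernoff_base (dlt : R) : R := Num.sqrt (1 + dlt ^+ 2 / 8)^-1.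

Lemma chernoff_base_bounds dlt : 0 < dlt -> 0 <= chernoff_base dlt < 1.
Proof.
move=> d0; have d2 : 0 < dlt ^+ 2 / 8 by rewrite divr_gt0 ?exprn_gt0.
rewrite sqrtr_ge0/= -[ltRHS]sqrtr1 ltr_sqrt// invf_lt1 ?ltrDl//.
by rewrite addr_gt0.
Qed.

Let base_le (k t dlt : R) : 0 < k -> 0 < dlt -> (k * expR t) ^+ 2 <= (1 + dlt ^+ 2 / 8)^-1 ->
  forall n, k ^+ n * expR (t * n%:R) <= chernoff_base dlt ^+ n.
Proof.
move=> k0 d0 h n; rewrite expRM_natr -exprMn lerXn2r ?nnegrE ?sqrtr_ge0//.
  by rewrite mulr_ge0 ?expR_ge0 ?ltW.
rewrite -(ler_pXn2r (n := 2)) ?nnegrE ?sqrtr_ge0//; first by rewrite sqr_sqrtr// (le_trans _ h)// sqr_ge0.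
by rewrite mulr_ge0 ?expR_ge0 ?ltW.
Qed.

Lemma tilt_far_gt n s dlt : 0 < s -> 0 < dlt < 1 ->
  (\int[gam n]_(x in [set x : 'rV[R]_n | ((1 + dlt) * (s ^+ 2 * n%:R) < enorm x ^+ 2)%R])
     (tilt s 0 x)%:E <= (chernoff_base dlt ^+ n)%:E)%E.
Proof.
(* With this [t] and [expR x >= 1 + x], the inverse of the squared base is at least (1 - dlt/4) (1 +
   dlt/4 + dlt^2/4), which exceeds 1 + dlt^2/8 when dlt < 1. *)
move=> s0 /andP[d0 d1]; pose t := dlt / 8.
have t2 : 0 < 1 - 2 * t by rewrite /t; lra.
pose k := Num.sqrt (1 - 2 * t)^-1.
have k0 : 0 < k by rewrite sqrtr_gt0 invr_gt0.
have k2 : k ^+ 2 = (1 - 2 * t)^-1 by rewrite sqr_sqrtr// invr_ge0 ltW.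
have ks0 : 0 < k * s by rewrite mulr_gt0.
have base := @base_le k (- t * (1 + dlt)) dlt k0 d0.
apply: (@le_trans _ _ ((k ^+ n * expR (- t * (1 + dlt) * n%:R))%:E * \int[gam n]_x (tilt (k * s) 0 x)%:E)%E); last first.
  rewrite integral_tilt// mule1 lee_fin; apply: base.
  have -> : (k * expR (- t * (1 + dlt))) ^+ 2 = ((1 - 2 * t) * expR (- (2%:R * (- t * (1 + dlt)))))^-1.
    by rewrite exprMn k2 -expRM_natl invfM -expRN opprK.
  rewrite lef_pV2 ?posrE; first last.
  - by rewrite addr_gt0// divr_gt0// exprn_gt0.
  - by rewrite mulr_gt0 ?expR_gt0.
  have := expR_ge1Dx (- (2%:R * (- t * (1 + dlt)))).
  move/(ler_wpM2l (ltW t2)); apply: le_trans.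
  rewrite /t; nra.
apply: integral_le_integral.
- by rewrite -[X in measurable X]setTI; apply: measurable_fun_ltr => //; exact: measurable_enorm_sqr.
- exact: measurable_tilt.
- exact: measurable_tilt.
- by move=> x; exact: tilt_ge0.
- by move=> x; exact: tilt_ge0.
- by rewrite mulr_ge0 ?expR_ge0// exprn_ge0// ltW.
move=> x /= hx; rewrite (@tilt_ratio n s k)// ler_wpM2r ?tilt_ge0// ler_wpM2l ?exprn_ge0 ?(ltW k0)//.
rewrite ler_expR exprVn k2 invrK (_ : 1 - 2 * t - 1 = - t * 2); last by ring.
rewrite (_ : _ * (- t * 2) = - t * (enorm x ^+ 2 / s ^+ 2)); last by field; rewrite gt_eqF.
rewrite -mulrA !mulNr lerN2 ler_pM2l ?divr_gt0// ler_pdivlMr ?exprn_gt0//.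
by rewrite -mulrA (mulrC n%:R) ltW.
Qed.

Lemma tilt_far_lt n s dlt : 0 < s -> 0 < dlt < 1 ->
  (\int[gam n]_(x in [set x : 'rV[R]_n | (enorm x ^+ 2 < (1 - dlt) * (s ^+ 2 * n%:R))%R])
     (tilt s 0 x)%:E <= (chernoff_base dlt ^+ n)%:E)%E.
Proof.
move=> s0 /andP[d0 d1]; pose t := dlt / 8.
have t2 : 0 < 1 + 2 * t by rewrite /t; lra.
pose k := Num.sqrt (1 + 2 * t)^-1.
have k0 : 0 < k by rewrite sqrtr_gt0 invr_gt0.
have k2 : k ^+ 2 = (1 + 2 * t)^-1 by rewrite sqr_sqrtr// invr_ge0 ltW.
have ks0 : 0 < k * s by rewrite mulr_gt0.
have base := @base_le k (t * (1 - dlt)) dlt k0 d0.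
apply: (@le_trans _ _ ((k ^+ n * expR (t * (1 - dlt) * n%:R))%:E * \int[gam n]_x (tilt (k * s) 0 x)%:E)%E); last first.
  rewrite integral_tilt// mule1 lee_fin; apply: base.
  have -> : (k * expR (t * (1 - dlt))) ^+ 2 = ((1 + 2 * t) * expR (- (2%:R * (t * (1 - dlt)))))^-1.
    by rewrite exprMn k2 -expRM_natl invfM -expRN opprK.
  rewrite lef_pV2 ?posrE; first last.
  - by rewrite addr_gt0// divr_gt0// exprn_gt0.
  - by rewrite mulr_gt0 ?expR_gt0.
  have := expR_ge1Dx (- (2%:R * (t * (1 - dlt)))).
  move/(ler_wpM2l (ltW t2)); apply: le_trans.
  rewrite /t; nra.
apply: integral_le_integral.
- by rewrite -[X in measurable X]setTI; apply: measurable_fun_ltr => //; exact: measurable_enorm_sqr.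
- exact: measurable_tilt.
- exact: measurable_tilt.
- by move=> x; exact: tilt_ge0.
- by move=> x; exact: tilt_ge0.
- by rewrite mulr_ge0 ?expR_ge0// exprn_ge0// ltW.
move=> x /= hx; rewrite (@tilt_ratio n s k)// ler_wpM2r ?tilt_ge0// ler_wpM2l ?exprn_ge0 ?(ltW k0)//.
rewrite ler_expR exprVn k2 invrK (_ : 1 + 2 * t - 1 = t * 2); last by ring.
rewrite (_ : _ * (t * 2) = t * (enorm x ^+ 2 / s ^+ 2)); last by field; rewrite gt_eqF.
rewrite -mulrA ler_pM2l ?divr_gt0// ler_pdivrMr ?exprn_gt0//.
by rewrite -mulrA (mulrC n%:R) ltW.
Qed.

Lemma tilt_1_0 n (x : 'rV[R]_n) : tilt 1 0 x = 1.
Proof. by rewrite /tilt invr1 expr1n mul1r subr0 expr1n mulr1 subrr expR0. Qed.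

Definition shell n (s dlt : R) : set 'rV[R]_n :=
  [set x | (1 - dlt) * (s ^+ 2 * n%:R) <= enorm x ^+ 2 <= (1 + dlt) * (s ^+ 2 * n%:R)].

Lemma measurable_shell n s dlt : measurable (@shell n s dlt).
Proof.
rewrite (_ : shell _ _ = [set x | (1 - dlt) * (s ^+ 2 * n%:R) <= enorm x ^+ 2] `&` [set x | enorm x ^+ 2 <= (1 + dlt) * (s ^+ 2 * n%:R)]).
  apply: measurableI; rewrite -[X in measurable X]setTI; apply: measurable_fun_ler => //; exact: measurable_enorm_sqr.
by apply/seteqP; split => x /=; [move/andP|move=> h; apply/andP].
Qed.

Lemma integral_tilt_shellC n s dlt : 0 < s -> 0 < dlt < 1 ->
  (\int[gam n]_(x in ~` @shell n s dlt) (tilt s 0 x)%:E <= (2 * chernoff_base dlt ^+ n)%:E)%E.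
Proof.
move=> s0 d01.
pose A := [set x : 'rV[R]_n | (1 + dlt) * (s ^+ 2 * n%:R) < enorm x ^+ 2].
pose B := [set x : 'rV[R]_n | enorm x ^+ 2 < (1 - dlt) * (s ^+ 2 * n%:R)].
have mA : measurable A by rewrite -[X in measurable X]setTI; apply: measurable_fun_ltr => //; exact: measurable_enorm_sqr.
have mB : measurable B by rewrite -[X in measurable X]setTI; apply: measurable_fun_ltr => //; exact: measurable_enorm_sqr.
have -> : ~` @shell n s dlt = A `|` B.
  apply/seteqP; split => x /=; rewrite /A /B/=.
    by move/negP; rewrite negb_and -!ltNge => /orP[]; [right|left].
  by case=> h /andP[h1 h2]; move: h; rewrite ltNge ?h1 ?h2.
have mt : measurable_fun setT (fun x : 'rV[R]_n => (tilt s 0 x)%:E) by apply/measurable_EFinP; exact: measurable_tilt.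
rewrite ge0_integral_setU//.
- rewrite mulr_natl mulr2n EFinD; apply: leeD; [exact: tilt_far_gt|exact: tilt_far_lt].
- exact: measurable_funTS.
- by move=> x _; rewrite lee_fin tilt_ge0.
- apply/disj_setPS => x [/= h1 h2]; have /andP[d0 d1] := d01.
  have : 0 <= s ^+ 2 * n%:R by rewrite mulr_ge0 ?sqr_ge0.
  by have := lt_trans h1 h2; rewrite /A /B/=; nra.
Qed.

Lemma gauss_shellC n dlt : 0 < dlt < 1 ->
  (gam n (~` @shell n 1 dlt) <= (2 * chernoff_base dlt ^+ n)%:E)%E.
Proof.
move=> d01; have := @integral_tilt_shellC n 1 dlt ltr01 d01.
under eq_integral do rewrite tilt_1_0.
by rewrite integral_cst ?mul1e//; apply: measurableC; exact: measurable_shell.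
Qed.

(** Under the law of variance [a ^+ 2] the shell has probability at least 1/2, by the assumption on
    [chernoff_base]. As [a >= 1], the density of that law relative to the standard one grows with
    the norm, so on the shell it is bounded by its value at the outer radius. *)
Lemma gauss_shell_ge n a dlt : 1 <= a -> 0 < dlt < 1 -> chernoff_base dlt ^+ n <= 4^-1 ->
  2^-1 * a ^+ n * expR (- ((a ^+ 2 - 1) * (1 + dlt) / 2 * n%:R)) <= fine (gam n (@shell n a dlt)).
Proof.
move=> a1 d01 b4; have a0 : 0 < a by rewrite (lt_le_trans ltr01).
have mS := @measurable_shell n a dlt.
have mt : measurable_fun setT (fun x : 'rV[R]_n => (tilt a 0 x)%:E) by apply/measurable_EFinP; exact: measurable_tilt.
set E := expR ((a ^+ 2 - 1) * (1 + dlt) / 2 * n%:R).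
have E0 : 0 < E by exact: expR_gt0.
have h1 : (\int[gam n]_(x in @shell n a dlt) (tilt a 0 x)%:E <= (a^-1 ^+ n * E)%:E * gam n (@shell n a dlt))%E.
  rewrite -integral_cst//; apply: ge0_le_integral => //=.
  - by move=> x _; rewrite lee_fin tilt_ge0.
  - exact: measurable_funTS.
  move=> x /andP[_ xS]; rewrite lee_fin /tilt subr0 ler_wpM2l ?exprn_ge0 ?invr_ge0 ?(ltW a0)//.
  rewrite ler_expR.
  rewrite (_ : _ - _ = (a ^+ 2 - 1) / (2 * a ^+ 2) * enorm x ^+ 2); last by field; rewrite gt_eqF.
  rewrite (_ : _ * n%:R = (a ^+ 2 - 1) / (2 * a ^+ 2) * ((1 + dlt) * (a ^+ 2 * n%:R))); last by field; rewrite gt_eqF.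
  apply: ler_wpM2l => //; apply: divr_ge0; [by rewrite subr_ge0 exprn_ege1|by rewrite mulr_ge0// sqr_ge0].
have h2 := @integral_tilt_shellC n a dlt a0 d01.
have : (1 <= (a^-1 ^+ n * E)%:E * gam n (@shell n a dlt) + (2 * chernoff_base dlt ^+ n)%:E)%E.
  rewrite -(@integral_tilt n a 0)// -(setUv (@shell n a dlt)) ge0_integral_setU//.
  - exact: leeD.
  - exact: measurableC.
  - exact: measurable_funTS.
  - by move=> x _; rewrite lee_fin tilt_ge0.
  - by apply/disj_setPS => x [].
have -> : gam n (@shell n a dlt) = (fine (gam n (@shell n a dlt)))%:E by rewrite fineK// fin_num_measure.
rewrite -EFinM -EFinD lee_fin /= => h.
have {}h : 2^-1 <= a^-1 ^+ n * E * fine (gam n (@shell n a dlt)).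
  move: h b4; move: (chernoff_base dlt ^+ n) (a^-1 ^+ n * E * _) => p q h b4; lra.
rewrite expRN -/E ler_pdivrMr// -ler_pdivlMr ?exprn_gt0//.
by move: h; rewrite exprVn mulrC mulrA mulrAC -mulrA.
Qed.

(** Moving the mean to [t *: w] gives a density of integral 1 that is at least exp(t^2 |w|^2 / 2) on
    the half-space. *)
Lemma gauss_linear n (w : 'rV[R]_n) t : 0 <= t ->
  (gam n [set x : 'rV[R]_n | (t * enorm w ^+ 2 <= \sum_(i < n) x 0 i * w 0 i)%R]
    <= (expR (- (t ^+ 2 * enorm w ^+ 2 / 2)))%:E)%E.
Proof.
move=> t0; pose A := [set x : 'rV[R]_n | t * enorm w ^+ 2 <= \sum_(i < n) x 0 i * w 0 i].
have mA : measurable A.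
  rewrite -[X in measurable X]setTI; apply: measurable_fun_ler => //.
  by apply: measurable_sum => i; apply: measurable_funM => //; exact: measurable_coord.
set q := t ^+ 2 * enorm w ^+ 2 / 2.
have E0 : 0 < expR q by exact: expR_gt0.
have : ((expR q)%:E * gam n A <= \int[gam n]_x (tilt 1 (t *: w) x)%:E)%E.
  apply: measure_le_integral => //.
  - exact: measurable_tilt.
  - by move=> x; exact: tilt_ge0.
  move=> x /= Ax; rewrite /tilt invr1 expr1n mul1r ler_expR expr1n mulr1 -mulrBl ler_pM2r//.
  have -> : enorm x ^+ 2 - enorm (x - t *: w) ^+ 2 = 2 * t * (\sum_(i < n) x 0 i * w 0 i) - t ^+ 2 * enorm w ^+ 2.
    rewrite !enorm_sqr !mulr_sumr -!sumrB; apply: eq_bigr => i _; rewrite !mxE; ring.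
  have : t * (t * enorm w ^+ 2) <= t * \sum_(i < n) x 0 i * w 0 i by rewrite ler_wpM2l.
  by rewrite mulrA -expr2; lra.
rewrite integral_tilt// muleC -lee_pdivlMr// expRN => h; apply: (le_trans h).
by rewrite mul1e.
Qed.

End tilt.
(** * Comparison of the sphere with the Gaussian *)

Section polar.
Variable R : realType.
Local Notation gam := (@std_gauss R).

Lemma pyth_bounds (r s : R) : 0 < r -> r ^+ 2 + s ^+ 2 = 1 -> r <= 1 /\ 1 - s ^+ 2 <= r.
Proof.
move=> r0 rs; have r1 : r <= 1.
  by have := sqr_ge0 s; nra.
by split => //; rewrite -rs addrK expr2 ler_piMl// ltW.
Qed.

Section kernel.
Variables (n : nat) (r s : R).
Hypotheses (r0 : 0 < r) (s0 : 0 < s) (rs : r ^+ 2 + s ^+ 2 = 1).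

(* Mehler's kernel of the Ornstein-Uhlenbeck semigroup. *)
Definition mehler (a x : 'rV[R]_n) : R := tilt s (r *: a) x.

Lemma mehlerE a x : mehler a x =
  s^-1 ^+ n * expR ((2 * r * dotr a x - r ^+ 2 * (enorm a ^+ 2 + enorm x ^+ 2)) / (2 * s ^+ 2)).
Proof.
rewrite /mehler /tilt enormB_sqr dotrZr enormZ exprMn real_normK ?num_real//.
rewrite dotrC; congr (_ * expR _).
have s2 : s ^+ 2 = 1 - r ^+ 2 by rewrite -rs addrC addKr.
rewrite (_ : enorm x ^+ 2 / 2 = s ^+ 2 * enorm x ^+ 2 / (2 * s ^+ 2)).
  by rewrite -mulrBl; congr (_ / _); rewrite s2; ring.
by field; rewrite gt_eqF.
Qed.

(** Reversibility: the total mass 1 in the second argument becomes total mass 1 in the first, that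
    is, invariance of the Gaussian measure. *)
Lemma mehlerC a x : mehler a x = mehler x a.
Proof. by rewrite !mehlerE dotrC [_ ^+ 2 + _]addrC. Qed.

Lemma mehler_ge0 a x : 0 <= mehler a x.
Proof. exact: tilt_ge0. Qed.

Lemma measurable_mehler d (T : measurableType d) (f g : T -> 'rV[R]_n) :
  (forall i, measurable_fun setT (fun t => f t 0 i)) ->
  (forall i, measurable_fun setT (fun t => g t 0 i)) ->
  measurable_fun setT (fun t => (mehler (f t) (g t))%:E).
Proof.
move=> mf mg; apply/measurable_EFinP.
rewrite (_ : (fun t => _) = (fun t => s^-1 ^+ n *
    expR ((2 * r * (\sum_(i < n) f t 0 i * g t 0 i) - r ^+ 2 *
      (\sum_(i < n) f t 0 i ^+ 2 + \sum_(i < n) g t 0 i ^+ 2)) / (2 * s ^+ 2)))); last first.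
  by apply/funext => t; rewrite mehlerE !enorm_sqr.
apply: measurable_funM => //; apply: measurableT_comp => //; apply: measurable_funM => //.
apply: measurable_funB; apply: measurable_funM => //.
  by apply: measurable_sum => i; exact: measurable_funM.
by apply: measurable_funD; apply: measurable_sum => i; exact: measurable_funX.
Qed.

Lemma integral_mehler a : (\int[gam n]_x (mehler a x)%:E = 1)%E.
Proof. exact: integral_tilt. Qed.

(** By symmetry the kernel is a density in [a] centered at [r *: x]. Its growing factor then
    involves only [enorm a], which is bounded, while [x] is arbitrary. As [1 - r <= s ^+ 2], the
    point [a] remains at distance at least [dlt / 2] from [r *: x]. *)
Lemma mehler_far a x R0 dlt : enorm a <= R0 -> dlt <= enorm (x - a) ->
  s ^+ 2 * (2 * (dlt + R0)) <= dlt -> 0 <= dlt ->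
  mehler a x <= s^-1 ^+ n * expR (R0 ^+ 2 / 2 - dlt ^+ 2 / 8 / s ^+ 2).
Proof.
move=> aR ax hs d0; rewrite mehlerC /mehler /tilt ler_wpM2l ?exprn_ge0 ?invr_ge0 ?(ltW s0)//.
have a0 := enorm_ge0 a.
have h1 : dlt / 2 <= enorm (a - r *: x).
  have e : r *: (x - a) = (1 - r) *: a - (a - r *: x).
    by apply/rowP => i; rewrite !mxE; ring.
  have h := enormB ((1 - r) *: a) (a - r *: x).
  have [r1 rr] := pyth_bounds r0 rs.
  move: h; rewrite -e !enormZ (ger0_norm (ltW r0)) ger0_norm ?subr_ge0// => h.
  have h2 : (1 - r) * enorm a <= s ^+ 2 * R0 by apply: ler_pM => //; lra.
  have h3 : (1 - s ^+ 2) * dlt <= r * enorm (x - a).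
    by apply: ler_pM => //; rewrite -rs addrK sqr_ge0.
  nra.
rewrite ler_expR lerB//.
  by rewrite ler_pM2r// ler_pXn2r// nnegrE// (le_trans a0).
rewrite ler_pdivlMr ?mulr_gt0 ?exprn_gt0//.
have -> : dlt ^+ 2 / 8 / s ^+ 2 * (2 * s ^+ 2) = (dlt / 2) ^+ 2 by field; exact: lt0r_neq0.
by rewrite ler_pXn2r// nnegrE ?enorm_ge0// divr_ge0.
Qed.

(** This is the Gaussianity of |g| u / rho for independent [g] and [u], tested against Mehler's
    kernel only. Rotation invariance moves the average over the direction [u] from the first
    argument to the second, after which the integral over [g] is a total mass. *)
Lemma mehler_sphere (rho : R) (sigma : probability 'rV[R]_n R) x : 0 < rho ->
  uniform_on_sphere rho sigma ->
  (\int[gam n]_g \int[sigma]_u (mehler ((enorm g / rho) *: u) x)%:E = 1)%E.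
Proof.
move=> rho0 [sph inv].
pose S := [set x : 'rV[R]_n | enorm x = rho].
have mS : measurable S by exact: measurable_sphere.
have mc d (T : measurableType d) (k : R) (f : T -> 'rV[R]_n) : (forall i, measurable_fun setT (fun t => f t 0 i)) ->
    forall i, measurable_fun setT (fun t => (k *: f t) 0 i).
  move=> mf i; rewrite (_ : (fun t => _) = (fun t => k * f t 0 i)); last by apply/funext => t; rewrite mxE.
  exact: measurable_funM.
have avg g : (\int[sigma]_u (mehler ((enorm g / rho) *: u) x)%:E =
    \int[sigma]_u (mehler g ((enorm x / rho) *: u))%:E)%E.
  (* [Q] carries the direction of [g] to that of [x]. Cross-multiplying by the norms avoids a
     division by a norm that may vanish. *)
  have [Q QQ Qg] : exists2 Q : 'M[R]_n, Q *m Q^T = 1%:M & (enorm x *: g) *m Q = enorm g *: x.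
    by apply: orthogonal_transitive; rewrite !enormZ !ger0_norm ?enorm_ge0// mulrC.
  have mQ : measurable_fun setT (fun u : 'rV[R]_n => u *m Q).
    apply: measurable_fun_mx => i j; rewrite ord1.
    rewrite (_ : (fun u => _) = (fun u : 'rV[R]_n => \sum_k u 0 k * Q k j)); last first.
      by apply/funext => u; rewrite mxE.
    by apply: measurable_sum => k; apply: measurable_funM => //; exact: measurable_coord.
  pose F u := (mehler ((enorm g / rho) *: u) x)%:E.
  have mF : measurable_fun setT F.
    by apply: measurable_mehler => //; apply: mc => i; exact: measurable_coord.
  have F0 u : (0 <= F u)%E by rewrite lee_fin mehler_ge0.
  transitivity (\int[pushforward sigma (fun u : 'rV[R]_n => u *m Q)]_u F u)%E.
    by apply: eq_measure_integral => A mA _; exact/esym/inv.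
  rewrite (ge0_integral_pushforward mQ sigma measurableT mF (fun u _ => F0 u)).
  rewrite preimage_setT; apply: (eq_full_integral mS sph).
  - exact: (measurableT_comp mF mQ).
  - by apply: measurable_mehler => //; apply: mc => i; exact: measurable_coord.
  - by move=> u; exact: F0.
  - by move=> u; rewrite lee_fin mehler_ge0.
  move=> u Su; congr EFin; rewrite !mehlerE !enormZ.
  have nuQ : enorm (u *m Q) = rho.
    by apply/eqP; rewrite -(eqrXn2 (n := 2)) ?enorm_ge0 ?(ltW rho0)// enorm_sqr_dotr dotr_mulmx// -enorm_sqr_dotr Su.
  rewrite nuQ Su !normrM !(ger0_norm (enorm_ge0 _)) normfV (gtr0_norm rho0) !divfK ?gt_eqF//.
  rewrite !dotrZl !dotrZr.
  have -> : enorm g / rho * dotr (u *m Q) x = enorm x / rho * dotr g u.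
    have e : enorm g * dotr (u *m Q) x = enorm x * dotr g u.
      by rewrite -dotrZr -Qg dotr_mulmx// dotrZr dotrC.
    by rewrite mulrAC e mulrAC.
  by [].
transitivity (\int[gam n]_g \int[sigma]_u (mehler g ((enorm x / rho) *: u))%:E)%E.
  by apply: eq_integral => g _; exact: avg.
rewrite (fubini_tonelli (m1 := gam n) (m2 := sigma)
  (fun z : 'rV[R]_n * 'rV[R]_n => (mehler z.1 ((enorm x / rho) *: z.2))%:E)); last first.
- by move=> z; rewrite lee_fin mehler_ge0.
- apply: measurable_mehler => [i|].
    exact: (measurableT_comp (@measurable_coord R 1 n 0 i) measurable_fst).
  by apply: mc => i; exact: (measurableT_comp (@measurable_coord R 1 n 0 i) measurable_snd).
rewrite (eq_integral (cst 1%E)); last first.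
  move=> u _ /=; rewrite -(integral_mehler ((enorm x / rho) *: u)).
  by apply: eq_integral => g _; rewrite mehlerC.
by rewrite integral_cst// mul1e; exact: probability_setT.
Qed.

(** The kernel is integrated over [u] in [A], [g] in [B] and all [x], in two orders. Integrating [x]
    first gives the left-hand side. For fixed [x] the integral over [u] and [g] is at most 1 by
    [mehler_sphere], and for [x] outside [G] it is at most the bound of [mehler_far], because all
    centers are then at distance at least [dlt]. *)
Lemma polar_kernel_bound (rho dlt R0 : R) (sigma : probability 'rV[R]_n R) (A B G : set 'rV[R]_n) :
  0 < rho -> uniform_on_sphere rho sigma -> 0 <= dlt ->
  s ^+ 2 * (2 * (dlt + R0)) <= dlt ->
  measurable A -> measurable B -> measurable G ->
  (forall g, B g -> enorm g <= R0) ->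
  (forall u g x, A u -> enorm u = rho -> B g ->
     enorm (x - (enorm g / rho) *: u) < dlt -> G x) ->
  (sigma A * gam n B <= gam n G + (s^-1 ^+ n * expR (R0 ^+ 2 / 2 - dlt ^+ 2 / 8 / s ^+ 2))%:E)%E.
Proof.
move=> rho0 usig d0 hs mA mB mG BR0 ABG; have [sph inv] := usig.
pose S := [set x : 'rV[R]_n | enorm x = rho].
have mS : measurable S by exact: measurable_sphere.
set eps := s^-1 ^+ n * _.
have eps0 : 0 <= eps by rewrite mulr_ge0 ?expR_ge0// exprn_ge0// invr_ge0 ltW.
pose m : probability ('rV[R]_n * 'rV[R]_n)%type R := (sigma \x gam n)%E.
pose D := (A `&` S) `*` B.
have mD : measurable D by apply: measurableX => //; exact: measurableI.
pose K (w : 'rV[R]_n * 'rV[R]_n) x := mehler ((enorm w.2 / rho) *: w.1) x.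
have m1 i : measurable_fun setT (fun w : 'rV[R]_n * 'rV[R]_n => w.1 0 i).
  exact: (measurableT_comp (@measurable_coord R 1 n 0 i) measurable_fst).
have m2 i : measurable_fun setT (fun w : 'rV[R]_n * 'rV[R]_n => w.2 0 i).
  exact: (measurableT_comp (@measurable_coord R 1 n 0 i) measurable_snd).
have men : measurable_fun setT (fun w : 'rV[R]_n * 'rV[R]_n => enorm w.2).
  exact: (measurableT_comp (@measurable_enorm R n) measurable_snd).
have mv i : measurable_fun setT (fun w : 'rV[R]_n * 'rV[R]_n => ((enorm w.2 / rho) *: w.1) 0 i).
  rewrite (_ : (fun w => _) = (fun w : 'rV[R]_n * 'rV[R]_n => enorm w.2 / rho * w.1 0 i)); last first.
    by apply/funext => w; rewrite mxE.
  by apply: measurable_funM => //; exact: measurable_funM.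
pose f (z : ('rV[R]_n * 'rV[R]_n) * 'rV[R]_n) : \bar R := ((\1_D z.1)%:E * (K z.1 z.2)%:E)%E.
have mi : measurable_fun setT (\1_D : _ -> R) by exact: measurable_indic.
have mf : measurable_fun setT f.
  apply: emeasurable_funM.
    by apply/measurable_EFinP; exact: (measurableT_comp mi measurable_fst).
  apply: measurable_mehler => i.
    exact: (measurableT_comp (mv i) measurable_fst).
  exact: (measurableT_comp (@measurable_coord R 1 n 0 i) measurable_snd).
have f0 z : (0 <= f z)%E by rewrite mule_ge0// lee_fin ?mehler_ge0.
have -> : (sigma A * gam n B = \int[m]_w \int[gam n]_x f (w, x))%E.
  transitivity (\int[m]_w (\1_D w)%:E)%E.
    have mDE : m D = (sigma (A `&` S) * gam n B)%E.
      by apply: product_measure1E => //; exact: measurableI.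
    rewrite integral_indic// setIT [RHS]mDE.
    by congr (_ * _)%E; exact/esym/measure_full_setI.
  apply: eq_integral => w _; rewrite /f /= ge0_integralZl//.
  - by rewrite integral_mehler mule1.
  - by apply: measurable_mehler => [i|i]; [exact: measurable_cst|exact: measurable_coord].
  - by move=> x _; rewrite lee_fin mehler_ge0.
rewrite (fubini_tonelli (m1 := m) (m2 := gam n) f mf f0).
have mK x : measurable_fun setT (fun w => (K w x)%:E).
  by apply: measurable_mehler => [i|i]; [exact: mv|exact: measurable_cst].
have K1 x : (\int[m]_w (K w x)%:E = 1)%E.
  rewrite /m fubini_tonelli2//; first exact: mehler_sphere.
  by move=> w; rewrite lee_fin mehler_ge0.
apply: (@le_trans _ _ (\int[gam n]_x ((\1_G x)%:E + cst eps%:E x))%E); last first.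
  rewrite ge0_integralD//.
  - rewrite integral_indic// setIT integral_cst//= leeD2l//.
    by rewrite [X in (_ * X)%E]probability_setT mule1.
  - by apply/measurable_EFinP; exact: measurable_indic.
apply: ge0_le_integral => //.
- by move=> x _; apply: integral_ge0 => w _; exact: f0.
- by apply: (measurable_fun_fubini_tonelli_G _ mf) => z; exact: f0.
- apply: emeasurable_funD => //; apply/measurable_EFinP; exact: measurable_indic.
move=> x _ /=.
have mfx : measurable_fun setT (fun w => f (w, x)).
  by apply: emeasurable_funM; [exact/measurable_EFinP|exact: mK].
have [Gx|nGx] := boolP (x \in G).
  apply: (@le_trans _ _ (\int[m]_w (K w x)%:E)%E).
    apply: ge0_le_integral; [exact: measurableT|by move=> w _; exact: f0|exact: mfx|exact: mK|].
    - move=> w _; rewrite /f/= -EFinM lee_fin ler_piMl ?mehler_ge0//.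
  by rewrite K1 indicE Gx -EFinD lee_fin lerDl.
rewrite indicE (negbTE nGx) add0e.
apply: (@le_trans _ _ (\int[m]_w (cst eps%:E w))%E); last first.
  by rewrite integral_cst// [X in (_ * X)%E]probability_setT mule1.
apply: ge0_le_integral; [exact: measurableT|by move=> w _; exact: f0|exact: mfx|exact: measurable_cst|].
move=> w _; rewrite /f/= indicE.
have [Dw|nDw] := boolP (w \in D); last by rewrite mul0e lee_fin.
rewrite mul1e lee_fin; move: Dw; rewrite inE => -[[Aw Sw] Bw].
have nw : enorm ((enorm w.2 / rho) *: w.1) = enorm w.2.
  by rewrite enormZ normrM normfV (gtr0_norm rho0) ger0_norm ?enorm_ge0// Sw divfK ?gt_eqF.
apply: mehler_far => //; first by rewrite nw; exact: BR0.
rewrite leNgt; apply/negP => h; move/negP: nGx; apply; rewrite inE.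
exact: (ABG w.1 w.2).
Qed.

End kernel.

Let vanishing_bound n (K D t : R) : 0 <= K -> 0 < D -> 0 < t <= 1 ->
  (Num.sqrt t)^-1 ^+ n * expR (K - D / t) <= expR K * n.+1`!%:R / D ^+ n.+1 * t.
Proof.
move=> K0 D0 /andP[t0 t1].
have st0 : 0 < Num.sqrt t by rewrite sqrtr_gt0.
have tst : t <= Num.sqrt t.
  rewrite -[X in X <= _](sqr_sqrtr (ltW t0)) expr2 ler_piMl ?sqrtr_ge0//.
  by rewrite -[leRHS]sqrtr1 ler_sqrt.
have h1 : (Num.sqrt t)^-1 ^+ n <= t^-1 ^+ n.
  by rewrite lerXn2r ?nnegrE ?invr_ge0 ?(ltW st0) ?(ltW t0)// lef_pV2.
have Dt : 0 < D / t by rewrite divr_gt0.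
have f0 : 0 < n.+1`!%:R :> R by rewrite ltr0n fact_gt0.
have h2 : expR (- (D / t)) <= n.+1`!%:R / (D / t) ^+ n.+1.
  rewrite expRN -[leRHS]invrK lef_pV2 ?posrE ?expR_gt0 ?invr_gt0 ?divr_gt0 ?exprn_gt0//.
  rewrite invf_div (le_trans _ (expR_ge1Dxn n (ltW Dt)))// lerDr//.
rewrite expRD mulrCA -!mulrA ler_wpM2l ?expR_ge0//.
apply: (le_trans (ler_pM _ _ h1 h2)); rewrite ?expR_ge0 ?exprn_ge0 ?invr_ge0 ?(ltW st0)//.
rewrite le_eqVlt; apply/orP; left; apply/eqP.
rewrite exprMn !exprVn invfM invrK !(exprS _ n).
have tn : t ^+ n != 0 by rewrite expf_neq0// gt_eqF.
have Dn : D ^+ n != 0 by rewrite expf_neq0// gt_eqF.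
by field; rewrite tn Dn !gt_eqF.
Qed.

(* If U is uniform on the sphere and X is an independent Gaussian vector, then
   |X| U / rho is Gaussian; only the inequality up to neighbourhoods is needed. *)
Lemma sphere_mul_gauss_le n (rho dlt R0 : R) (sigma : probability 'rV[R]_n R) (A B G : set 'rV[R]_n) :
  0 < rho -> uniform_on_sphere rho sigma -> 0 < dlt -> 0 <= R0 ->
  measurable A -> measurable B -> measurable G ->
  (forall g, B g -> enorm g <= R0) ->
  (forall u g x, A u -> enorm u = rho -> B g ->
     enorm (x - (enorm g / rho) *: u) < dlt -> G x) ->
  (sigma A * gam n B <= gam n G)%E.
Proof.
move=> rho0 usig d0 R00 mA mB mG BR0 ABG.
apply/lee_addgt0Pr => e e0.
pose D := dlt ^+ 2 / 8.
have D0 : 0 < D by rewrite divr_gt0 ?exprn_gt0.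
pose C := expR (R0 ^+ 2 / 2) * n.+1`!%:R / D ^+ n.+1.
have C0 : 0 < C by rewrite divr_gt0 ?exprn_gt0// mulr_gt0 ?expR_gt0// ltr0n fact_gt0.
have dR0 : 0 < 2 * (dlt + R0) by rewrite mulr_gt0// ltr_wpDr.
(* [t] is the square of the smoothing parameter [s]. The three bounds make [r] positive, fulfil the
   condition of [mehler_far], and bring the error below [e]. *)
pose t := Num.min 2^-1 (Num.min (dlt / (2 * (dlt + R0))) (e / C)).
have t0 : 0 < t.
  have h2 : 0 < 2^-1 :> R by rewrite invr_gt0.
  by rewrite /t !lt_min h2 (divr_gt0 d0 dR0) (divr_gt0 e0 C0).
have t2 : t <= 2^-1 by rewrite ge_min lexx.
have td : t * (2 * (dlt + R0)) <= dlt by rewrite -ler_pdivlMr// !ge_min lexx orbT.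
have te : C * t <= e by rewrite mulrC -ler_pdivlMr// !ge_min lexx !orbT.
have t1 : 0 < t <= 1 by rewrite t0/= (le_trans t2)// invf_le1// ler1n.
have t1' : 0 < 1 - t by lra.
pose s := Num.sqrt t; pose r := Num.sqrt (1 - t).
have s0 : 0 < s by rewrite sqrtr_gt0.
have r0 : 0 < r by rewrite sqrtr_gt0.
have s2 : s ^+ 2 = t by rewrite sqr_sqrtr// ltW.
have rs : r ^+ 2 + s ^+ 2 = 1 by rewrite s2 sqr_sqrtr ?subrK// ltW.
have hs : s ^+ 2 * (2 * (dlt + R0)) <= dlt by rewrite s2.
apply: (le_trans (polar_kernel_bound r0 s0 rs rho0 usig (ltW d0) hs mA mB mG BR0 ABG)).
rewrite leeD2l// lee_fin s2 (le_trans _ te)//.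
by apply: vanishing_bound => //; rewrite divr_ge0 ?sqr_ge0.
Qed.
End polar.
(** * Transport of empirical measures *)

Section mixture.
Context d d' (T : measurableType d) (T' : measurableType d') (R : realType).
Local Open Scope ereal_scope.

(** The two proofs are arguments so that the measure structure declared below can be inferred from
    the term. *)
Definition mdensity (mu : {measure set T -> \bar R}) (w : T -> R)
    (mw : measurable_fun setT w) (w0 : forall x, (0 <= w x)%R) (A : set T) :=
  \int[mu]_(x in A) (w x)%:E.

Section mdensity.
Variables (mu : {measure set T -> \bar R}) (w : T -> R).
Hypotheses (mw : measurable_fun setT w) (w0 : forall x, (0 <= w x)%R).
Local Notation m := (mdensity mu mw w0).

Let mdensity0 : m set0 = 0.
Proof. by rewrite /mdensity integral_set0. Qed.

Let mdensity_ge0 A : 0 <= m A.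
Proof. by apply: integral_ge0 => x _; rewrite lee_fin. Qed.

Let mdensity_sigma_additive : semi_sigma_additive m.
Proof.
move=> A mA tA mUA; rewrite /mdensity ge0_integral_bigcup//.
- apply: is_cvg_ereal_nneg_natsum_cond => n _ _.
  by apply: integral_ge0 => x _; rewrite lee_fin.
- by apply: measurable_funTS; exact/measurable_EFinP.
- by move=> x _; rewrite lee_fin.
Qed.

HB.instance Definition _ := isMeasure.Build _ _ _ m
  mdensity0 mdensity_ge0 mdensity_sigma_additive.
End mdensity.

Definition image_measure (mu : {measure set T -> \bar R}) (phi : T -> T')
    (mphi : measurable_fun setT phi) : {measure set T' -> \bar R} :=
  measure_function_pushforward__canonical__measure_function_Measure mu mphi.

Section mixture.
Variables (P : {measure set T -> \bar R}) (n : nat).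
Variables (w : 'I_n.+1 -> T -> R) (phi : 'I_n.+1 -> T -> T').
Hypotheses (mw : forall k, measurable_fun setT (w k)) (w0 : forall k x, (0 <= w k x)%R).
Hypothesis mphi : forall k, measurable_fun setT (phi k).

(** The law of [phi k x] when the pair [(k, x)] has density [w k x]. Both couplings constructed
    below have this form, and their marginals and costs become finite sums of integrals against [P].
    [inord] appears because [msum] is indexed by natural numbers. *)
Definition mixture : {measure set T' -> \bar R} :=
  msum (fun k => image_measure (mdensity P (mw (inord k)) (w0 (inord k))) (mphi (inord k))) n.+1.

Lemma ge0_integral_mixture (F : T' -> \bar R) : measurable_fun setT F -> (forall y, 0 <= F y) ->
  \int[mixture]_y F y = \sum_(k < n.+1) \int[P]_x (F (phi k x) * (w k x)%:E).
Proof.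
move=> mF F0; rewrite ge0_integral_measure_sum//; apply: eq_bigr => k _.
rewrite ge0_integral_pushforward// ?preimage_setT inord_val.
rewrite (@ge0_integral_density _ _ _ _ P (w k))//; last by move=> x; exact: F0.
exact: measurableT_comp.
Qed.

Lemma mixtureE (A : set T') : measurable A ->
  mixture A = \sum_(k < n.+1) \int[P]_x ((\1_A (phi k x))%:E * (w k x)%:E).
Proof.
move=> mA; transitivity (\int[mixture]_y (\1_A y)%:E); first by rewrite integral_indic// setIT.
rewrite ge0_integral_mixture//.
by apply/measurable_EFinP; exact: measurable_indic.
Qed.

Hypothesis w1 : \sum_(k < n.+1) \int[P]_x (w k x)%:E = 1.

Let mixture_setT : mixture setT = 1.
Proof.
rewrite mixtureE// -w1; apply: eq_bigr => k _; apply: eq_integral => x _.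
by rewrite indicT mul1e.
Qed.

Definition mixture_prob : probability T' R :=
  HB.pack (mixture : set T' -> \bar R) (Measure.on mixture) (Measure_isProbability.Build _ _ _ mixture mixture_setT).
End mixture.
End mixture.

Section empirical.
Variable R : realType.
Variables (d n : nat).
Hypothesis n0 : (0 < n)%N.
Implicit Types x u y : 'I_n -> 'rV[R]_d.

Let ext x (k : nat) : 'rV[R]_d := oapp x 0 (insub k).

(** This exhibits the set function [empirical x] as a measure, which integration lemmas require. The
    extension [ext] serves the indexing of [msum]; its default value does not occur among the first
    [n] terms. *)
Lemma empirical_msum x :
  empirical x = mscale (NngNum (ltac:(rewrite invr_ge0; exact: ler0n) : 0 <= (n%:R : R)^-1))
     (msum (fun k => \d_(ext x k)) n).
Proof.
apply/funext => A; rewrite /empirical /mscale/= /msum; congr (_ * _)%E.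
by apply: eq_bigr => i _; rewrite /ext valK.
Qed.

Lemma ge0_integral_empirical x (f : 'rV[R]_d -> \bar R) : measurable_fun setT f ->
  (forall z, 0 <= f z)%E ->
  (\int[empirical x]_z f z = (n%:R^-1)%:E * \sum_(i < n) f (x i))%E.
Proof.
move=> mf f0; rewrite empirical_msum ge0_integral_mscale// ge0_integral_measure_sum//.
congr (_ * _)%E; apply: eq_bigr => i _; rewrite integral_dirac// diracT mul1e.
by rewrite /ext valK.
Qed.

Lemma integral_empirical x (f : 'rV[R]_d -> R) : measurable_fun setT f ->
  (\int[empirical x]_z (f z)%:E = (n%:R^-1 * \sum_(i < n) f (x i))%:E)%E.
Proof.
move=> mf; have mfE : measurable_fun setT (EFin \o f) by exact/measurable_EFinP.
transitivity (\int[empirical x]_z (EFin \o f)^\+ z - \int[empirical x]_z (EFin \o f)^\- z)%E.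
  by rewrite empirical_msum; exact: integralE.
rewrite !ge0_integral_empirical//.
- rewrite funerpos funerneg !sumEFin -!EFinM -EFinB -mulrBr -sumrB.
  by congr (_ * _)%:E; apply: eq_bigr => i _; rewrite -[in RHS](funrposBneg f).
- exact: measurable_funeneg.
- exact: measurable_funepos.
Qed.

Lemma mean_empirical x : mean (empirical x) = average x.
Proof.
apply/rowP => j; rewrite !mxE integral_empirical; last exact: measurable_coord.
by rewrite /= summxE.
Qed.

Lemma centering_empirical x :
  centering (empirical x) = empirical (fun i => x i - average x).
Proof. by rewrite /centering mean_empirical. Qed.

End empirical.

Lemma measurable_eq_rV (R : realType) d disp (T : measurableType disp) (f : T -> 'rV[R]_d) (a : 'rV[R]_d) :
  measurable_fun setT f -> measurable [set z | f z = a].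
Proof.
move=> mf; rewrite (_ : [set z | f z = a] = [set z | forall j, f z 0 j = a 0 j]).
  apply: measurable_forall => j.
  rewrite -[X in measurable X]setTI.
  by apply: (measurableT_comp (@measurable_coord R 1 d 0 j) mf measurableT (measurable_set1 (a 0 j))).
by apply/seteqP; split=> z /= => [-> //|h]; apply/rowP.
Qed.

Section W1.
Variables (R : realType) (d n : nat).
Implicit Types (u y : 'I_n.+1 -> 'rV[R]_d) (nu : probability 'rV[R]_d R).
Local Notation Rd := 'rV[R]_d.

Lemma measurable_dist : measurable_fun setT (fun z : Rd * Rd => enorm (z.1 - z.2)).
Proof.
apply: measurableT_comp; first exact: measurable_enorm.
apply: measurable_fun_mx => i j; rewrite ord1.
rewrite (_ : (fun z => _) = (fun z : Rd * Rd => z.1 0 j - z.2 0 j)); last first.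
  by apply/funext => z; rewrite !mxE.
apply: measurable_funB.
  exact: (measurableT_comp (@measurable_coord R 1 d 0 j) measurable_fst).
exact: (measurableT_comp (@measurable_coord R 1 d 0 j) measurable_snd).
Qed.

(* Transporting the atom y i to u i turns a coupling of the law of y into one of the law of u. *)
Lemma W1_empirical_move u y nu :
  (W1 (empirical u) nu <=
   W1 (empirical y) nu + (n.+1%:R^-1 * \sum_(i < n.+1) enorm (u i - y i))%:E)%E.
Proof.
set c := _ * _.
(* With the constant on the left, each coupling of [empirical y] and [nu] can be treated
   separately. *)
rewrite -leeBlDr//; apply: le_ereal_inf_tmp => _ [pi cpl <-]; rewrite leeBlDr//.
(* The points [y k] may coincide. The mass of [pi] above an atom is shared equally among the indices
   located there, and the share of index [k] has its first component moved to [u k]. *)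
pose mlt (v : Rd) : R := (#|[pred k : 'I_n.+1 | y k == v]|)%:R.
pose E k := [set z : Rd * Rd | z.1 = y k].
have mE k : measurable (E k) by apply: measurable_eq_rV; exact: measurable_fst.
have mlt0 k : 0 < mlt (y k).
  by rewrite ltr0n; apply/card_gt0P; exists k; rewrite inE.
pose w k (z : Rd * Rd) : R := \1_(E k) z / mlt (y k).
pose phi k (z : Rd * Rd) : Rd * Rd := (u k, z.2).
have mw k : measurable_fun setT (w k).
  by apply: measurable_funM => //; exact: measurable_indic.
have w0 k z : 0 <= w k z by rewrite divr_ge0// ltW.
have mphi k : measurable_fun setT (phi k) by exact: measurable_fun_pair.
have piE k : (pi (E k) = (n.+1%:R^-1 * mlt (y k))%:E)%E.
  have m1 : measurable [set y k].
    by apply: (@measurable_eq_rV _ _ _ _ id); exact: measurable_id.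
  have [h _] := cpl _ m1; rewrite -[LHS]/(pushforward pi fst [set y k]) h /empirical EFinM; congr (_ * _)%E.
  rewrite /mlt -sum1_card natr_sum [in RHS]big_mkcond/= -sumEFin; apply: eq_bigr => i _.
  rewrite diracE inE; case: (eqVneq (y i) (y k)) => [->|neq]; first by rewrite mem_set.
  by rewrite memNset// => /= e; move/eqP: neq.
have intw k : (\int[pi]_z (w k z)%:E = (n.+1%:R^-1)%:E)%E.
  under eq_integral do rewrite EFinM.
  rewrite ge0_integralZr//.
  - rewrite integral_indic// setIT; apply: (etrans (congr1 (fun t => t * _)%E (piE k))).
    rewrite -EFinM mulfK//; exact: lt0r_neq0.
  - by apply/measurable_EFinP; exact: measurable_indic.
  - by rewrite lee_fin invr_ge0 ltW.
have w1 : (\sum_(k < n.+1) \int[pi]_z (w k z)%:E = 1)%E.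
  rewrite (eq_bigr (fun=> (n.+1%:R^-1)%:E)); last by move=> k _; exact: intw.
  by rewrite sumEFin sumr_const card_ord -[_ *+ _]mulr_natr mulVf// pnatr_eq0.
pose S := [set z : Rd * Rd | exists k, z.1 = y k].
have mS : measurable S.
  rewrite (_ : S = ~` [set z | forall k, (~` E k) z]); last first.
    by apply/seteqP; split => z /= => [[k zk] /(_ k)//|/existsNP[k /contrapT zk]]; exists k.
  by apply: measurableC; apply: measurable_forall => k; exact: measurableC.
have sw z : \sum_(k < n.+1) w k z = \1_S z.
  rewrite indicE; have [|nS] := boolP (z \in S).
    rewrite inE => -[k0 zk0].
    rewrite (eq_bigr (fun k => (y k == y k0)%:R / mlt (y k0))).
      rewrite -mulr_suml -[X in X / _](_ : mlt (y k0) = _) ?mulfV ?lt0r_neq0//.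
      by rewrite /mlt -sum1_card natr_sum [LHS]big_mkcond/=; apply: eq_bigr => k _; rewrite inE; case: eqP.
    move=> k _; rewrite /w indicE; case: (eqVneq (y k) (y k0)) => [e|neq].
      by rewrite mem_set /E /= ?e.
    by rewrite memNset ?mul0r// => /= e; move/eqP: neq; apply; rewrite -e.
  apply: big1 => k _; rewrite /w indicE memNset ?mul0r// => Ek.
  by move/negP: nS; apply; rewrite inE; exists k.
have swE z : (\sum_(k < n.+1) (w k z)%:E = (\1_S z)%:E)%E by rewrite sumEFin sw.
have mwE k : measurable_fun setT (fun z => (w k z)%:E) by exact/measurable_EFinP.
have w0E k z : (0 <= (w k z)%:E)%E by rewrite lee_fin.
have PS : pi S = 1%E.
  rewrite -w1 -ge0_integral_sum//.
  rewrite (eq_integral (fun z => (\1_S z)%:E)); last by move=> z _; exact: swE.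
  by rewrite integral_indic// setIT.
pose pi' := mixture_prob mw w0 mphi w1.
have mdE : measurable_fun setT (fun z : Rd * Rd => (enorm (z.1 - z.2))%:E).
  by apply/measurable_EFinP; exact: measurable_dist.
have cpl' : coupling (empirical u) nu pi'.
  move=> A mA; split; rewrite /pushforward.
    transitivity (mixture pi mw w0 mphi (fst @^-1` A)) => //.
    rewrite mixtureE; last by rewrite -[X in measurable X]setTI; exact: measurable_fst.
    rewrite /empirical ge0_sume_distrr//; apply: eq_bigr => k _.
    rewrite (eq_integral (fun z => (\1_A (u k))%:E * (w k z)%:E)%E); last by [].
    by rewrite ge0_integralZl// ?lee_fin// intw muleC.
  transitivity (mixture pi mw w0 mphi (snd @^-1` A)) => //.
  have mA2 : measurable (snd @^-1` A : set (Rd * Rd)) by rewrite -[X in measurable X]setTI; exact: measurable_snd.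
  have [_ <-] := cpl _ mA; rewrite /pushforward mixtureE//.
  have mI : measurable_fun setT (fun z : Rd * Rd => (\1_A z.2)%:E : \bar R).
    by apply/measurable_EFinP; apply: (measurableT_comp (f := \1_A : Rd -> R)); [exact: measurable_indic|exact: measurable_snd].
  rewrite -ge0_integral_sum//; first last.
  - by move=> k z _; rewrite mule_ge0// lee_fin.
  - by move=> k; exact: emeasurable_funM.
  transitivity (\int[pi]_z (\1_(snd @^-1` A) z)%:E)%E; last by rewrite integral_indic// setIT.
  apply: (eq_full_integral mS PS).
  - apply: emeasurable_sum => k; exact: emeasurable_funM.
  - by apply/measurable_EFinP; exact: measurable_indic.
  - by move=> z; apply: sume_ge0 => k _; rewrite mule_ge0// lee_fin.
  - by move=> z; rewrite lee_fin.
  move=> z Sz; transitivity (\sum_(k < n.+1) (\1_A z.2)%:E * (w k z)%:E)%E; first by [].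
  by rewrite -ge0_sume_distrr// swE [\1_S z]indicE mem_set// mule1.
apply: (@le_trans _ _ (\int[pi']_z (enorm (z.1 - z.2))%:E)%E).
  by apply: ereal_inf_lbound; exists pi'.
rewrite (_ : integral _ _ _ = \int[mixture pi mw w0 mphi]_z (enorm (z.1 - z.2))%:E)%E//.
rewrite ge0_integral_mixture//; last by move=> z; rewrite lee_fin enorm_ge0.
have mdw k : measurable_fun setT (fun z : Rd * Rd => (enorm (z.1 - z.2))%:E * (w k z)%:E)%E.
  exact: emeasurable_funM.
have dw0 k (z : Rd * Rd) : (0 <= (enorm (z.1 - z.2))%:E * (w k z)%:E)%E.
  by rewrite mule_ge0// lee_fin enorm_ge0.
apply: (@le_trans _ _ (\sum_(k < n.+1) \int[pi]_z
   ((enorm (u k - y k))%:E * (w k z)%:E + (enorm (z.1 - z.2))%:E * (w k z)%:E))%E).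
  apply: lee_sum => k _; apply: ge0_le_integral => //.
  - by move=> z _; rewrite mule_ge0// lee_fin enorm_ge0.
  - apply: emeasurable_funM => //; apply/measurable_EFinP.
    exact: (measurableT_comp measurable_dist (mphi k)).
  - by apply: emeasurable_funD => //; exact: emeasurable_funM.
  move=> z _; rewrite -!EFinM -EFinD lee_fin -mulrDl /w indicE.
  have [|_] := boolP (z \in E k); last by rewrite mul0r !mulr0.
  rewrite inE => Ek; rewrite ler_wpM2r ?divr_ge0 ?(ltW (mlt0 k))//= Ek.
  exact: enorm_distD.
under eq_bigr => k _.
  rewrite ge0_integralD//; last 2 first.
  - by move=> z _; rewrite mule_ge0// lee_fin ?enorm_ge0.
  - exact: emeasurable_funM.
  rewrite ge0_integralZl//; last by rewrite lee_fin enorm_ge0.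
  rewrite intw.
  over.
rewrite big_split/= addeC; apply: leeD.
  rewrite -ge0_integral_sum//; apply: ge0_le_integral => //.
  - by move=> z _; apply: sume_ge0.
  - exact: emeasurable_sum.
  move=> z _; rewrite -ge0_sume_distrr// swE -EFinM lee_fin ler_piMr ?enorm_ge0//.
rewrite /c mulr_sumr -sumEFin; apply: lee_sum => k _.
by rewrite -EFinM mulrC.
Qed.
End W1.

(** * Uniqueness of the standard Gaussian measure and independence of its blocks *)

Section gauss_unique.
Variable R : realType.

Definition rectangles n : set (set 'rV[R]_n) :=
  [set [set x : 'rV[R]_n | forall i, A i (x 0 i)] | A in [set A : 'I_n -> set R | forall i, measurable (A i)]].

Lemma measurable_rectangle n (A : 'I_n -> set R) : (forall i, measurable (A i)) ->
  measurable [set x : 'rV[R]_n | forall i, A i (x 0 i)].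
Proof.
move=> mA; apply: measurable_forall => i; rewrite -[X in measurable X]setTI.
by apply: measurable_coord.
Qed.

(** For the less obvious inclusion, the identity map is measurable from the sigma-algebra of
    rectangles because each of its coordinates is. *)
Lemma measurable_rectanglesE n :
  (measurable : set (set 'rV[R]_n)) = <<s @rectangles n >>.
Proof.
apply/seteqP; split => A; last first.
  apply: smallest_sub; first exact: sigma_algebra_measurable.
  by move=> _ [B mB <-]; exact: measurable_rectangle.
move=> mA; pose f : g_sigma_algebraType (@rectangles n) -> 'rV[R]_n := id.
have mf : measurable_fun setT f.
  apply: measurable_fun_mx => i j _ B mB; rewrite ord1 setTI.
  apply: sub_sigma_algebra; exists (fun k => if k == j then B else setT).
    by move=> k; case: ifP.
  apply/seteqP; split => x /= h; last by move=> k; case: ifPn => // /eqP ->.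
  by have := h j; rewrite eqxx.
have := mf measurableT _ mA; rewrite setTI => h; exact: h.
Qed.

Lemma rectangles_setI n : setI_closed (@rectangles n).
Proof.
move=> _ _ [A mA <-] [B mB <-]; exists (fun i => A i `&` B i).
  by move=> i; exact: measurableI.
by apply/seteqP; split=> x /= => [h|[h1 h2]]; [split=> i; have [] := h i|move=> i; split].
Qed.

(** The rectangles generate the Borel sets and are stable under intersection. This links [std_gauss]
    with the given [gamma] and with Gaussian vectors assembled block by block. *)
Lemma standard_gaussian_unique n (mu nu : probability 'rV[R]_n R) :
  standard_gaussian mu -> standard_gaussian nu ->
  forall A, measurable A -> mu A = nu A.
Proof.
move=> hmu hnu; apply: (measure_unique (@rectangles n) (fun=> setT)).
- exact: measurable_rectanglesE.
- exact: rectangles_setI.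
- move=> _; exists (fun=> setT) => //.
  by apply/seteqP; split.
- by rewrite bigcup_const//; exists 0%N.
- move=> _ [A mA <-]; exact: etrans (hmu A mA) (esym (hnu A mA)).
- by move=> _; apply: (@le_lt_trans _ _ 1%E); [exact: probability_le1|exact: ltry].
Qed.
End gauss_unique.

Section blocks.
Variable R : realType.
Local Notation gam n := (std_gauss R n).

Definition cons_block n d (z : 'rV[R]_d * 'rV[R]_(n * d)) : 'rV[R]_(n.+1 * d) :=
  mxvec (\matrix_(i < n.+1) oapp (block z.2) z.1 (unlift ord0 i)).

Lemma cons_blockE n d (z : 'rV[R]_d * 'rV[R]_(n * d)) i j :
  cons_block z 0 (mxvec_index i j) = oapp (block z.2) z.1 (unlift ord0 i) 0 j.
Proof. by rewrite mxvecE mxE. Qed.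

Lemma block_cons n d (z : 'rV[R]_d * 'rV[R]_(n * d)) i :
  block (cons_block z) i = oapp (block z.2) z.1 (unlift ord0 i).
Proof. by rewrite /block mxvecK rowK. Qed.

Lemma blockE n d (u : 'rV[R]_(n * d)) i j : block u i 0 j = u 0 (mxvec_index i j).
Proof. by rewrite !mxE. Qed.

Lemma measurable_block n d i : measurable_fun setT (fun u : 'rV[R]_(n * d) => block u i).
Proof.
apply: measurable_fun_mx => k j; rewrite ord1.
rewrite (_ : (fun x => _) = (fun x : 'rV[R]_(n * d) => x 0 (mxvec_index i j))); last first.
  by apply/funext => x; rewrite blockE.
exact: measurable_coord.
Qed.

Lemma measurable_cons_block n d : measurable_fun setT (@cons_block n d).
Proof.
apply: measurable_fun_mx => i k; rewrite ord1; case/mxvec_indexP: k => k j.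
rewrite (_ : (fun x => _) = (fun z : 'rV[R]_d * 'rV[R]_(n * d) =>
   oapp (block z.2) z.1 (unlift ord0 k) 0 j)); last by apply/funext => z; rewrite cons_blockE.
case: unliftP => [l _|_] /=; last exact: (measurableT_comp (@measurable_coord R 1 d 0 j) measurable_fst).
rewrite (_ : (fun x => _) = (fun z : 'rV[R]_d * 'rV[R]_(n * d) => z.2 0 (mxvec_index l j))); last first.
  by apply/funext => z; rewrite blockE.
exact: (measurableT_comp (@measurable_coord R 1 (n * d) 0 _) measurable_snd).
Qed.

HB.instance Definition _ n d := isMeasurableFun.Build _ _ _ _ (@cons_block n d) (@measurable_cons_block n d).

Lemma big_mxvec (S : Type) (idx : S) (op : Monoid.com_law idx) n d (F : 'I_(n * d) -> S) :
  \big[op/idx]_(k < n * d) F k = \big[op/idx]_(i < n) \big[op/idx]_(j < d) F (mxvec_index i j).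
Proof.
rewrite pair_bigA (reindex _ (curry_mxvec_bij n d))/=.
by apply: eq_bigr => -[i j] _.
Qed.

Let unindex n d (k : 'I_(n * d)) : 'I_n * 'I_d := enum_val (cast_ord (esym (mxvec_cast n d)) k).

Let unindexK n d i j : @unindex n d (mxvec_index i j) = (i, j).
Proof. by rewrite /unindex cast_ordK enum_rankK. Qed.

(** [std_gauss] splits off single coordinates; through uniqueness this lemma splits off a whole
    block of [d] coordinates at once. *)
Lemma cons_block_gaussian n d :
  standard_gaussian (distribution (gam d \x gam (n * d))%E (@cons_block n d)).
Proof.
move=> A mA.
pose A0 j := A (mxvec_index ord0 j).
pose A1 k := A (mxvec_index (lift ord0 (@unindex n d k).1) (@unindex n d k).2).
transitivity ((gam d \x gam (n * d))%E
  ([set a : 'rV[R]_d | forall j, A0 j (a 0 j)] `*`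
   [set b : 'rV[R]_(n * d) | forall k, A1 k (b 0 k)])).
  rewrite /distribution /pushforward/=; congr (product_measure1 _ _ _); apply/seteqP; split.
    move=> z /= h; split=> /= [j|k].
      by have := h (mxvec_index ord0 j); rewrite cons_blockE unlift_none.
    case: (mxvec_indexP k) => i j; rewrite /A1 unindexK.
    by have := h (mxvec_index (lift ord0 i) j); rewrite cons_blockE liftK /= blockE.
  move=> [a b] /= [h1 h2] k; case/mxvec_indexP: k => i j; rewrite cons_blockE.
  case: (unliftP ord0 i) => [l ->|->] /=; last exact: h1.
  by rewrite blockE; have := h2 (mxvec_index l j); rewrite /A1 unindexK.
rewrite product_measure1E; [|by apply: measurable_rectangle => k; exact: mA|by apply: measurable_rectangle => k; exact: mA].
apply: (etrans (congr2 _ (std_gaussP (A := A0) _) (std_gaussP (A := A1) _))) => [k|k|].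
- exact: mA.
- exact: mA.
rewrite !big_mxvec big_ord_recl; congr (_ * _)%E.
by apply: eq_bigr => i _; apply: eq_bigr => j _; rewrite /A1 unindexK.
Qed.

Lemma ge0_integral_block_prod n d (h : 'I_n -> 'rV[R]_d -> R) :
  (forall i, measurable_fun setT (h i)) -> (forall i x, 0 <= h i x) ->
  (\int[gam (n * d)]_x (\prod_(i < n) h i (block x i))%:E =
   \prod_(i < n) \int[gam d]_x (h i x)%:E)%E.
Proof.
elim: n h => [|n IH] h mh h0.
  rewrite big_ord0 (eq_integral (cst 1%E)); last by move=> x _; rewrite big_ord0.
  by rewrite integral_cst// mul1e; exact: probability_setT.
have mprod m (k : 'I_m -> 'rV[R]_d -> R) : (forall i, measurable_fun setT (k i)) ->
    measurable_fun setT (fun x : 'rV[R]_(m * d) => \prod_(i < m) k i (block x i)).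
  move=> mk; apply: measurable_prod => i _.
  exact: (measurableT_comp (mk i) (@measurable_block m d i)).
have p0 m (k : 'I_m -> 'rV[R]_d -> R) (x : 'rV[R]_(m * d)) : (forall i x, 0 <= k i x) ->
    (0 <= (\prod_(i < m) k i (block x i))%:E)%E.
  by move=> k0; rewrite lee_fin prodr_ge0.
pose h' i := h (lift ord0 i).
transitivity (\int[distribution (gam d \x gam (n * d))%E (@cons_block n d)]_x
    (\prod_(i < n.+1) h i (block x i))%:E)%E.
  apply: eq_measure_integral => A mA _; apply: standard_gaussian_unique => //.
    exact: std_gaussP.
  exact: cons_block_gaussian.
rewrite ge0_integral_distribution//; last first.
- by move=> x; exact: p0.
- by apply/measurable_EFinP; exact: mprod.
rewrite (eq_integral (fun z : 'rV[R]_d * 'rV[R]_(n * d) => (h ord0 z.1 * \prod_(i < n) h' i (block z.2 i))%:E)); last first.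
  move=> z _ /=; rewrite big_ord_recl block_cons unlift_none/=.
  by congr (_ * _)%:E; apply: eq_bigr => i _; rewrite block_cons liftK.
rewrite fubini_tonelli1//; last 2 first.
- apply/measurable_EFinP; apply: measurable_funM.
    exact: (measurableT_comp (mh ord0) measurable_fst).
  exact: (measurableT_comp (mprod _ h' (fun i => mh (lift ord0 i))) measurable_snd).
- move=> z; rewrite EFinM; apply: mule_ge0; first by rewrite lee_fin.
  by apply: (p0 _ h') => i x; exact: h0.
rewrite /fubini_F big_ord_recl.
transitivity (\int[gam d]_x ((h ord0 x)%:E * \prod_(i < n) \int[gam d]_y (h' i y)%:E))%E.
  apply: eq_integral => x _; rewrite -IH; last 2 first.
  - by move=> i; exact: mh.
  - by move=> i y; exact: h0.
  rewrite -ge0_integralZl//=; first last.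
  - by rewrite lee_fin.
  - by move=> y _; apply: (p0 _ h') => i z; exact: h0.
  - by apply/measurable_EFinP; apply: (mprod _ h') => i; exact: mh.
rewrite ge0_integralZr//.
- by apply/measurable_EFinP.
- by move=> x _; rewrite lee_fin.
- by apply: prode_ge0 => i _; apply: integral_ge0 => x _; rewrite lee_fin; exact: h0.
Qed.
End blocks.
(** * Law of large numbers for the blocks *)

Section LLN.
Variable R : realType.
Local Notation gam n := (std_gauss R n).

(** From exp(-x) >= 1 - x follows exp(x) <= 1 / (1 - x), and (1 - x) (1 + x + 2 x^2) = 1 + x^2 (1 -
    2 x). *)
Lemma expR_le_quadratic (x : R) : `|x| <= 2^-1 -> expR x <= 1 + x + 2 * x ^+ 2.
Proof.
rewrite ler_norml => /andP[x1 x2].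
have y0 : 0 < 1 - x by lra.
have h : 1 - x <= (expR x)^-1 by rewrite -expRN; have := expR_ge1Dx (- x).
rewrite -(ler_pM2r y0); apply: (@le_trans _ _ 1).
  by rewrite (le_trans (ler_wpM2l (expR_ge0 x) h))// mulfV// gt_eqF// expR_gt0.
have : 0 <= x ^+ 2 * (1 - 2 * x) by rewrite mulr_ge0 ?sqr_ge0//; lra.
by rewrite -subr_ge0 => /le_trans; apply; rewrite le_eqVlt; apply/orP; left; apply/eqP; ring.
Qed.

Lemma integrable_bounded d (T : measurableType d) (P : probability T R) (h : T -> R) M :
  measurable_fun setT h -> (forall x, `|h x| <= M) -> P.-integrable setT (EFin \o h).
Proof.
move=> mh hM; apply: measurable_bounded_integrable => //.
  by apply: le_lt_trans (probability_le1 P measurableT) _; rewrite ltry.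
exists M; split; rewrite ?num_real// => N MN x _ /=; apply: (le_trans (hM x)); exact: ltW.
Qed.

Lemma expR_moment_le d (T : measurableType d) (P : probability T R) (h : T -> R) M l :
  measurable_fun setT h -> (forall x, `|h x| <= M) -> 0 <= l -> l * M <= 2^-1 ->
  (\int[P]_x (expR (l * h x))%:E <=
   (expR (l * (\int[P]_x h x)%R + 2 * (l * M) ^+ 2))%:E)%E.
Proof.
move=> mh hM l0 lM.
have b x : `|l * h x| <= l * M by rewrite normrM ger0_norm// ler_wpM2l.
have M0 (x : T) : 0 <= M by apply: le_trans (hM x).
have hi : P.-integrable setT (EFin \o h) by exact: integrable_bounded hM.
have hi' : P.-integrable setT (EFin \o (fun x => l * h x)).
  by apply: (@integrable_bounded _ _ _ _ (l * M)) => //; exact: measurable_funM.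
pose k := 1 + 2 * (l * M) ^+ 2.
have ki : P.-integrable setT (EFin \o (fun=> k)) by exact: finite_measure_integrable_cst.
have e : (\int[P]_x (k + l * h x) = k + l * \int[P]_x h x)%R.
  by rewrite RintegralD// RintegralZl// /Rintegral integral_cst//= [P _]probability_setT mule1.
have ms : measurable_fun setT (fun x => expR (l * h x)).
  by apply: measurableT_comp => //; exact: measurable_funM.
apply: (@le_trans _ _ (\int[P]_x (k + l * h x)%:E)%E).
  apply: ge0_le_integral => //.
  - exact/measurable_EFinP.
  - by apply/measurable_EFinP; apply: measurable_funD => //; exact: measurable_funM.
  move=> x _; rewrite lee_fin (le_trans (expR_le_quadratic (le_trans (b x) lM)))//.
  rewrite /k addrAC lerD2r lerD2l ler_wpM2l//.
  by rewrite -real_normK ?num_real// lerXn2r// ?nnegrE ?(le_trans _ (b x)).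
rewrite -[leLHS]fineK; last first.
  apply: integrable_fin_num => //.
  exact: (integrableD measurableT ki hi').
rewrite lee_fin [leLHS]e /k; apply: le_trans (expR_ge1Dx _).
by rewrite le_eqVlt; apply/orP; left; apply/eqP; ring.
Qed.

Lemma gauss_block_lln n d (h : 'rV[R]_d -> R) M t :
  measurable_fun setT h -> (forall x, `|h x| <= M) -> 0 < t <= 2 * M ->
  (gam (n * d) [set y : 'rV[R]_(n * d) |
      (((\int[gam d]_x h x) + t) * n%:R <= \sum_(i < n) h (block y i))%R]
   <= (expR (- (t ^+ 2 / (8 * M ^+ 2))) ^+ n)%:E)%E.
Proof.
move=> mh hM /andP[t0 tM]; have M0 : 0 < M by lra.
set m := (\int[gam d]_x h x)%R; set S := [set y | _].
(* [l] minimises - l t + 2 l^2 M^2, with minimum - t^2 / (8 M^2). The condition [t <= 2 * M] says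
   that [l * M <= 1 / 2], the range of the quadratic bound. *)
pose l := t / (4 * M ^+ 2).
have l0 : 0 <= l by rewrite divr_ge0// ?ltW// mulr_gt0// exprn_gt0.
have lME : l * M = t / (4 * M) by rewrite /l; field; rewrite gt_eqF.
have lM : l * M <= 2^-1.
  by rewrite lME ler_pdivrMr ?mulr_gt0//; lra.
have mf : measurable_fun setT (fun y : 'rV[R]_(n * d) => \sum_(i < n) h (block y i)).
  by apply: measurable_sum => i; exact: (measurableT_comp mh (@measurable_block R n d i)).
have mS : measurable S.
  rewrite -[X in measurable X]setTI; apply: measurable_fun_ler => //.
have mf' : measurable_fun setT (fun y : 'rV[R]_(n * d) => \prod_(i < n) expR (l * h (block y i))).
  apply: measurable_prod => i _; apply: measurableT_comp => //; apply: measurable_funM => //.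
  exact: (measurableT_comp mh (@measurable_block R n d i)).
have := @measure_le_integral _ _ _ (gam (n * d)) S _ (expR (l * ((m + t) * n%:R))) mS mf'
  (fun y => prodr_ge0 _ (fun i _ => expR_ge0 _)) (expR_ge0 _).
move=> /(_ _)/wrap[|H].
  by move=> y Sy; rewrite -expR_sum ler_expR -mulr_sumr ler_wpM2l.
have bnd x : 0 <= expR (l * h x) <= expR 2^-1.
  rewrite expR_ge0 ler_expR (le_trans (ler_norm _))// normrM ger0_norm//.
  by rewrite (le_trans _ lM)// ler_wpM2l.
have mh' : measurable_fun setT (fun x => expR (l * h x)).
  by apply: measurableT_comp => //; exact: measurable_funM.
pose I := (\int[gam d]_x expR (l * h x))%R.
have IE : (\int[gam d]_x (expR (l * h x))%:E)%E = I%:E by exact: fin_num_bounded_integral bnd.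
have I0 : 0 <= I by rewrite -lee_fin -IE; apply: integral_ge0 => x _; rewrite lee_fin expR_ge0.
have IM : I <= expR (l * m + 2 * (l * M) ^+ 2) by rewrite -lee_fin -IE; exact: expR_moment_le.
rewrite (ge0_integral_block_prod (h := fun _ x => expR (l * h x))) in H.
- rewrite (eq_bigr (fun=> I%:E)) in H; last by [].
  rewrite prodEFin prodr_const card_ord muleC -lee_pdivlMr ?expR_gt0// in H.
  apply: (le_trans H); rewrite -EFinM lee_fin -expRN.
  apply: (@le_trans _ _ (expR (l * m + 2 * (l * M) ^+ 2) ^+ n * expR (- (l * ((m + t) * n%:R))))).
    by rewrite ler_wpM2r ?expR_ge0// lerXn2r// nnegrE expR_ge0.
  rewrite -!expRM_natl -expRD ler_expR le_eqVlt; apply/orP; left; apply/eqP.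
  by rewrite /l; field; rewrite gt_eqF.
- by [].
- by move=> _ x; rewrite expR_ge0.
Qed.
End LLN.

(** * Wasserstein distance estimated through a countable partition *)

Section cells.
Variable R : realType.

Lemma measurable_fun_nat_comp d (T : measurableType d) d' (T' : measurableType d')
    (k : T -> nat) (G : nat -> T') :
  (forall j, measurable [set z | k z = j]) -> measurable_fun setT (fun z => G (k z)).
Proof.
move=> mk _ B mB; rewrite setTI.
rewrite (_ : _ @^-1` B = \bigcup_(j in [set j | B (G j)]) [set z | k z = j]); last first.
  by apply/seteqP; split=> z /= => [Bz|[j Bj e]]; [exists (k z)|rewrite e].
by rewrite bigcup_mkcond; apply: bigcupT_measurable => j; case: ifP.
Qed.

Lemma sum_eq_nat (m j0 : nat) (F : nat -> R) : (forall j, (m <= j)%N -> F j = 0) ->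
  \sum_(j < m) (j0 == j)%:R * F j = F j0.
Proof.
move=> F0; have [jm|mj] := ltnP j0 m.
  rewrite (bigD1 (Ordinal jm))//= eqxx mul1r big1 ?addr0// => j nj.
  by rewrite (_ : (j0 == j) = false) ?mul0r//; apply: contraNF nj => /eqP e; apply/eqP; exact: val_inj.
rewrite F0// big1// => j _; rewrite (_ : (j0 == j) = false) ?mul0r//.
by apply/negbTE; rewrite gtn_eqF// (leq_trans (ltn_ord j)).
Qed.

Variables (d n m : nat) (y : 'I_n.+1 -> 'rV[R]_d) (nu : probability 'rV[R]_d R).
Variables (kap : 'rV[R]_d -> nat) (a : nat -> R) (h t : R).
Hypothesis mkap : forall j, measurable [set z | kap z = j].
Hypothesis diam : forall x z, kap x = kap z -> enorm (x - z) <= h.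

Definition cell_freq j := n.+1%:R^-1 * \sum_(i < n.+1) (kap (y i) == j)%:R : R.
Local Notation phat := cell_freq.
Local Notation p j := (fine (nu [set z | kap z = j])).
Hypotheses (a0 : forall j, 0 <= a j) (aph : forall j, a j <= phat j)
  (ap : forall j, a j <= p j) (am : forall j, (m <= j)%N -> a j = 0).
Let M := 1 - \sum_(j < m) a j.
Hypotheses (M0 : 0 < M) (t0 : 0 < t).

Let phat0 j : 0 <= phat j. Proof. exact: le_trans (aph j). Qed.
Let p0 j : 0 <= p j. Proof. exact: le_trans (ap j). Qed.

(** Division by 0 returns 0, which is the right value for empty cells: [z = 0] forces [x = 0]. *)
Let divK_le (x z : R) : 0 <= x -> x <= z -> x / z * z = x.
Proof.
move=> x0 xz; have [z0|nz] := eqVneq z 0; last by rewrite divfK.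
by rewrite z0 mulr0; apply/eqP; rewrite eq_le x0 -z0 xz.
Qed.

Let div_le1 (x z : R) : 0 <= x -> x <= z -> 0 <= x / z <= 1.
Proof.
move=> x0 xz; rewrite divr_ge0//=; last exact: le_trans xz.
have [->|nz] := eqVneq z 0; first by rewrite invr0 mulr0.
by rewrite ler_pdivrMr ?mul1r// lt_neqAle eq_sym nz (le_trans x0).
Qed.

Let integral_cell (G : nat -> R) : (forall j, 0 <= G j) -> (forall j, (m <= j)%N -> G j = 0) ->
  (\int[nu]_z (G (kap z))%:E = (\sum_(j < m) G j * p j)%:E)%E.
Proof.
move=> G0 Gm.
transitivity (\int[nu]_z (\sum_(j < m) (G j * \1_[set z | kap z = j] z)%:E))%E.
  apply: eq_integral => z _; rewrite sumEFin; congr EFin.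
  rewrite -[LHS](sum_eq_nat _ Gm); apply: eq_bigr => j _; rewrite mulrC; congr (_ * _).
  rewrite indicE; case: eqP => e; first by rewrite mem_set.
  by rewrite memNset.
rewrite ge0_integral_sum//; last 2 first.
- by move=> j; apply/measurable_EFinP; apply: measurable_funM => //; exact: measurable_indic.
- by move=> j z _; rewrite lee_fin mulr_ge0.
rewrite -sumEFin; apply: eq_bigr => j _.
under eq_integral do rewrite EFinM.
rewrite ge0_integralZl//; last by rewrite lee_fin.
  rewrite integral_indic// setIT EFinM fineK//.
  exact: fin_num_measure.
by apply/measurable_EFinP; exact: measurable_indic.
Qed.

Let avg (F : nat -> R) : (forall j, (m <= j)%N -> F j = 0) ->
  n.+1%:R^-1 * \sum_(i < n.+1) F (kap (y i)) = \sum_(j < m) F j * phat j.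
Proof.
move=> Fm; under eq_bigr do rewrite -(sum_eq_nat _ Fm).
rewrite exchange_big mulr_sumr; apply: eq_bigr => j _.
by rewrite /phat mulrCA; congr (_ * _); rewrite mulr_sumr; apply: eq_bigr => i _; rewrite mulrC.
Qed.

(* A mass a j is coupled inside the j-th cell; the remaining masses of the two
   measures are coupled independently. *)
Let w1 j := 1 - a j / phat j.
Let w2 j := 1 - a j / p j.
Let b j := a j / phat j / p j.
Let r i z := w1 (kap (y i)) * w2 (kap z) / M.
(** Joint density of the index of the atom and of the second point, relative to counting measure
    times [nu]. Its marginals are computed in [integral_w] and [sum_w]. *)
Let w (i : 'I_n.+1) z := n.+1%:R^-1 * ((kap (y i) == kap z)%:R * b (kap z) + r i z).

Let w1_ge0 j : 0 <= w1 j.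
Proof. by rewrite subr_ge0; case/andP: (div_le1 (a0 j) (aph j)). Qed.
Let w2_ge0 j : 0 <= w2 j.
Proof. by rewrite subr_ge0; case/andP: (div_le1 (a0 j) (ap j)). Qed.
Let b_ge0 j : 0 <= b j.
Proof. by rewrite !divr_ge0. Qed.
Let r_ge0 i z : 0 <= r i z.
Proof. by rewrite /r divr_ge0 ?mulr_ge0// ltW. Qed.
Let w_ge0 i z : 0 <= w i z.
Proof. by rewrite /w mulr_ge0 ?invr_ge0// addr_ge0// mulr_ge0. Qed.

Let mr i : measurable_fun setT (r i).
Proof. exact: (@measurable_fun_nat_comp _ _ _ _ kap (fun j => w1 (kap (y i)) * w2 j / M)). Qed.

Let mw i : measurable_fun setT (w i).
Proof.
apply: (@measurable_fun_nat_comp _ _ _ _ kap (fun j => n.+1%:R^-1 * ((kap (y i) == j)%:R * b j + w1 (kap (y i)) * w2 j / M))).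
exact: mkap.
Qed.

Let bE j : b j * p j = a j / phat j.
Proof.
rewrite /b mulrAC -mulrA mulrC -!mulrA; have := divK_le (a0 j) (ap j).
rewrite mulrC => {2}<-; ring.
Qed.

Let bE' j : b j * phat j = a j / p j.
Proof. by rewrite /b -mulrA [X in _ * X]mulrC mulrA divK_le. Qed.

Let integral_w2 : (\int[nu]_z (w2 (kap z))%:E = M%:E)%E.
Proof.
have mc (G : nat -> R) : measurable_fun setT (fun z => (G (kap z))%:E).
  by apply/measurable_EFinP; exact: measurable_fun_nat_comp.
have : (\int[nu]_z ((w2 (kap z))%:E + (a (kap z) / p (kap z))%:E) = 1)%E.
  rewrite -[RHS](probability_setT nu) -[RHS]mul1e -integral_cst//.
  by apply: eq_integral => z _; rewrite -EFinD subrK.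
rewrite ge0_integralD//; last 3 first.
- by move=> z _; rewrite lee_fin.
- by move=> z _; rewrite lee_fin divr_ge0.
- exact: (mc (fun j => a j / p j)).
rewrite (integral_cell (G := fun j => a j / p j)); last 2 first.
- by move=> j; rewrite divr_ge0.
- by move=> j mj; rewrite am// mul0r.
rewrite (eq_bigr (fun j : 'I_m => a j)); last by move=> j _; exact: divK_le.
by move=> e; rewrite /M EFinB -e addeK.
Qed.

Let integral_r i : (\int[nu]_z (r i z)%:E = (w1 (kap (y i)))%:E)%E.
Proof.
transitivity (\int[nu]_z ((w1 (kap (y i)) / M)%:E * (w2 (kap z))%:E))%E.
  by apply: eq_integral => z _; rewrite -EFinM /r mulrAC.
rewrite ge0_integralZl//.
- by rewrite integral_w2 -EFinM divfK// gt_eqF.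
- by apply/measurable_EFinP; exact: measurable_fun_nat_comp.
- by move=> z _; rewrite lee_fin.
- by rewrite lee_fin divr_ge0// ltW.
Qed.

Let integral_w i : (\int[nu]_z (w i z)%:E = (n.+1%:R^-1)%:E)%E.
Proof.
have mc (G : nat -> R) : measurable_fun setT (fun z => (G (kap z))%:E).
  by apply/measurable_EFinP; exact: measurable_fun_nat_comp.
pose G j := (kap (y i) == j)%:R * b j.
have G0 j : 0 <= G j by rewrite mulr_ge0.
transitivity (\int[nu]_z ((n.+1%:R^-1)%:E * ((G (kap z))%:E + (r i z)%:E)))%E.
  by apply: eq_integral.
have mrE : measurable_fun setT (fun z => (r i z)%:E) by exact/measurable_EFinP.
rewrite ge0_integralZl//; last 2 first.
- exact: (emeasurable_funD (mc G) mrE).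
- by move=> z _; rewrite adde_ge0// lee_fin.
rewrite ge0_integralD//; [|by move=> z _; rewrite lee_fin|by move=> z _; rewrite lee_fin].
rewrite (integral_cell (G := G))//; last by move=> j mj; rewrite /G /b am// !mul0r mulr0.
rewrite integral_r (eq_bigr (fun j : 'I_m => (kap (y i) == j)%:R * (b j * p j))); last first.
  by move=> j _; rewrite /G mulrA.
rewrite (sum_eq_nat _ (F := fun j => b j * p j)); last by move=> j mj; rewrite /b am// !mul0r.
by rewrite bE -EFinD -EFinM /w1 addrC subrK mulr1.
Qed.

Let avg_w1 : n.+1%:R^-1 * \sum_(i < n.+1) w1 (kap (y i)) = M.
Proof.
rewrite /w1 sumrB mulrBr sumr_const card_ord -[_ *+ _]mulr_natr mul1r mulVf ?pnatr_eq0//.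
rewrite (avg (F := fun j => a j / phat j)); last by move=> j mj; rewrite am// mul0r.
by congr (_ - _); apply: eq_bigr => j _; exact: divK_le.
Qed.

Let sum_w z : \sum_(i < n.+1) w i z = 1.
Proof.
rewrite /w -mulr_sumr big_split/= mulrDr.
have -> : n.+1%:R^-1 * \sum_(i < n.+1) (kap (y i) == kap z)%:R * b (kap z) = a (kap z) / p (kap z).
  by rewrite -mulr_suml mulrA -bE' [RHS]mulrC.
have -> : n.+1%:R^-1 * \sum_(i < n.+1) r i z = w2 (kap z).
  rewrite /r -mulr_suml -mulr_suml !mulrA avg_w1 mulrAC mulfV ?mul1r// gt_eqF//.
by rewrite /w2 addrC subrK.
Qed.

(** Matched mass travels at most [h]. The unmatched part has mass [M], but its cost |y| + |z| is
    unbounded; x <= t x^2 + 1 / (4 t) trades it for second moments with the small factor [t], plus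
    [M / (2 * t)]. *)
Lemma W1_empirical_cells (Y Z : R) :
  n.+1%:R^-1 * \sum_(i < n.+1) enorm (y i) ^+ 2 <= Y ->
  (\int[nu]_z (enorm z ^+ 2)%:E <= Z%:E)%E ->
  (W1 (empirical y) nu <= (h + t * (Y + Z) + M / (2 * t))%:E)%E.
Proof.
move=> hY hZ.
pose phi i (z : 'rV[R]_d) : 'rV[R]_d * 'rV[R]_d := (y i, z).
have mphi i : measurable_fun setT (phi i) by exact: measurable_fun_pair.
have w1e : (\sum_(i < n.+1) \int[nu]_z (w i z)%:E = 1)%E.
  rewrite (eq_bigr (fun=> (n.+1%:R^-1)%:E)); last by move=> k _; exact: integral_w.
  by rewrite sumEFin sumr_const card_ord -[_ *+ _]mulr_natr mulVf// pnatr_eq0.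
pose pi := mixture_prob mw w_ge0 mphi w1e.
have mwE i : measurable_fun setT (fun z => (w i z)%:E) by exact/measurable_EFinP.
have w0E i z : (0 <= (w i z)%:E)%E by rewrite lee_fin.
have swE z : (\sum_(k < n.+1) (w k z)%:E = 1)%E by rewrite sumEFin sum_w.
have cpl : coupling (empirical y) nu pi.
  move=> A mA; split; rewrite /pushforward.
    transitivity (mixture nu mw w_ge0 mphi (fst @^-1` A)) => //.
    rewrite mixtureE; last by rewrite -[X in measurable X]setTI; exact: measurable_fst.
    rewrite /empirical ge0_sume_distrr//; apply: eq_bigr => k _.
    rewrite (eq_integral (fun z => (\1_A (y k))%:E * (w k z)%:E)%E); last by [].
    by rewrite ge0_integralZl// ?lee_fin// integral_w muleC.
  transitivity (mixture nu mw w_ge0 mphi (snd @^-1` A)) => //.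
  have mA2 : measurable (snd @^-1` A : set ('rV[R]_d * 'rV[R]_d)).
    by rewrite -[X in measurable X]setTI; exact: measurable_snd.
  have mI : measurable_fun setT (fun z => (\1_A z)%:E : \bar R).
    by apply/measurable_EFinP; exact: measurable_indic.
  rewrite mixtureE// -ge0_integral_sum//; first last.
  - by move=> k z _; rewrite mule_ge0// lee_fin.
  - by move=> k; exact: emeasurable_funM.
  transitivity (\int[nu]_z (\1_A z)%:E)%E; last by rewrite integral_indic// setIT.
  apply: eq_integral => z _.
  transitivity (\sum_(k < n.+1) (\1_A z)%:E * (w k z)%:E)%E; first by [].
  by rewrite -ge0_sume_distrr// swE mule1.
apply: (@le_trans _ _ (\int[pi]_z (enorm (z.1 - z.2))%:E)%E).
  by apply: ereal_inf_lbound; exists pi.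
rewrite (_ : integral _ _ _ = \int[mixture nu mw w_ge0 mphi]_z (enorm (z.1 - z.2))%:E)%E//.
rewrite ge0_integral_mixture//; last 2 first.
- by apply/measurable_EFinP; exact: measurable_dist.
- by move=> z; rewrite lee_fin enorm_ge0.
have mn : measurable_fun setT (fun z : 'rV[R]_d => (t * enorm z ^+ 2)%:E).
  by apply/measurable_EFinP; apply: measurable_funM => //; exact: measurable_enorm_sqr.
have mrE i : measurable_fun setT (fun z => ((2 * t)^-1 / n.+1%:R * r i z)%:E).
  by apply/measurable_EFinP; apply: measurable_funM.
pose f1 i z := ((h + t * enorm (y i) ^+ 2)%:E * (w i z)%:E)%E.
pose f2 i z := ((t * enorm z ^+ 2)%:E * (w i z)%:E)%E.
pose f3 i z := ((2 * t)^-1 / n.+1%:R * r i z)%:E.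
have h00 : 0 <= h by apply: le_trans (diam (erefl (kap 0))); rewrite enorm_ge0.
have h0 i : 0 <= h + t * enorm (y i) ^+ 2 by rewrite addr_ge0 ?mulr_ge0 ?enorm_ge0 ?(ltW t0).
have f10 i z : (0 <= f1 i z)%E by rewrite mule_ge0// lee_fin.
have f20 i z : (0 <= f2 i z)%E by rewrite mule_ge0// lee_fin mulr_ge0 ?sqr_ge0 ?(ltW t0).
have t2 : 0 <= (2 * t)^-1 by rewrite invr_ge0 mulr_ge0// ltW.
have f30 i z : (0 <= f3 i z)%E.
  by rewrite lee_fin; apply: mulr_ge0 => //; apply: mulr_ge0 => //; rewrite invr_ge0.
have mf1 i : measurable_fun setT (f1 i) by apply: emeasurable_funM.
have mf2 i : measurable_fun setT (f2 i) by apply: emeasurable_funM.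
have mf3 i : measurable_fun setT (f3 i) by exact: mrE.
apply: (@le_trans _ _ (\sum_(i < n.+1) \int[nu]_z (f1 i z + f2 i z + f3 i z))%E).
  apply: lee_sum => i _; apply: ge0_le_integral => //.
  - by move=> z _; rewrite mule_ge0// lee_fin enorm_ge0.
  - apply: emeasurable_funM => //; apply/measurable_EFinP.
    exact: (measurableT_comp (@measurable_dist R d) (mphi i)).
  - by do 2 apply: emeasurable_funD => //.
  move=> z _; rewrite /f1 /f2 /f3 -!EFinM -!EFinD lee_fin /=.
  have wr : (2 * t)^-1 / n.+1%:R * r i z <= (2 * t)^-1 * w i z.
    rewrite -mulrA ler_wpM2l// /w ler_wpM2l ?invr_ge0// lerDr.
    by rewrite mulr_ge0.
  have [e|ne] := eqVneq (kap (y i)) (kap z).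
    apply: (@le_trans _ _ (h * w i z)); first by rewrite ler_wpM2r// diam.
    rewrite mulrDl -!addrA lerDl; apply: addr_ge0.
      by apply: mulr_ge0 => //; rewrite mulr_ge0 ?sqr_ge0// ltW.
    apply: addr_ge0; first by apply: mulr_ge0 => //; rewrite mulr_ge0 ?sqr_ge0// ltW.
    by apply: mulr_ge0 => //; apply: mulr_ge0 => //; rewrite invr_ge0.
  have -> : (2 * t)^-1 / n.+1%:R * r i z = (2 * t)^-1 * w i z.
    by rewrite /w (negbTE ne) mul0r add0r mulrA.
  rewrite -!mulrDl ler_wpM2r// (le_trans (enormB _ _))//.
  have am_gm x : x <= t * x ^+ 2 + (4 * t)^-1.
    have t4 : 0 < 4 * t by rewrite mulr_gt0.
    rewrite -subr_ge0 -(pmulr_rge0 _ t4).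
    rewrite (_ : 4 * t * _ = (2 * t * x - 1) ^+ 2) ?sqr_ge0//.
    by field; rewrite gt_eqF.
  have := lerD (am_gm (enorm (y i))) (am_gm (enorm z)).
  move=> /le_trans; apply.
  have -> : (2 * t)^-1 = (4 * t)^-1 + (4 * t)^-1 by field; rewrite gt_eqF.
  by rewrite -subr_ge0 (_ : _ - _ = h)//; ring.
have int1 i : (\int[nu]_z f1 i z = ((h + t * enorm (y i) ^+ 2) / n.+1%:R)%:E)%E.
  rewrite /f1 ge0_integralZl//; last by rewrite lee_fin.
  by rewrite integral_w -EFinM.
have int3 i : (\int[nu]_z f3 i z = ((2 * t)^-1 * (n.+1%:R^-1 * w1 (kap (y i))))%:E)%E.
  rewrite /f3; under eq_integral do rewrite EFinM.
  rewrite ge0_integralZl//.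
  - by rewrite integral_r -EFinM mulrA.
  - exact/measurable_EFinP.
  - by move=> z _; rewrite lee_fin.
  - by rewrite lee_fin; apply: mulr_ge0 => //; rewrite invr_ge0.
rewrite (eq_bigr (fun i => ((h + t * enorm (y i) ^+ 2) / n.+1%:R)%:E +
  (\int[nu]_z f2 i z + ((2 * t)^-1 * (n.+1%:R^-1 * w1 (kap (y i))))%:E)))%E; last first.
  move=> i _; rewrite ge0_integralD//; last by apply: emeasurable_funD.
    rewrite (ge0_integralD _ measurableT (fun z _ => f10 i z) (mf1 i) (fun z _ => f20 i z) (mf2 i)).
    by rewrite int1 int3; exact/esym/addeA.
  by move=> z _; rewrite adde_ge0.
rewrite big_split/= big_split/= !sumEFin -!mulr_sumr avg_w1.
have -> : (\sum_(i < n.+1) \int[nu]_z f2 i z = t%:E * \int[nu]_z (enorm z ^+ 2)%:E)%E.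
  rewrite -ge0_integral_sum// -ge0_integralZl//.
  - apply: eq_integral => z _; rewrite /f2 -ge0_sume_distrr// swE mule1 EFinM//.
  - by apply/measurable_EFinP; exact: measurable_enorm_sqr.
  - by move=> z _; rewrite lee_fin sqr_ge0.
  - by rewrite lee_fin ltW.
apply: (@le_trans _ _ ((\sum_(i < n.+1) (h + t * enorm (y i) ^+ 2) / n.+1%:R)%:E +
   (t%:E * Z%:E + ((2 * t)^-1 * M)%:E))%E).
  by rewrite leeD2l// leeD2r// lee_wpmul2l// lee_fin ltW.
rewrite -EFinM -!EFinD lee_fin -mulr_suml big_split/= sumr_const card_ord -mulr_sumr.
rewrite mulrDl -[h *+ _]mulr_natr mulfK ?pnatr_eq0// [M / _]mulrC [t * (Y + Z)]mulrDr.
rewrite -!addrA lerD2l lerD2r -mulrA ler_wpM2l ?(ltW t0)//.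
by rewrite mulrC.
Qed.
End cells.
Section grid.
Variables (R : realType) (d : nat) (h : R).
Hypothesis h0 : 0 < h.

(** Cubes of side [h], numbered through [pickle]; a natural number that encodes no integer vector
    gives an empty cell. *)
Definition grid_cell (z : 'rV[R]_d) : nat := pickle (\row_k Num.floor (z 0 k / h)).

Lemma measurable_grid_cell j : measurable [set z | grid_cell z = j].
Proof.
rewrite (_ : [set z | _] = \bigcup_(c in [set c : 'rV[int]_d | pickle c = j])
    [set z : 'rV[R]_d | forall k, (c 0 k)%:~R <= z 0 k / h < (c 0 k + 1)%:~R]); last first.
  apply/seteqP; split=> [z zj|z /= [c cj zc]] /=.
    exists (\row_k Num.floor (z 0 k / h)) => //= k; rewrite mxE.
    exact: floor_itv.
  rewrite -cj; congr pickle; apply/rowP => k; rewrite mxE; apply: floor_def.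
  exact: zc.
rewrite bigcup_mkcond; apply: countable_bigcupT_measurable => // c; case: ifP => // _.
apply: measurable_forall => k.
rewrite (_ : (fun x => _) = [set z : 'rV[R]_d | (c 0 k)%:~R <= z 0 k / h] `&`
   [set z : 'rV[R]_d | z 0 k / h < (c 0 k + 1)%:~R]); last first.
  by apply/seteqP; split=> z /= => [/andP//|[-> ->]].
have mz : measurable_fun setT (fun z : 'rV[R]_d => z 0 k / h).
  by apply: measurable_funM => //; exact: measurable_coord.
apply: measurableI; rewrite -[X in measurable X]setTI.
- exact: measurable_fun_ler.
- exact: measurable_fun_ltr.
Qed.

Lemma grid_cell_diam x z : grid_cell x = grid_cell z -> enorm (x - z) <= d%:R * h.
Proof.
move=> /(pcan_inj pickleK)/rowP e; apply: le_trans (enorm_le_sum _) _.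
apply: (@le_trans _ _ (\sum_(k < d) h)); last by rewrite sumr_const card_ord mulr_natl.
apply: ler_sum => k _; have := e k; rewrite !mxE => ek.
have /andP[x1 x2] := floor_itv (x 0 k / h); have /andP[z1 z2] := floor_itv (z 0 k / h).
rewrite ek !intrD in x1 x2 z1 z2.
suff : `|x 0 k / h - z 0 k / h| <= 1.
  by rewrite -mulrBl normrM normfV (gtr0_norm h0) ler_pdivrMr// mul1r.
by rewrite ler_norml; apply/andP; split; lra.
Qed.
End grid.

(** * Typical events under the Gaussian measure *)

Section likely.
Variables (R : realType) (d : nat).
Local Notation gam n := (std_gauss R n).

(** No rate is recorded: concentration asks only for a typical set of measure at least 1/2. The form
    of the definition is stable under finite intersections. *)
Definition likely (E : forall n, set 'rV[R]_(n * d)) : Prop :=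
  (forall n, measurable (E n)) /\
  forall e, 0 < e -> \forall n \near \oo, (gam (n * d) (~` E n) <= e%:E)%E.

Lemma likelyI E F : likely E -> likely F -> likely (fun n => E n `&` F n).
Proof.
move=> [mE hE] [mF hF]; split=> [n|e e0]; first exact: measurableI.
have e2 : 0 < e / 2 by rewrite divr_gt0.
near=> n; rewrite setCI.
apply: le_trans (measureU2 _ _ _) _; [exact: measurableC|exact: measurableC|].
rewrite (splitr e) EFinD; apply: leeD; near: n.
- exact: hE.
- exact: hF.
Unshelve. all: by end_near.
Qed.

Lemma likelyT : likely (fun=> setT).
Proof.
split=> // e e0; near=> n; rewrite setCT measure0 lee_fin ltW//.
Unshelve. all: by end_near.
Qed.

Lemma likely_forall (m : nat) (E : nat -> forall n, set 'rV[R]_(n * d)) :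
  (forall j, (j < m)%N -> likely (E j)) ->
  likely (fun n => [set y | forall j, (j < m)%N -> E j n y]).
Proof.
elim: m => [|m IH] hE.
  rewrite (_ : (fun n => _) = fun=> setT); first exact: likelyT.
  by apply: functional_extensionality_dep => n; apply/seteqP; split.
rewrite (_ : (fun n => _) =
    (fun n => [set y : 'rV[R]_(n * d) | forall j, (j < m)%N -> E j n y] `&` E m n)).
  apply: likelyI; last exact: hE.
  by apply: IH => j jm; apply: hE; exact: leq_trans jm _.
apply: functional_extensionality_dep => n; apply/seteqP; split=> y /=.
  by move=> h; split=> [j jm|]; apply: h => //; exact: leq_trans jm _.
by move=> [h1 h2] j; rewrite ltnS leq_eqVlt => /predU1P[->//|]; exact: h1.
Qed.

Lemma likely_geometric (E : forall n, set 'rV[R]_(n * d)) C c :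
  (forall n, measurable (E n)) -> 0 <= c < 1 ->
  (forall n, (gam (n * d) (~` E n) <= (C * c ^+ n)%:E)%E) -> likely E.
Proof.
move=> mE /andP[c0 c1] hE; split=> // e e0.
have : geometric C c n @[n --> \oo] --> (0 : R) by apply: cvg_geometric; rewrite ger0_norm.
move=> /cvgr_lt /(_ _ e0) h; near=> n; apply: le_trans (hE n) _; rewrite lee_fin ltW//.
by near: n; exact: h.
Unshelve. all: by end_near.
Qed.

Lemma enorm_blocks n (u : 'rV[R]_(n * d)) : enorm u ^+ 2 = \sum_(i < n) enorm (block u i) ^+ 2.
Proof.
rewrite enorm_sqr big_mxvec; apply: eq_bigr => i _; rewrite enorm_sqr.
by apply: eq_bigr => j _; rewrite blockE.
Qed.

Lemma likely_lln (h : 'rV[R]_d -> R) M t : measurable_fun setT h ->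
  (forall x, `|h x| <= M) -> 0 < t ->
  likely (fun n => [set y | \sum_(i < n) h (block y i) < ((\int[gam d]_x h x)%R + t) * n%:R]).
Proof.
(* The enlarged bound [M'] is positive and satisfies [t <= 2 * M'], as [gauss_block_lln]
   requires. *)
move=> mh hM t0; pose M' := M + t.
have M0 : 0 <= M by apply: le_trans (hM 0).
have M'0 : 0 < M' by rewrite ltr_wpDl.
apply: (@likely_geometric _ 1 (expR (- (t ^+ 2 / (8 * M' ^+ 2))))).
- move=> n; rewrite -[X in measurable X]setTI; apply: measurable_fun_ltr => //.
  by apply: measurable_sum => i; exact: (measurableT_comp mh (@measurable_block R n d i)).
- rewrite expR_ge0 expR_lt1 oppr_lt0 divr_gt0 ?exprn_gt0//.
  by rewrite mulr_gt0// exprn_gt0.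
move=> n; rewrite mul1r; have h' : forall x, `|h x| <= M'.
  by move=> x; rewrite (le_trans (hM x))// lerDl ltW.
apply: le_trans (gauss_block_lln (t := t) n mh h' _); last first.
  by rewrite t0/= /M'; lra.
rewrite le_eqVlt; apply/orP; left; apply/eqP; congr (gam _ _).
by apply/seteqP; split=> y /=; rewrite ?leNgt => /negP.
Qed.
End likely.

Section W1_lln.
Variables (R : realType) (d : nat).
Local Notation gam n := (std_gauss R n).

(** Up to normalisation the density of the law of variance 2 is exp(|z|^2 / 4), and 4 exp(x / 4) >=
    x. Any finite bound would serve. *)
Lemma second_moment_gauss : (\int[gam d]_z (enorm z ^+ 2)%:E <= (4 * Num.sqrt 2 ^+ d)%:E)%E.
Proof.
pose s : R := Num.sqrt 2; have s0 : 0 < s by rewrite sqrtr_gt0.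
have s2 : s ^+ 2 = 2 by rewrite sqr_sqrtr.
have c0 : 0 <= 4 * s ^+ d by rewrite mulr_ge0// exprn_ge0// ltW.
have mt : measurable_fun setT (fun z : 'rV[R]_d => (tilt s 0 z)%:E).
  by apply/measurable_EFinP; exact: measurable_tilt.
have t0 (z : 'rV[R]_d) : (0 <= (tilt s 0 z)%:E)%E by rewrite lee_fin tilt_ge0.
rewrite -[leRHS]mule1 -(integral_tilt (0 : 'rV[R]_d) s0) -ge0_integralZl//.
apply: ge0_le_integral => //.
- by move=> z _; rewrite lee_fin sqr_ge0.
- by apply/measurable_EFinP; exact: measurable_enorm_sqr.
- by apply: emeasurable_funM.
move=> z _; rewrite -EFinM lee_fin /tilt subr0 s2 exprVn [_^-1 * _]mulrC mulrA.
rewrite -/s mulrAC mulfK; last by rewrite gt_eqF// exprn_gt0.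
have -> : enorm z ^+ 2 / 2 - enorm z ^+ 2 / (2 * 2) = enorm z ^+ 2 / 4 by field.
have := expR_ge1Dx (enorm z ^+ 2 / 4); lra.
Qed.

(** The three thirds of [e] pay for the cell diameter, the second moments and the unmatched mass in
    [W1_empirical_cells]. The law of large numbers is applied to finitely many cells carrying almost
    all the mass. The bound on [enorm y] is a separate hypothesis because bounded test functions do
    not control second moments. *)
Lemma W1_lln e : 0 < e -> exists E : forall n, set 'rV[R]_(n * d), likely E /\
  forall n (y : 'rV[R]_(n * d)), (0 < n)%N -> E n y -> enorm y ^+ 2 <= 2 * (n * d)%:R ->
  (W1 (empirical (block y)) (gam d) <= e%:E)%E.
Proof.
move=> e0.
pose h := e / (3 * (d%:R + 1)).
have h0 : 0 < h by rewrite divr_gt0// mulr_gt0// ltr_wpDl.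
have div_bound (x : R) : 0 <= x -> x * (e / (3 * (x + 1))) <= e / 3.
  move=> x0; have x1 : 0 < 3 * (x + 1) by rewrite mulr_gt0// ltr_wpDl.
  rewrite -subr_ge0 (_ : _ - _ = e / (3 * (x + 1))); first by rewrite divr_ge0// ltW.
  by field; rewrite gt_eqF// ltr_wpDl.
have dh : d%:R * h <= e / 3 by exact: div_bound.
pose kap := grid_cell (d := d) h.
pose p j : R := fine (gam d [set z | kap z = j]).
pose Z : R := 4 * Num.sqrt 2 ^+ d.
have Z0 : 0 <= Z by rewrite mulr_ge0// exprn_ge0// sqrtr_ge0.
pose t := e / (3 * (2 * d%:R + Z + 1)).
have t0 : 0 < t by rewrite divr_gt0// mulr_gt0// ltr_wpDl// addr_ge0// mulr_ge0.
have tYZ : t * (2 * d%:R + Z) <= e / 3.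
  by rewrite mulrC; apply: div_bound; rewrite addr_ge0// mulr_ge0.
(* Matching [(1 - eta) * p j] in cells of total mass at least [1 - eta] leaves at most 1 - (1 -
   eta)^2 <= 2 eta unmatched; the second bound then makes [M / (2 * t)] at most [e / 3]. *)
pose eta := Num.min 2^-1 (e * t / 3).
have eta0 : 0 < eta by rewrite lt_min invr_gt0 ltr0n/= divr_gt0// mulr_gt0.
have eta1 : eta <= 2^-1 by rewrite ge_min lexx.
have p0 j : 0 <= p j by rewrite fine_ge0.
have mkap j : measurable [set z | kap z = j] by exact: measurable_grid_cell.
have [m /andP[hm hm1]] : exists m, 1 - eta <= \sum_(j < m) p j <= 1.
  have cv : (\sum_(0 <= j < k) p j) @[k --> \oo] --> (1 : R).
    have U : \bigcup_j [set z | kap z = j] = setT by apply/seteqP; split=> // z _; exists (kap z).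
    have tr : trivIset setT (fun j => [set z | kap z = j]) by move=> i j _ _ [z [/= <- <-]].
    have cv : (\sum_(0 <= j < k) (p j)%:E)%E @[k --> \oo] --> (1 : \bar R)%E.
      rewrite -(probability_setT (gam d)) -U.
      rewrite (_ : (fun k => _) = (fun k => \sum_(0 <= j < k) gam d [set z | kap z = j])%E).
        exact: measure_sigma_additive.
      by apply/funext => k; apply: eq_bigr => j _; rewrite fineK// fin_num_measure.
    rewrite (_ : (fun k => _) = fine \o (fun k => \sum_(0 <= j < k) (p j)%:E)%E).
      exact: fine_cvg cv.
    by apply/funext => k /=; rewrite sumEFin.
  have le1 k : \sum_(0 <= j < k) p j <= 1.
    have nd : nondecreasing_seq (fun k => \sum_(0 <= j < k) p j).
      by apply/nondecreasing_seqP => i; rewrite big_nat_recr//= lerDl.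
    rewrite -(cvg_lim _ cv)//; apply: nondecreasing_cvgn_le => //.
    by apply/cvg_ex; exists 1.
  have lt1 : 1 - eta < 1 by rewrite gtrBl.
  have [k _ /(_ _ (leqnn k))hk] := (cvgr_gt _ cv) _ lt1.
  exists k; rewrite -(big_mkord xpredT) le1 andbT; exact: ltW.
(* The sign turns the upper bound of [likely_lln] into a lower bound on the frequency of a cell. *)
pose f j (z : 'rV[R]_d) : R := - 1 * \1_[set z | kap z = j] z.
have mI j : measurable_fun setT (\1_[set z | kap z = j] : 'rV[R]_d -> R) by exact: measurable_indic.
have I1 j (z : 'rV[R]_d) : `|\1_[set z | kap z = j] z| <= 1 :> R.
  by rewrite indicE normr_nat lern1 leq_b1.
have mf j : measurable_fun setT (f j) by exact: measurable_funM.
have f1 j z : `|f j z| <= 1 by rewrite /f mulN1r normrN.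
have intf j : (\int[gam d]_x f j x)%R = - p j.
  rewrite /f RintegralZl//; last exact: integrable_bounded (I1 j).
  by rewrite /Rintegral integral_indic// setIT mulN1r.
(* The tolerance [eta * p j] has to be positive; for a cell of mass 0 the required lower bound on
   the frequency is 0. *)
pose E j n : set 'rV[R]_(n * d) := if 0 < p j then
  [set y | \sum_(i < n) f j (block y i) < ((\int[gam d]_x f j x)%R + eta * p j) * n%:R]
  else setT.
exists (fun n => [set y | forall j, (j < m)%N -> E j n y]); split.
  apply: likely_forall => j _; rewrite /E; case: (ltP 0 (p j)) => [pj|_]; last exact: likelyT.
  by apply: (likely_lln (M := 1)) => //; exact: mulr_gt0.
case=> [//|n] y _ Ey hy.
pose a j := if (j < m)%N then (1 - eta) * p j else 0.
have a0 j : 0 <= a j by rewrite /a; case: ifP => // _; rewrite mulr_ge0//; lra.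
have aph j : a j <= cell_freq (block y) kap j.
  rewrite /a; case: ifPn => [jm|_]; last first.
    by rewrite /cell_freq mulr_ge0 ?invr_ge0// sumr_ge0.
  have := p0 j; rewrite le_eqVlt => /predU1P[<-|pj].
    by rewrite mulr0 /cell_freq mulr_ge0 ?invr_ge0// sumr_ge0.
  have := Ey j jm; rewrite /E pj/= intf /f -mulr_sumr mulN1r.
  rewrite /cell_freq [_^-1 * _]mulrC ler_pdivlMr ?ltr0n// => /ltW.
  rewrite lerNl -mulNr (_ : - (- p j + eta * p j) = (1 - eta) * p j); last by ring.
  move=> /le_trans; apply; apply: ler_sum => i _; rewrite indicE.
  by case: eqP => e'; [rewrite mem_set|rewrite memNset].
have ap j : a j <= fine (gam d [set z | kap z = j]).
  rewrite /a; case: ifP => _; last exact: p0.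
  by rewrite -[leRHS]mul1r ler_wpM2r ?p0//; lra.
have am j : (m <= j)%N -> a j = 0 by rewrite /a leqNgt => /negbTE ->.
have sa : \sum_(j < m) a j = (1 - eta) * \sum_(j < m) p j.
  by rewrite mulr_sumr; apply: eq_bigr => j _; rewrite /a ltn_ord.
have M0 : 0 < 1 - \sum_(j < m) a j.
  by rewrite sa; nra.
have Mle : 1 - \sum_(j < m) a j <= 2 * eta by rewrite sa; nra.
apply: le_trans (W1_empirical_cells (h := d%:R * h) mkap _ a0 aph ap am M0 t0 (Y := 2 * d%:R) _ second_moment_gauss) _.
- by move=> x z; exact: grid_cell_diam.
- rewrite -enorm_blocks mulrC ler_pdivrMr ?ltr0n// (le_trans hy)// natrM; nra.
rewrite lee_fin (_ : e = e / 3 + e / 3 + e / 3); last by field.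
apply: lerD; first exact: lerD.
have t20 : 0 < 2 * t by rewrite pmulr_rgt0.
rewrite ler_pdivrMr//; apply: (le_trans Mle).
have : eta <= e * t / 3 by rewrite ge_min lexx orbT.
lra.
Qed.
End W1_lln.

(** * Comparison of the rate function with the logarithm *)

Section calculus.
Variable R : realType.

Lemma mul_cos_le_sin (x : R) : 0 <= x <= pi / 2 -> x * cos x <= sin x.
Proof.
move=> /andP[x0 x1].
pose f (y : R) := y * cos y - sin y.
have df (y : R) : is_derive y 1 f (- y * sin y).
  rewrite /f; apply: is_derive_eq; rewrite !scaler1 /GRing.scale/=; ring.
have : f x <= f 0.
  apply: (@ler0_derive1_nincr R f 0 (pi / 2)) => //.
  - move=> y yi; rewrite derive1E derive_val mulNr oppr_le0.
    move: yi; rewrite in_itv/= => /andP[y0 y1].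
    by rewrite mulr_ge0 ?ltW// sin_gt0_pi// y0 (lt_trans y1)// ltr_pdivrMr// ltr_pMr ?pi_gt0// ltr1n.
  - by apply: derivable_within_continuous => y _; exact: ex_derive.
by rewrite /f mul0r sin0 subr0 subr_le0.
Qed.

(** The derivative of cos y exp(y^2 / 2) has the sign of y cos y - sin y. *)
Lemma cos_le_expR (x : R) : 0 <= x <= pi / 2 -> cos x <= expR (- (x ^+ 2 / 2)).
Proof.
move=> /andP[x0 x1].
pose f (y : R) := cos y * expR (y ^+ 2 / 2).
have df (y : R) : is_derive y 1 f ((y * cos y - sin y) * expR (y ^+ 2 / 2)).
  by rewrite /f; apply: is_derive_eq; rewrite /GRing.scale/= !mulr1; field.
have : f x <= f 0.
  apply: (@ler0_derive1_nincr R f 0 (pi / 2)) => //.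
  - move=> y; rewrite in_itv/= => /andP[y0 y1].
    rewrite derive1E derive_val mulr_le0_ge0 ?expR_ge0// subr_le0.
    by rewrite mul_cos_le_sin// !ltW.
  - by apply: derivable_within_continuous => y _; exact: ex_derive.
rewrite /f cos0 expr0n/= mul0r expR0 mulr1 => h.
by rewrite expRN -[leRHS]mul1r ler_pdivlMr ?expR_gt0.
Qed.

Lemma alpha_le_ln (d : nat) (r : R) : (0 < d)%N -> 0 < r -> r < 2 * d%:R ->
  ((d%:R * ln (1 - r / (2 * d%:R)))%:E <= - alpha d r)%E.
Proof.
move=> d0 r0 r2d; have dR : 0 < d%:R :> R by rewrite ltr0n.
rewrite /alpha ifT; last by apply/andP; split; lra.
set s := Num.sqrt r / _.
have s0 : 0 <= s by rewrite divr_ge0 ?sqrtr_ge0// mulr_ge0 ?sqrtr_ge0.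
have s2 : s ^+ 2 = r / (4 * d%:R).
  rewrite /s expr_div_n exprMn !sqr_sqrtr ?ltW//; congr (_ / _); ring.
have s1 : s ^+ 2 < 2^-1.
  by rewrite s2 ltr_pdivrMr ?mulr_gt0//; lra.
have s11 : -1 <= s <= 1.
  apply/andP; split; first by lra.
  by rewrite leNgt; apply/negP => s1'; move: s1; nra.
pose ph := asin s.
have sph : sin ph = s by have [] := asin_def s11.
have phb := asin_lepi2 s11.
have ph0 : 0 <= ph.
  rewrite leNgt; apply/negP => n0.
  have : sin (- ph) > 0.
    rewrite sin_gt0_pi// oppr_gt0 n0/= ltrNl; apply: lt_le_trans (asin_geNpi2 s11).
    by rewrite ltrN2 ltr_pdivrMr// ltr_pMr ?pi_gt0// ltr1n.
  by rewrite sinN sph oppr_gt0 ltNge s0.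
have c2 : cos (ph *+ 2) = 1 - r / (2 * d%:R).
  rewrite cos_mulr2n -[cos ph ^+ 2](addrK (sin ph ^+ 2)) cos2Dsin2 sph s2 -mulr_natl.
  by field; rewrite gt_eqF.
have q0 : 0 < 1 - r / (2 * d%:R).
  by rewrite subr_gt0 ltr_pdivrMr ?mul1r// mulr_gt0.
(* A priori [2 ph <= pi]; positivity of its cosine brings it down to [pi / 2], the range of
   [cos_le_expR]. *)
have ph4 : ph *+ 2 <= pi / 2.
  rewrite leNgt; apply/negP => h.
  have : cos (ph *+ 2) <= 0.
    rewrite -[ph *+ 2](subrK pi) cosDpi oppr_le0 cos_ge0_pihalf//.
    by move: phb h; rewrite -/ph -mulr_natl => phb h; apply/andP; split; lra.
  by rewrite c2 leNgt q0.
rewrite -EFinN lee_fin.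
have -> : - (2 * d%:R * asin s ^+ 2) = d%:R * - ((ph *+ 2) ^+ 2 / 2).
  by rewrite -mulr_natl /ph; field.
apply: ler_wpM2l; first exact: ltW.
rewrite -ler_expR lnK ?posrE// -c2 cos_le_expR// ph4 andbT.
by rewrite mulrn_wge0.
Qed.
End calculus.

(** * Exponential bounds and the upper limit *)

Section limsup.
Variable R : realType.

Lemma limn_esup_le (u : nat -> \bar R) (c : \bar R) :
  (\forall n \near \oo, u n <= c)%E -> (limn_esup u <= c)%E.
Proof.
move=> h; apply: (@le_trans _ _ (ereal_sup (u @` [set n | (u n <= c)%E]))).
  by apply: ereal_inf_lbound; exists [set n | (u n <= c)%E].
by apply: ge_ereal_sup => _ [n /= un <-].
Qed.

(** The factor [C] contributes [ln C / n], eventually below any [e]; probability 0 is covered by the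
    monotonicity of [lne] on the extended half-line. *)
Lemma limn_esup_lne_le (p : nat -> \bar R) (C c : R) : 0 < C ->
  (forall n, 0 <= p n)%E ->
  (\forall n \near \oo, (p n <= (C * expR (c * n%:R))%:E)%E) ->
  (limn_esup (fun n => (n%:R^-1)%:E * lne (p n)) <= c%:E)%E.
Proof.
move=> C0 p0 hp; apply/lee_addgt0Pr => e e0; apply: limn_esup_le.
near=> n.
have n0 : 0 < n%:R :> R by rewrite ltr0n; near: n; exact: nbhs_infty_gt.
have E0 : 0 < C * expR (c * n%:R) by rewrite mulr_gt0 ?expR_gt0.
have hn : ln C <= e * n%:R.
  by rewrite mulrC -ler_pdivrMr//; near: n; exact: nbhs_infty_ger.
apply: (@le_trans _ _ ((n%:R^-1)%:E * lne (C * expR (c * n%:R))%:E)%E).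
  apply: lee_wpmul2l; first by rewrite lee_fin invr_ge0.
  have pn : (p n <= (C * expR (c * n%:R))%:E)%E by near: n.
  by rewrite lee_lne// in_itv/= leey andbT; [exact: p0|rewrite lee_fin; exact: ltW].
rewrite lne_EFin// lnM ?posrE ?expR_gt0// expRK -EFinM -EFinD lee_fin.
by rewrite mulrC ler_pdivrMr// mulrDl addrC lerD2l.
Unshelve. all: by end_near.
Qed.
End limsup.
(** * Deviations on the sphere *)

Section typical.
Variables (R : realType) (d : nat).
Hypothesis d0 : (0 < d)%N.
Local Notation gam n := (std_gauss R n).

Lemma likely_shell dlt : 0 < dlt < 1 -> likely (fun n => @shell R (n * d) 1 dlt).
Proof.
move=> dlt01; have /andP[dlt0 _] := dlt01; have /andP[b0 b1] := chernoff_base_bounds dlt0.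
apply: (@likely_geometric _ _ _ 2 (chernoff_base dlt ^+ d)).
- by move=> n; exact: measurable_shell.
- by rewrite exprn_ge0// exprn_ilt1// -lt0n.
by move=> n; rewrite -exprM mulnC; exact: gauss_shellC.
Qed.

(** Coordinates are unbounded, so [likely_lln] does not apply. The sum of the [k]-th coordinates of
    all blocks is a linear functional, and [gauss_linear] controls it for either sign. *)
Lemma likely_mean e : 0 < e -> exists E : forall n, set 'rV[R]_(n * d), likely E /\
  forall n (y : 'rV[R]_(n * d)), E n y -> enorm (average (block y)) <= e.
Proof.
move=> e0; pose t := e / d%:R; have t0 : 0 < t by rewrite divr_gt0// ltr0n.
(* The entry (-1)^b stands at place [k] of every block, whence squared norm [n]. The tolerance
   [t = e / d] per coordinate adds up to [e]. *)
pose w (b : bool) (k : 'I_d) n : 'rV[R]_(n * d) := mxvec (\matrix_(i, j) ((-1) ^+ b * (j == k)%:R)).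
have wE b k n i j : w b k n 0 (mxvec_index i j) = (-1) ^+ b * (j == k)%:R by rewrite mxvecE mxE.
have sw b k n : enorm (w b k n) ^+ 2 = n%:R.
  rewrite enorm_sqr big_mxvec (eq_bigr (fun=> 1)) ?sumr_const ?card_ord//.
  move=> i _; rewrite (bigD1 k)//= wE eqxx mulr1 sqrr_sign big1 ?addr0// => j jk.
  by rewrite wE (negbTE jk) mulr0 expr0n.
have xw b k n (x : 'rV[R]_(n * d)) :
    \sum_(i < n * d) x 0 i * w b k n 0 i = (-1) ^+ b * \sum_(i < n) block x i 0 k.
  rewrite big_mxvec mulr_sumr; apply: eq_bigr => i _.
  rewrite (bigD1 k)//= wE eqxx mulr1 big1 ?addr0; first by rewrite blockE mulrC.
  by move=> j jk; rewrite wE (negbTE jk) !mulr0.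
pose E (b : bool) (k : 'I_d) n := [set y : 'rV[R]_(n * d) | (-1) ^+ b * \sum_(i < n) block y i 0 k < t * n%:R].
have lE b k : likely (E b k).
  apply: (@likely_geometric _ _ _ 1 (expR (- (t ^+ 2 / 2)))).
  - move=> n; rewrite -[X in measurable X]setTI; apply: measurable_fun_ltr => //.
    apply: measurable_funM => //; apply: measurable_sum => i.
    exact: (measurableT_comp (@measurable_coord R 1 d 0 k) (@measurable_block R n d i)).
  - by rewrite expR_ge0 expR_lt1 oppr_lt0 divr_gt0 ?exprn_gt0.
  move=> n; rewrite mul1r.
  have := gauss_linear (w b k n) (ltW t0); rewrite sw.
  rewrite -expRM_natr mulNr [_ / 2 * n%:R]mulrAC => H; apply: le_trans H.
  rewrite le_eqVlt; apply/orP; left; apply/eqP; congr (gam _ _).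
  by apply/seteqP; split=> y; rewrite /E /= xw leNgt => /negP.
pose F (j : nat) n : set 'rV[R]_(n * d) :=
  if insub j is Some k then E true k n `&` E false k n else setT.
exists (fun n => [set y | forall j, (j < d)%N -> F j n y]); split.
  apply: likely_forall => j jd; rewrite /F; case: insubP => [k _ _|]; last by rewrite jd.
  by apply: likelyI.
case=> [|n] y Ey.
  rewrite /average big_ord0 scaler0 /enorm big1 ?sqrtr0 ?ltW// => i _.
  by rewrite mxE expr0n.
apply: le_trans (enorm_le_sum _) _.
apply: (@le_trans _ _ (\sum_(k < d) t)); last first.
  by rewrite sumr_const card_ord -mulr_natr /t divfK// gt_eqF// ltr0n.
apply: ler_sum => k _; have := Ey k (ltn_ord k); rewrite /F valK => -[].
rewrite /E /= !mulN1r expr0 mul1r => h1 h2.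
rewrite /average mxE summxE normrM normfV (ger0_norm (ler0n _ _)) mulrC ler_pdivrMr ?ltr0n//.
by rewrite ler_norml lerNl !ltW.
Qed.
End typical.

(** With s = |g| / sqrt N close to [a] and |u|^2 = N, one has |s u - y|^2 = (s^2 - s) N + (1 - s)
    |y|^2 + s |u - y|^2, and |y|^2 close to N turns the first two terms into (s - 1)^2 N. The errors
    add up: 3 a^2 and 2 a + a r / d from replacing [s] by [a], 1 + 2 a from |y|^2, and 4 a + 4 from
    replacing [s *: u] by [x]. *)
Lemma sphere_dist_ge (R : realType) (n d : nat) (u y g x : 'rV[R]_(n * d)) (a r dlt : R) :
  (0 < n)%N -> (0 < d)%N -> 1 <= a -> 0 <= r -> 0 < dlt <= 2^-1 ->
  enorm u = Num.sqrt (n * d)%:R -> shell 1 dlt y -> shell a dlt g ->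
  n%:R * (r - dlt) <= enorm (u - y) ^+ 2 ->
  enorm (x - (enorm g / Num.sqrt (n * d)%:R) *: u) < dlt ->
  (n * d)%:R * ((a - 1) ^+ 2 + a * r / d%:R - dlt * (3 * a ^+ 2 + 8 * a + 5 + a * r / d%:R))
    <= enorm (x - y) ^+ 2.
Proof.
move=> n0 d0 a1 r0 /andP[dl0 dl1] uN /andP[y1 y2] /andP[g1 g2] huy hx.
rewrite expr1n mul1r in y1 y2.
have nd0 : (0 < n * d)%N by rewrite muln_gt0 n0.
set N : R := (n * d)%:R in uN hx y1 y2 g1 g2 *.
have N1 : 1 <= N by rewrite ler1n.
have N0 : 0 < N by rewrite (lt_le_trans ltr01).
set q := Num.sqrt N in uN hx.
have q0 : 0 < q by rewrite sqrtr_gt0.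
have q2 : q ^+ 2 = N by rewrite sqr_sqrtr// ltW.
have q1 : 1 <= q by rewrite -[leLHS]sqrtr1 ler_sqrt// ltW.
have qN : q <= N by rewrite -q2 expr2 ler_peMr// ltW.
have dR1 : 1 <= d%:R :> R by rewrite ler1n.
set s := enorm g / q in hx *.
have s0 : 0 <= s by rewrite divr_ge0 ?enorm_ge0// ltW.
have s2 : s ^+ 2 = enorm g ^+ 2 / N by rewrite expr_div_n q2.
have sa1 : (1 - dlt) * a ^+ 2 <= s ^+ 2 by rewrite s2 ler_pdivlMr// -mulrA.
have sa2 : s ^+ 2 <= (1 + dlt) * a ^+ 2 by rewrite s2 ler_pdivrMr// -mulrA.
have sl : (1 - dlt) * a <= s.
  rewrite -(ler_pXn2r (_ : 0 < 2)%N) ?nnegrE//; last by apply: mulr_ge0; lra.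
  by apply: le_trans sa1; rewrite exprMn ler_wpM2r ?sqr_ge0//; nra.
have su : s <= (1 + dlt) * a.
  rewrite -(ler_pXn2r (_ : 0 < 2)%N) ?nnegrE//; last by apply: mulr_ge0; lra.
  by apply: (le_trans sa2); rewrite exprMn ler_wpM2r ?sqr_ge0//; nra.
have s2a : s <= 2 * a by nra.
pose p := enorm (s *: u - y).
have p0 : 0 <= p by exact: enorm_ge0.
have yq : enorm y <= 2 * q.
  rewrite -(ler_pXn2r (_ : 0 < 2)%N) ?nnegrE ?enorm_ge0//; last by apply: mulr_ge0; rewrite // ltW.
  by rewrite exprMn q2; nra.
have pq : p <= (2 * a + 2) * N.
  apply: (le_trans (enormB _ _)); rewrite enormZ ger0_norm// uN mulrDl; apply: lerD.
    by apply: ler_pM => //; exact: ltW.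
  by apply: (le_trans yq); rewrite ler_wpM2l.
have xp : p ^+ 2 - 2 * dlt * p <= enorm (x - y) ^+ 2.
  have : p <= enorm (x - y) + dlt.
    rewrite /p (le_trans (enorm_distD x _ _))// addrC lerD2l enorm_distC ltW//.
  have := enorm_ge0 (x - y); move: (enorm (x - y)) => z z0 pz.
  have [h|h] := leP p dlt.
    by apply: le_trans (sqr_ge0 _); nra.
  nra.
have pE : p ^+ 2 = (s ^+ 2 - s) * N + (1 - s) * enorm y ^+ 2 + s * enorm (u - y) ^+ 2.
  rewrite /p !enormB_sqr enormZ dotrZl exprMn uN q2 real_normK ?num_real//; ring.
have h1 : (1 - s) * N - dlt * (1 + 2 * a) * N <= (1 - s) * enorm y ^+ 2.
  rewrite -mulrBl.
  by have [s1|s1] := leP s 1; nra.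
have h2 : s * (N * (r / d%:R - dlt)) <= s * enorm (u - y) ^+ 2.
  apply: ler_wpM2l => //; apply: le_trans huy.
  rewrite /N natrM -mulrA ler_wpM2l// mulrBr mulrCA mulfV ?mulr1 ?gt_eqF ?ltr0n// lerD2l lerN2.
  by rewrite ler_peMl// ltW.
set rho := r / d%:R in h2; rewrite -/rho -![a * r / d%:R]mulrA -/rho.
have rho0 : 0 <= rho by rewrite divr_ge0.
apply: le_trans xp.
apply: (@le_trans _ _ (p ^+ 2 - 2 * dlt * ((2 * a + 2) * N))); last first.
  by rewrite lerD2l lerN2 ler_wpM2l// mulr_ge0// ltW.
have h3 : (a - 1) ^+ 2 - dlt * (3 * a ^+ 2) <= (s - 1) ^+ 2.
  have e : (s - 1) ^+ 2 - (a - 1) ^+ 2 = (s - a) * (s + a - 2) by ring.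
  have : - (dlt * a * (3 * a)) <= (s - a) * (s + a - 2).
    have k1 : - (dlt * a) <= s - a by lra.
    have k2 : s - a <= dlt * a by lra.
    have k3 : s + a - 2 <= 3 * a by lra.
    have k4 : - (3 * a) <= s + a - 2 by lra.
    have k0 : 0 <= dlt * a by nra.
    nra.
  lra.
have h4 : a * rho - dlt * (a * rho) - dlt * (2 * a) <= s * (rho - dlt).
  nra.
suff : N * ((a - 1) ^+ 2 - dlt * (3 * a ^+ 2) + (a * rho - dlt * (a * rho) - dlt * (2 * a))
   - dlt * (1 + 2 * a)) <= p ^+ 2 by lra.
apply: (@le_trans _ _ (N * ((s - 1) ^+ 2 + s * (rho - dlt) - dlt * (1 + 2 * a)))).
  by apply: ler_wpM2l; [exact: ltW|rewrite lerD2r lerD].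
rewrite pE; lra.
Qed.
Section sphere_deviation.
Variables (R : realType) (d : nat).
Hypothesis d0 : (0 < d)%N.
Local Notation gam n := (std_gauss R n).

Lemma continuous_sum_seq (T : topologicalType) (I : Type) (s : seq I) (f : I -> T -> R) :
  (forall i, continuous (f i)) -> continuous (fun x => \sum_(i <- s) f i x).
Proof.
move=> cf; elim: s => [|i s IH] x.
  by rewrite (_ : (fun _ => _) = cst 0); [exact: cvg_cst|apply/funext => z; rewrite big_nil].
rewrite (_ : (fun _ => _) = (fun x => f i x + \sum_(j <- s) f j x)).
  by apply: continuousD; [exact: cf|exact: IH].
by apply/funext => z; rewrite big_cons.
Qed.

Lemma continuous_enorm_dist n (c : 'rV[R]_n) : continuous (fun x : 'rV[R]_n => enorm (x - c)).
Proof.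
move=> x; apply: (@continuous_comp _ _ _ (fun x : 'rV[R]_n => \sum_(i < n) (x - c) 0 i ^+ 2) Num.sqrt).
  apply: (@continuous_sum_seq _ _ _ (fun i (x : 'rV[R]_n) => (x - c) 0 i ^+ 2)) => i {}x.
  rewrite (_ : (fun _ => _) = (fun x : 'rV[R]_n => (x 0 i - c 0 i) ^+ 2)); last first.
    by apply/funext => z; rewrite sub_mxE.
  apply: (@continuous_comp _ _ _ (fun x : 'rV[R]_n => x 0 i) (fun t => (t - c 0 i) ^+ 2)).
    exact: coord_continuous.
  apply: (@continuous_comp _ _ _ (fun t => t - c 0 i) (fun t => t ^+ 2)).
    by apply: (@continuousB _ _ _ id (fun=> c 0 i)); [exact: cvg_id|exact: cvg_cst].
  exact: exprn_continuous.
exact: sqrt_continuous.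
Qed.

(** Arbitrary unions of such balls are open, hence Borel. This gives the measurability of the
    enlarged set [G] below and of the [W1] event. *)
Lemma open_enorm_ball n (c : 'rV[R]_n) e : open [set x | enorm (x - c) < e].
Proof.
rewrite (_ : [set x | _] = (fun x => enorm (x - c)) @^-1` [set t : R | t < e]); last by [].
by apply: open_comp; [move=> x _; exact: continuous_enorm_dist|exact: open_lt].
Qed.

(** Solves the concentration inequality for the weighted measure of the far set when the other set
    has measure at least 1/2. The bound depends on [l] alone, hence not on the dimension. *)
Lemma powR_le_bound (X b l : R) : 0 <= X -> 2^-1 <= b -> 0 < l < 1 ->
  X `^ (1 - l) * b `^ l <= 1 -> X <= (2 `^ l) `^ (1 - l)^-1.
Proof.
move=> X0 b2 /andP[l0 l1] h.
have b0 : 0 < b by apply: lt_le_trans b2; rewrite invr_gt0.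
have : X `^ (1 - l) <= 2 `^ l.
  rewrite -(ler_pM2r (_ : 0 < 2^-1 `^ l)) ?powR_gt0// -powRM// mulfV// powR1.
  apply: le_trans h; apply: ler_wpM2l; first exact: powR_ge0.
  by apply: ge0_ler_powR => //; rewrite ?nnegrE ltW.
have l10 : 0 < (1 - l)^-1 by rewrite invr_gt0 subr_gt0.
move=> /(ge0_ler_powR (ltW l10)); rewrite -powRrM mulfV ?subr_eq0 ?gt_eqF// powRr1//.
by apply; rewrite nnegrE powR_ge0.
Qed.

Variables (sigma : forall n, probability 'rV[R]_(n * d) R).
Hypothesis sigma_unif : forall n, (0 < n)%N ->
  uniform_on_sphere (Num.sqrt (d * n)%:R) (sigma n).
Variables (A : forall n, set 'rV[R]_(n * d)) (r : R).
Hypotheses (mA : forall n, measurable (@A n)) (r0 : 0 < r).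
Hypothesis far : forall e, 0 < e -> exists E : forall n, set 'rV[R]_(n * d), likely E /\
  forall n (u y : 'rV[R]_(n * d)), (0 < n)%N -> @A n u -> enorm u = Num.sqrt (d * n)%:R ->
  E n y -> n%:R * (r - e) <= enorm (u - y) ^+ 2.

Let q := 1 - r / (2 * d%:R).

Lemma sphere_deviation_tilt a : 1 <= a ->
  (limn_esup (fun n => (n%:R^-1)%:E * lne (sigma n (@A n))) <= (d%:R * (a * q - 1 - ln a))%:E)%E.
Proof.
move=> a1; apply/lee_addgt0Pr => k k0; rewrite -EFinD.
have a0 : 0 < a by lra.
have dR : 0 < d%:R :> R by rewrite ltr0n.
pose t0 := (a - 1) ^+ 2 + a * r / d%:R.
pose C1 := 3 * a ^+ 2 + 8 * a + 5 + a * r / d%:R.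
have ar0 : 0 <= a * r / d%:R by rewrite divr_ge0// mulr_ge0 ?ltW.
have t00 : 0 <= t0 by rewrite addr_ge0// sqr_ge0.
have C10 : 0 <= C1 by rewrite /C1; nra.
(* The errors in the exponent total at most [n * dl * D], so [dl <= k / D] lets the slack [k] absorb
   them. *)
pose D := d%:R * (t0 + C1 + a ^+ 2).
have D0 : 0 < D by have := exprn_gt0 2 a0 => a2; rewrite /D mulr_gt0//; lra.
pose dl := Num.min 2^-1 (k / D).
have dl0 : 0 < dl by rewrite lt_min invr_gt0 ltr0n/= divr_gt0.
have dl1 : dl <= 2^-1 by rewrite ge_min lexx.
have dlD : dl * D <= k by rewrite -ler_pdivlMr// ge_min lexx orbT.
have [E [[mE lE] farE]] := far dl0.
have dl01 : 0 < dl < 1 by apply/andP; split; lra.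
have [mS lS] := likely_shell d0 dl01.
have [_ lB] := likelyI (conj mE lE) (conj mS lS).
pose l := 1 - dl.
have l01 : 0 < l < 1 by apply/andP; split; rewrite /l; lra.
pose K : R := (2 `^ l) `^ (1 - l)^-1.
have K0 : 0 < K by rewrite !powR_gt0.
apply: (@limn_esup_lne_le _ _ (2 * K)); first by rewrite mulr_gt0.
  by move=> n; exact: measure_ge0.
have h2 : (0 : R) < 2^-1 by [].
have := lB _ h2 => {}lB.
have /andP[cb0 cb1] := chernoff_base_bounds dl0.
have cbd : chernoff_base dl ^+ d < 1 by rewrite exprn_ilt1// -lt0n.
have lC : \forall n \near \oo, chernoff_base dl ^+ (n * d) <= 4^-1.
  have : geometric 1 (chernoff_base dl ^+ d) n @[n --> \oo] --> (0 : R).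
    by apply: cvg_geometric; rewrite ger0_norm// exprn_ge0.
  move=> /cvgr_lt /(_ 4^-1) h; near=> n; rewrite mulnC exprM -[leLHS]mul1r ltW//.
  by near: n; apply: h; rewrite invr_gt0.
near=> n.
have n0 : (0 < n)%N by near: n; exact: nbhs_infty_gt.
have Cn : chernoff_base dl ^+ (n * d) <= 4^-1 by near: n; exact: lC.
have Bn : (gam (n * d) (~` (E n `&` @shell R (n * d) 1 dl)) <= 2^-1%:E)%E by near: n; exact: lB.
have nd0 : (0 < n * d)%N by rewrite muln_gt0 n0.
have dn : (d * n)%:R = (n * d)%:R :> R by rewrite mulnC.
have us := sigma_unif n0; rewrite dn in us.
set N : R := (n * d)%:R in us.
have N0 : 0 < N by rewrite ltr0n.
have q0 : 0 < Num.sqrt N by rewrite sqrtr_gt0.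
pose B := E n `&` @shell R (n * d) 1 dl.
have mB : measurable B by exact: measurableI.
have gB : 2^-1 <= fine (gam (n * d) B).
  have gBE : gam (n * d) B = (fine (gam (n * d) B))%:E by rewrite fineK// fin_num_measure.
  have := Bn; rewrite [X in (X <= _)%E -> _](probability_setC _ mB).
  by rewrite [X in (_ - X)%E]gBE -EFinB lee_fin; lra.
pose S := @shell R (n * d) a dl.
have mS' : measurable S by exact: measurable_shell.
(* The neighborhood of radius [dl] leaves the room that the smoothing in [sphere_mul_gauss_le]
   requires, and its openness makes this possibly uncountable union measurable. *)
pose G : set 'rV[R]_(n * d) := \bigcup_(z in [set z : 'rV[R]_(n * d) * 'rV[R]_(n * d) |
   @A n z.1 /\ enorm z.1 = Num.sqrt N /\ S z.2])
   [set x | enorm (x - (enorm z.2 / Num.sqrt N) *: z.1) < dl].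
have mG : measurable G.
  by apply: open_measurable_mx; apply: bigcup_open => z _; exact: open_enorm_ball.
pose T := N * (t0 - dl * C1).
have GB x y : G x -> B y -> T <= enorm (x - y) ^+ 2.
  move=> [[u g] /= [Au [uN Sg]] xg] [Ey Sy].
  apply: (@sphere_dist_ge R n d u y g x a r dl) => //; first exact: ltW.
    by apply/andP; split.
  by apply: farE => //; rewrite dn.
have gG := powR_le_bound _ gB l01 (gauss_concentration l01 mG mB GB).
have {}gG : expR (l * T / 2) * fine (gam (n * d) G) <= K.
  by apply: gG; rewrite mulr_ge0 ?expR_ge0// fine_ge0.
have sG : (sigma n (@A n) * gam (n * d) S <= gam (n * d) G)%E.
  have h := sphere_mul_gauss_le q0 us dl0 (sqrtr_ge0 ((1 + dl) * (a ^+ 2 * N))) (@mA n) mS' mG.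
  apply: h.
  - move=> g /andP[_ hg]; rewrite -[leLHS]ger0_norm ?enorm_ge0// -sqrtr_sqr.
    by rewrite ler_wsqrtr.
  - by move=> u g x Au uN Sg xg; exists (u, g).
have gS : 2^-1 * a ^+ (n * d) * expR (- ((a ^+ 2 - 1) * (1 + dl) / 2 * N)) <= fine (gam (n * d) S).
  by exact: gauss_shell_ge.
have fin_P (m : nat) (Q : probability 'rV[R]_m R) Z : measurable Z -> Q Z = (fine (Q Z))%:E.
  by move=> mZ; rewrite fineK// fin_num_measure.
rewrite (fin_P _ (sigma n) _ (@mA n)) (fin_P _ (gam _) _ mS') (fin_P _ (gam _) _ mG) -EFinM lee_fin in sG.
rewrite (fin_P _ (sigma n) _ (@mA n)) lee_fin.
move: sG gS gG; set p := fine (sigma n _); set gs := fine (gam _ S); set gg := fine (gam _ G).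
move=> sG gS gG; have p0 : 0 <= p by exact: fine_ge0.
pose X := (a ^+ 2 - 1) * (1 + dl) / 2 * N.
have aE : a ^+ (n * d) = expR (N * ln a) by rewrite expRM_natl lnK// posrE.
have gl0 : 0 <= expR (l * T / 2) by exact: expR_ge0.
have main : p * expR (N * ln a - X + l * T / 2) <= 2 * K.
  have h : p * (2^-1 * a ^+ (n * d) * expR (- X)) <= gg by apply: le_trans sG; rewrite ler_wpM2l.
  have := le_trans (ler_wpM2l gl0 h) gG.
  rewrite aE -[N * ln a - X]/(N * ln a + - X) !expRD => h3.
  by rewrite -(ler_pM2l (_ : 0 < 2^-1 :> R)) ?invr_gt0// mulKf//; apply: le_trans h3; rewrite le_eqVlt; apply/orP; left; apply/eqP; ring.
(* The terms free of [dl] and [k] match exactly: (a^2 - 1) / 2 - (a - 1)^2 / 2 - a r / (2 d) = a q -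
   1. *)
have expo : - ((d%:R * (a * q - 1 - ln a) + k) * n%:R) <= N * ln a - X + l * T / 2.
  have NE : N = n%:R * d%:R by rewrite /N natrM.
  rewrite -subr_ge0.
  have -> : N * ln a - X + l * T / 2 - - ((d%:R * (a * q - 1 - ln a) + k) * n%:R) =
    n%:R * (k - dl * d%:R * (a ^+ 2 - 1 + t0 + (1 - dl) * C1) / 2).
    by rewrite /X /T /l NE /t0 /q; field; rewrite gt_eqF.
  apply: mulr_ge0 => //; rewrite subr_ge0; apply: le_trans dlD.
  rewrite /D mulrA -mulrA; apply: ler_wpM2l; first by rewrite mulr_ge0// ltW.
  have : (1 - dl) * C1 <= C1 by nra.
  by have := sqr_ge0 a; lra.
rewrite -(ler_pM2r (expR_gt0 (N * ln a - X + l * T / 2))); apply: (le_trans main).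
have K20 : 0 <= 2 * K by rewrite mulr_ge0// ltW.
rewrite -[leRHS]mulrA -expRD ler_peMr// -[leLHS]expR0 ler_expR; lra.
Unshelve. all: by end_near.
Qed.
End sphere_deviation.
Section rate.
Variables (R : realType) (d : nat).
Hypothesis d0 : (0 < d)%N.
Local Notation gam n := (std_gauss R n).
Variables (sigma : forall n, probability 'rV[R]_(n * d) R).
Hypothesis sigma_unif : forall n, (0 < n)%N ->
  uniform_on_sphere (Num.sqrt (d * n)%:R) (sigma n).
Variables (A : forall n, set 'rV[R]_(n * d)) (r : R).
Hypotheses (mA : forall n, measurable (@A n)) (r0 : 0 < r).
Hypothesis far : forall e, 0 < e -> exists E : forall n, set 'rV[R]_(n * d), likely E /\
  forall n (u y : 'rV[R]_(n * d)), (0 < n)%N -> @A n u -> enorm u = Num.sqrt (d * n)%:R ->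
  E n y -> n%:R * (r - e) <= enorm (u - y) ^+ 2.

Lemma sphere_deviation :
  (limn_esup (fun n => (n%:R^-1)%:E * lne (sigma n (@A n))) <= - alpha d r)%E.
Proof.
have dR : 0 < d%:R :> R by rewrite ltr0n.
have tilt := sphere_deviation_tilt d0 sigma_unif mA r0 far.
have [r2d|r2d] := ltP r (2 * d%:R).
  apply: le_trans (alpha_le_ln d0 r0 r2d).
  set q := 1 - r / _.
  have q0 : 0 < q by rewrite subr_gt0 ltr_pdivrMr ?mul1r// mulr_gt0.
  have q1 : q <= 1 by rewrite gerBl divr_ge0// ?ltW// mulr_gt0.
  have a1 : 1 <= q^-1 by rewrite invf_ge1.
  by have := tilt _ a1; rewrite -/q mulVf ?gt_eqF// subrr sub0r lnV ?posrE// opprK.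
(* Here [q <= 0], so the bound is at most [- d ln a]; the choice of [a] below makes this [- |M|] for
   any given [M]. *)
suff -> : limn_esup (fun n => (n%:R^-1)%:E * lne (sigma n (@A n)))%E = -oo%E by exact: leNye.
apply: eq_ninfty => M; pose a := expR (`|M| / d%:R).
have a1 : 1 <= a by rewrite -expR0 ler_expR divr_ge0// ltW.
apply: (le_trans (tilt a a1)); rewrite lee_fin expRK.
have q0 : 1 - r / (2 * d%:R) <= 0.
  by rewrite subr_le0 ler_pdivlMr ?mul1r// mulr_gt0.
have : d%:R * (a * (1 - r / (2 * d%:R)) - 1 - `|M| / d%:R) <= d%:R * (- (`|M| / d%:R)).
  apply: ler_wpM2l; first exact: ltW.
  have : a * (1 - r / (2 * d%:R)) <= 0 by rewrite mulr_ge0_le0// (le_trans ler01).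
  lra.
move=> /le_trans; apply; rewrite mulrN mulrCA mulfV ?gt_eqF// mulr1.
by rewrite lerNl (le_trans (ler_norm _))// normrN.
Qed.
End rate.

Lemma sphere_deviation_RV (R : realType) (d : nat) (d0 : (0 < d)%N) (disp : nat -> measure_display)
    (Omega : forall n, measurableType (disp n)) (P : forall n, probability (Omega n) R)
    (U : forall n, {RV (P n) >-> 'rV[R]_(n * d)})
    (U_unif : forall n, (0 < n)%N ->
       uniform_on_sphere (Num.sqrt (d * n)%:R) (distribution (P n) (U n)))
    (A : forall n, set 'rV[R]_(n * d)) (r : R) : (forall n, measurable (A n)) -> 0 < r ->
  (forall e, 0 < e -> exists E : forall n, set 'rV[R]_(n * d), likely E /\
    forall n (u y : 'rV[R]_(n * d)), (0 < n)%N -> A n u -> enorm u = Num.sqrt (d * n)%:R ->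
    E n y -> n%:R * (r - e) <= enorm (u - y) ^+ 2) ->
  (limn_esup (fun n => (n%:R^-1)%:E * lne (P n [set w | A n (U n w)])) <= - alpha d r)%E.
Proof. by move=> mA r0 far; exact: (sphere_deviation d0 U_unif mA r0 far). Qed.

(** * Centered blocks and measurability of the Wasserstein event *)

Section application.
Variables (R : realType) (d : nat).
Local Notation gam n := (std_gauss R n).
Definition centered n (u : 'rV[R]_(n * d)) (i : 'I_n) : 'rV[R]_d := block u i - average (block u).

Lemma averageE n (x : 'I_n -> 'rV[R]_d) k : average x 0 k = n%:R^-1 * \sum_(i < n) x i 0 k.
Proof. by rewrite /average mxE summxE. Qed.

Let sum_cst n (x : R) : \sum_(i < n) x = n%:R * x.
Proof. by rewrite sumr_const card_ord mulr_natl. Qed.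

(** In each coordinate the right side exceeds the left by n (c - b)^2, where [c] and [b] are the
    averages of [u] and [y]. Thus [u] is centered while [y] is not, at the cost of the average of
    [y], which is typically small. *)
Lemma sum_centered_sub_sqr n (u y : 'rV[R]_(n * d)) :
  \sum_(i < n) enorm (centered u i - block y i) ^+ 2 <=
  enorm (u - y) ^+ 2 + n%:R * enorm (average (block y)) ^+ 2.
Proof.
rewrite enorm_blocks enorm_sqr mulr_sumr.
rewrite (eq_bigr (fun i => \sum_(k < d) (centered u i - block y i) 0 k ^+ 2)); last by move=> i _; rewrite enorm_sqr.
rewrite [X in _ <= X + _](eq_bigr (fun i => \sum_(k < d) (block u i 0 k - block y i 0 k) ^+ 2)); last first.
  by move=> i _; rewrite enorm_sqr; apply: eq_bigr => k _; rewrite !blockE sub_mxE.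
rewrite exchange_big [X in _ <= X + _]exchange_big -big_split/=; apply: ler_sum => k _.
case: n => [|n] in u y *; first by rewrite !big_ord0 mul0r addr0.
have n0 : n.+1%:R != 0 :> R by rewrite pnatr_eq0.
set c := average (block u) 0 k; set b := average (block y) 0 k.
have uE : \sum_(i < n.+1) block u i 0 k = n.+1%:R * c by rewrite /c averageE mulVKf.
have yE : \sum_(i < n.+1) block y i 0 k = n.+1%:R * b by rewrite /b averageE mulVKf.
have -> : \sum_(i < n.+1) (centered u i - block y i) 0 k ^+ 2 =
    \sum_(i < n.+1) (block u i 0 k - block y i 0 k) ^+ 2 -
    2 * c * (\sum_(i < n.+1) block u i 0 k - \sum_(i < n.+1) block y i 0 k) + n.+1%:R * c ^+ 2.
  rewrite -sumrB mulr_sumr -(sum_cst n.+1) -sumrB -big_split/=; apply: eq_bigr => i _.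
  by rewrite /centered !sub_mxE -/c; ring.
rewrite uE yE -subr_ge0.
rewrite (_ : _ - _ = n.+1%:R * (c - b) ^+ 2); last by ring.
by rewrite mulr_ge0// sqr_ge0.
Qed.

Lemma measurable_centered n (i : 'I_n) : measurable_fun setT (fun u : 'rV[R]_(n * d) => centered u i).
Proof.
have mb j k : measurable_fun setT (fun u : 'rV[R]_(n * d) => block u j 0 k).
  exact: (measurableT_comp (@measurable_coord R 1 d 0 k) (@measurable_block R n d j)).
apply: measurable_fun_mx => k j; rewrite ord1.
rewrite (_ : (fun x => _) = (fun u : 'rV[R]_(n * d) =>
  block u i 0 j - n%:R^-1 * \sum_(l < n) block u l 0 j)).
  by apply: measurable_funB => //; apply: measurable_funM => //; exact: measurable_sum.
by apply/funext => u; rewrite /centered sub_mxE averageE.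
Qed.

Lemma enorm_block_le n (u : 'rV[R]_(n * d)) i : enorm (block u i) <= enorm u.
Proof.
rewrite -(ler_pXn2r (_ : 0 < 2)%N) ?nnegrE ?enorm_ge0// enorm_blocks (bigD1 i)//= lerDl.
by apply: sumr_ge0 => j _; exact: sqr_ge0.
Qed.

(** Block and average each contribute one [enorm (u - v)]. The estimate serves the measurability of
    the [W1] event. *)
Lemma centered_dist n (u v : 'rV[R]_(n.+1 * d)) :
  n.+1%:R^-1 * \sum_(i < n.+1) enorm (centered u i - centered v i) <= 2 * enorm (u - v).
Proof.
have blockB i : block u i - block v i = block (u - v) i.
  by apply/rowP => k; rewrite sub_mxE !blockE sub_mxE.
have avgB : average (block u) - average (block v) = average (block (u - v)).
  rewrite /average -scalerBr -sumrB; congr (_ *: _); apply: eq_bigr => i _; exact: blockB.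
have avg_le : enorm (average (block (u - v))) <= enorm (u - v).
  rewrite /average enormZ ger0_norm ?invr_ge0// mulrC ler_pdivrMr ?ltr0n//.
  apply: (@le_trans _ _ (\sum_(i < n.+1) enorm (block (u - v) i))).
    elim/big_ind2: _ => [|a b c e h1 h2|//]; last by rewrite (le_trans (enormD _ _))// lerD.
    by rewrite /enorm big1 ?sqrtr0// => k _; rewrite mxE expr0n.
  rewrite mulrC -(sum_cst n.+1); apply: ler_sum => i _.
  exact: enorm_block_le.
rewrite mulrC ler_pdivrMr ?ltr0n// mulrC -(sum_cst n.+1).
apply: ler_sum => i _; rewrite /centered.
rewrite (_ : _ - _ = block (u - v) i - average (block (u - v))).
  by rewrite (le_trans (enormB _ _))// mulr_natl mulr2n lerD// enorm_block_le.
by rewrite -blockB -avgB; apply/rowP => k; rewrite !sub_mxE; ring.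
Qed.

Lemma W1_ge0 (mu nu : set 'rV[R]_d -> \bar R) : (0 <= W1 mu nu)%E.
Proof.
by apply: le_ereal_inf_tmp => _ [pi _ <-]; apply: integral_ge0 => z _; rewrite lee_fin enorm_ge0.
Qed.

Lemma W1_eqr (mu : set 'rV[R]_d -> \bar R) (nu nu' : probability 'rV[R]_d R) :
  (forall B, measurable B -> nu B = nu' B) -> W1 mu nu = W1 mu nu'.
Proof.
move=> e; congr ereal_inf; apply/seteqP; split=> _ [pi cpl <-]; exists pi => // B mB.
  by rewrite -e//; exact: cpl.
by have := cpl _ mB; rewrite e.
Qed.

Lemma measurable_rV0 (A : set 'rV[R]_0) : measurable A.
Proof.
have h (u : 'rV[R]_0) : u = 0 by apply/rowP => -[].
have [A0|nA0] := pselect (A 0).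
  have -> : A = setT by apply/seteqP; split=> // u _; rewrite (h u).
  exact: measurableT.
have -> : A = set0 by apply/seteqP; split=> // u Au; apply: nA0; rewrite -(h u).
exact: measurable0.
Qed.

(** The complement is open. Moving the atoms by [u - v] changes the distance by at most
    [2 * enorm (u - v)], so a ball of radius [e] around [v] stays in the complement when the value
    at [v] plus [2 * e] is at most [c]. *)
Lemma measurable_W1_ge (nu : probability 'rV[R]_d R) n (c : R) : measurable
  [set u : 'rV[R]_(n * d) | (c%:E <= W1 (centering (empirical (block u))) nu)%E].
Proof.
case: n => [|n].
  exact: measurable_rV0.
pose w (u : 'rV[R]_(n.+1 * d)) := W1 (empirical (centered u)) nu.
have wE (u : 'rV[R]_(n.+1 * d)) : W1 (centering (empirical (block u))) nu = w u.
  by rewrite centering_empirical.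
rewrite -[X in measurable X]setCK; apply: measurableC; apply: open_measurable_mx.
rewrite (_ : ~` _ = \bigcup_(z in [set z : 'rV[R]_(n.+1 * d) * R |
   (0 < z.2)%R /\ (w z.1 + (2 * z.2)%:E <= c%:E)%E]) [set u | enorm (u - z.1) < z.2]).
  by apply: bigcup_open => z _; exact: open_enorm_ball.
apply/seteqP; split=> u /=.
  move=> /negP; rewrite -ltNge wE => wc.
  have w0 : (0 <= w u)%E by exact: W1_ge0.
  have wfin : w u = (fine (w u))%:E.
    by rewrite fineK// ge0_fin_numE// (lt_trans wc)// ltry.
  have wc' : fine (w u) < c by rewrite -lte_fin -wfin.
  exists (u, (c - fine (w u)) / 2) => /=.
    split; first by lra.
    by rewrite wfin -EFinD lee_fin; lra.
  rewrite subrr /enorm big1 ?sqrtr0; first by lra.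
  by move=> k _; rewrite mxE expr0n.
move=> [[v e] /= [e0 ve] uv]; apply/negP; rewrite -ltNge wE; apply: (lt_le_trans _ ve).
apply: (le_lt_trans (W1_empirical_move (centered u) (centered v) nu)).
have wfin : w v \is a fin_num.
  rewrite ge0_fin_numE ?W1_ge0//; apply: le_lt_trans (ltry c); apply: le_trans ve.
  by rewrite leeDl// lee_fin mulr_ge0// ltW.
rewrite lteD2lE// lte_fin; apply: (le_lt_trans (centered_dist u v)).
by rewrite ltr_pM2l.
Qed.
End application.

(** * Both bad events keep away from typical Gaussian vectors *)

Section far.
Variables (R : realType) (d : nat).
Hypothesis d0 : (0 < d)%N.
Local Notation gam n := (std_gauss R n).

(** The cost inequality is summed over the pairs of a centered block of [u] and a block of [y]. One
    half of [e] pays for the law of large numbers for [g], the other for the average of [y]. *)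
Lemma far_of_cost (f g : 'rV[R]_d -> R) (r M : R) : continuous g -> (forall x, `|g x| <= M) ->
  (forall x y, f x - g y <= enorm (x - y) ^+ 2) -> forall e, 0 < e ->
  exists E : forall n, set 'rV[R]_(n * d), likely E /\
  forall n (u y : 'rV[R]_(n * d)), (0 < n)%N ->
  (\int[gam d]_x g x)%R + r <= n%:R^-1 * \sum_(i < n) f (centered u i) ->
  E n y -> n%:R * (r - e) <= enorm (u - y) ^+ 2.
Proof.
move=> cg gM fg e e0; have e2 : 0 < e / 2 by rewrite divr_gt0.
have mg : measurable_fun setT g by exact: continuous_measurable_mx_real.
have s0 : 0 < Num.sqrt (e / 2) by rewrite sqrtr_gt0.
have [E [lE hE]] := likely_mean d0 s0.
have lG := likely_lln mg gM e2.
exists (fun n => E n `&` [set y | \sum_(i < n) g (block y i) < ((\int[gam d]_x g x)%R + e / 2) * n%:R]).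
split; first exact: likelyI.
move=> n u y n0 hu [Ey Gy]; have nR : 0 < n%:R :> R by rewrite ltr0n.
rewrite -(ler_pM2l nR) mulrA mulfV ?mul1r ?gt_eqF// in hu.
have h1 : \sum_(i < n) f (centered u i) - \sum_(i < n) g (block y i) <=
    \sum_(i < n) enorm (centered u i - block y i) ^+ 2.
  by rewrite -sumrB; apply: ler_sum => i _; exact: fg.
have h2 := sum_centered_sub_sqr u y.
have h3 : n%:R * enorm (average (block y)) ^+ 2 <= n%:R * (e / 2).
  rewrite ler_pM2l// -[leRHS](sqr_sqrtr (ltW e2)).
  by rewrite lerXn2r ?nnegrE ?enorm_ge0 ?sqrtr_ge0//; exact: hE.
move: Gy => /= Gy; lra.
Qed.

Lemma cauchy_schwarz_sum n (a : 'I_n -> R) : (\sum_(i < n) a i) ^+ 2 <= n%:R * \sum_(i < n) a i ^+ 2.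
Proof.
case: n a => [|n] a; first by rewrite !big_ord0 expr0n mul0r.
have n0 : n.+1%:R != 0 :> R by rewrite pnatr_eq0.
set S := \sum_(i < n.+1) a i; pose m := S / n.+1%:R.
have : 0 <= \sum_(i < n.+1) (a i - m) ^+ 2 by apply: sumr_ge0 => i _; exact: sqr_ge0.
rewrite (eq_bigr (fun i => a i ^+ 2 - 2 * m * a i + m ^+ 2)); last by move=> i _; ring.
rewrite big_split/= sumrB -mulr_sumr sumr_const card_ord -mulr_natl -/S.
rewrite -(pmulr_rge0 _ (_ : 0 < n.+1%:R :> R)) ?ltr0n// => h.
rewrite -subr_ge0; apply: le_trans h _; rewrite le_eqVlt; apply/orP; left; apply/eqP.
by rewrite -mulr_natl /m; field.
Qed.

(** [W1_empirical_move] compares the centered [u] with [y], whose empirical measure is within [t] of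
    the Gaussian. The mean distance between blocks is thus at least [r - t], and Cauchy-Schwarz
    passes to squares. *)
Lemma far_of_W1 (r : R) : 0 < r -> forall e, 0 < e ->
  exists E : forall n, set 'rV[R]_(n * d), likely E /\
  forall n (u y : 'rV[R]_(n * d)), (0 < n)%N ->
  (r%:E <= W1 (centering (empirical (block u))) (gam d))%E ->
  E n y -> n%:R * (r ^+ 2 - e) <= enorm (u - y) ^+ 2.
Proof.
(* Since (r - t)^2 - t^2 = r^2 - 2 r t, this [t] loses at most [e]; [t <= r] permits squaring. *)
move=> r0 e e0; pose t := Num.min r (e / (2 * r)).
have t0 : 0 < t by rewrite lt_min r0 divr_gt0// mulr_gt0.
have tr : t <= r by rewrite ge_min lexx.
have te : 2 * r * t <= e.
  by rewrite mulrC -ler_pdivlMr ?mulr_gt0// ge_min lexx orbT.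
have [E [lE hE]] := likely_mean d0 t0.
have [F [lF hF]] := W1_lln d t0.
have h2 : 0 < (2^-1 : R) < 1 by apply/andP; split; lra.
have lS := likely_shell d0 h2.
exists (fun n => E n `&` (F n `&` @shell R (n * d) 1 2^-1)); split.
  by do 2 apply: likelyI => //.
move=> [//|n] u y _ hu [Ey [Fy /andP[_ Sy]]].
have nR : 0 < n.+1%:R :> R by rewrite ltr0n.
rewrite expr1n mul1r in Sy.
have y2 : enorm y ^+ 2 <= 2 * (n.+1 * d)%:R.
  by apply: (le_trans Sy); rewrite ler_wpM2r//; lra.
have := le_trans hu _; rewrite centering_empirical// => /(_ _ (W1_empirical_move _ (block y) _)).
move=> /le_trans /(_ (leeD2r _ (hF n.+1 y isT Fy y2))).
rewrite -EFinD lee_fin => h1.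
set s := \sum_(i < n.+1) enorm (centered u i - block y i) ^+ 2.
have h3 : n.+1%:R * (r - t) ^+ 2 <= s.
  have h4 : n.+1%:R * (r - t) <= \sum_(i < n.+1) enorm (centered u i - block y i).
    by rewrite mulrC -ler_pdivlMr// mulrC lerBlDl.
  rewrite -(ler_pM2l nR); apply: le_trans (cauchy_schwarz_sum _).
  rewrite mulrA -expr2 -exprMn lerXn2r ?nnegrE ?mulr_ge0 ?subr_ge0//.
  by apply: sumr_ge0 => i _; exact: enorm_ge0.
have h4 := sum_centered_sub_sqr u y.
have h5 : n.+1%:R * enorm (average (block y)) ^+ 2 <= n.+1%:R * t ^+ 2.
  by rewrite ler_pM2l// lerXn2r ?nnegrE ?enorm_ge0 ?(ltW t0)//; exact: hE.
have h6 : n.+1%:R * (2 * r * t) <= n.+1%:R * e by rewrite ler_pM2l.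
rewrite -/s in h4; lra.
Qed.
End far.

Theorem proposition5p3 (R : realType) (d : nat) (d_gt0 : (0 < d)%N)
    (disp : nat -> measure_display)
    (Omega : forall n : nat, measurableType (disp n))
    (P : forall n : nat, probability (Omega n) R)
    (U : forall n : nat, {RV (P n) >-> 'rV[R]_(n * d)})
    (U_unif : forall n : nat, (0 < n)%N ->
       uniform_on_sphere (Num.sqrt (d * n)%:R) (distribution (P n) (U n)))
    (gamma : probability 'rV[R]_d R) (gamma_std : standard_gaussian gamma)
    (r : R) (r_gt0 : 0 < r) :
  (forall f g : 'rV[R]_d -> R,
     bounded_fun f -> bounded_fun g -> continuous f -> continuous g ->
     (forall x y : 'rV[R]_d, f x - g y <= enorm (x - y) ^+ 2) ->
     (limn_esup (fun n : nat =>
        (n%:R^-1)%:E *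
        lne (P n [set w | (n%:R^-1 * (\sum_(i < n)
                             f (block (U n w) i - average (block (U n w)))) >=
                           \int[gamma]_x g x + r)%R]))
      <= - alpha d r)%E) /\
  (limn_esup (fun n : nat =>
     (n%:R^-1)%:E *
     lne (P n [set w | W1 (centering (empirical (block (U n w)))) gamma >= r%:E]))
   <= - alpha d (r ^+ 2))%E.
Proof.
(* The given [gamma] is replaced by [std_gauss R d], in the integral of [g] and in the second
   marginal of couplings. *)
have gE B : measurable B -> gamma B = std_gauss R d B.
  by apply: standard_gaussian_unique => //; exact: std_gaussP.
split.
  move=> f g _ [M [_ gM]] cf cg fg.
  have intg : (\int[gamma]_x g x = \int[std_gauss R d]_x g x)%R.
    by congr fine; apply: eq_measure_integral => B mB _; exact: gE.
  rewrite intg.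
  pose A n := [set u : 'rV[R]_(n * d) | (\int[std_gauss R d]_x g x)%R + r <=
    n%:R^-1 * \sum_(i < n) f (centered u i)].
  apply: (sphere_deviation_RV d_gt0 U_unif (A := A)) => //.
    move=> n; rewrite -[X in measurable X]setTI; apply: measurable_fun_ler => //.
    apply: measurable_funM => //; apply: measurable_sum => i.
    exact: (measurableT_comp (continuous_measurable_mx_real cf) (@measurable_centered R d n i)).
  move=> e e0; have gM' x : `|g x| <= `|M| + 1.
    by apply: gM => //; rewrite (le_lt_trans (ler_norm _))// ltrDl.
  have [E [lE hE]] := far_of_cost d_gt0 r cg gM' fg e0.
  by exists E; split=> // n u y n0 Au _; exact: hE.
pose A n := [set u : 'rV[R]_(n * d) | (r%:E <= W1 (centering (empirical (block u))) gamma)%E].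
have mA n : measurable (@A n) by exact: measurable_W1_ge.
apply: (sphere_deviation_RV d_gt0 U_unif mA (exprn_gt0 2 r_gt0)).
move=> e e0; have [E [lE hE]] := far_of_W1 d_gt0 r_gt0 e0.
by exists E; split=> // n u y n0 Au _; apply: hE => //; rewrite -(W1_eqr _ gE).
Qed.
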